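(* Let $\mathcal{T}$ be any triangulation of the annulus with $n>0$ marked points on the outer boundary component and $m>0$ marked points on the inner boundary component, and let $D(\mathcal{T})$ be the corresponding weak Postnikov diagram of degree $2$. Then the boundary algebra $B_{D(\mathcal{T})}$ is isomorphic to $\Lambda_{n,m}$.
   Context: **Weak Postnikov diagrams.** Let $(X,M)$ be a marked oriented surface with nonempty boundary, all marked points on the boundary, at least one on each boundary component. A weak Postnikov diagram on $(X,M)$ consists of directed curves (strands) in $X$, considered up to isotopy, one starting at each marked point and ending on the same boundary component, with exactly one strand starting and exactly one ending at each marked point, such that: (a1) only two strands can cross at a given point, transversely; (a2) there are finitely many crossings; (a3) along each strand the strands crossing it alternate between crossing left to right and right to left (the strands ending and starting at a marked point are regarded as crossing there). A weak Postnikov diagram has degree $2$ if each strand ends at the marked point two steps on from its starting point, on the same boundary component, moving along that component with the surface on the right. **The diagram $D(\mathcal{T})$.** A triangulation $\mathcal{T}$ has as edges its internal arcs and the boundary intervals between consecutive marked points. In each triangle, with corners $P_1,P_2,P_3$ in anticlockwise order (indices mod 3), draw for each $i$ a directed segment parallel to the edge $P_iP_{i+1}$, starting at a point of the edge $P_{i-1}P_i$ close to $P_i$ and ending at a point of the edge $P_{i+1}P_{i+2}$ close to $P_{i+1}$; the three segments cross pairwise once. If an edge of the triangle is a boundary edge, any intersection of a segment with it is slid along the edge to the adjacent corner. The segments in adjacent triangles are joined along internal edges; the resulting strands form $D(\mathcal{T})$, which is a weak Postnikov diagram of degree $2$. **Dimer algebra and boundary algebra.** For such a $D$, a region of the complement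 of the strands is alternating if the strands on its boundary alternate in orientation, and oriented if they are all clockwise or all anticlockwise. The quiver $Q(D)$ has a vertex for each alternating region, and an arrow for each crossing and each marked point (those at marked points are the boundary arrows; others are internal). At an interior crossing the arrow goes from the alternating region between the two incoming strand ends to that between the two outgoing strand ends; at a marked point it joins the two adjacent boundary alternating regions, from the one next to the incoming strand to the one next to the outgoing strand. Faces correspond to oriented regions ($Q_2^+$ anticlockwise, $Q_2^-$ clockwise), with boundary the oriented cycle of arrows around the region. For an internal arrow $\alpha$ let $F^\pm\in Q_2^\pm$ be the faces containing it, with boundaries $\alpha p_\alpha^\pm$. The dimer algebra is $A_D=\mathbb{C}Q(D)/(p_\alpha^+=p_\alpha^-:\alpha\text{ internal})$. Boundary vertices are the alternating regions having a boundary interval between marked points as an edge; if $e$ is the sum of their idempotents, the boundary algebra is $B_D=eA_De$. **The algebra $\Lambda_{n,m}$.** $\Lambda_{n,m}$ is the quotient of the path algebra over $\mathbb{C}$ (paths composed right to left) of the following quiver. Vertices: $1,\dots,n$ (indices mod $n$) and $\overline1,\dots,\overline m$ (indices mod $m$). Arrows: $x_i\colon i-1\to i$ and $y_i\colon i\to i-1$ for $i\in\mathbb{Z}_n$; $\overline{x}_i\colon\overline{i}\to\overline{i-1}$ and $\overline{y}_i\colon\overline{i-1}\to\overline{i}$ for $i\in\mathbb{Z}_m$; $r\colon1\to\overline1$; $s\colon\overline m\to n$. Omitting subscripts determined by the starting vertex, the relations are: $xy=yx$ at each vertex $1,\dots,n$; $\overline x\,\overline y=\overline y\,\overline x$ at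 each vertex $\overline1,\dots,\overline m$; $$y^2=x^{n-1-i}\,s\,\overline{x}^{\,m+1}\,r\,x^{i}$$ at each vertex among $1,\dots,n$, where $i\ge0$ is minimal such that $x^i$ started at that vertex ends at vertex $1$; $$\overline{y}^{\,2}=\overline{x}^{\,m-1-i}\,r\,x^{n+1}\,s\,\overline{x}^{\,i}$$ at each vertex among $\overline1,\dots,\overline m$, where $i\ge0$ is minimal such that $\overline{x}^{\,i}$ started at that vertex ends at $\overline m$; and $$r=\overline{x}^{\,m}rx^n,\quad s=x^ns\,\overline{x}^{\,m},\quad yxs=s\,\overline{x}\,\overline{y},\quad \overline{x}\,\overline{y}\,r=ryx.$$ *)

(* Defs.v *)
From HB Require Import structures.
From mathcomp Require Import all_boot all_order all_algebra finmap.
From mathcomp Require Import boolp.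
From mathcomp.multinomials Require Import monalg.

Set Implicit Arguments.
Unset Strict Implicit.
Unset Printing Implicit Defensive.

Import GRing.Theory.
Local Open Scope ring_scope.

Record quiver := Quiver {
  vertex : finType;
  arrow : finType;
  qsrc : arrow -> vertex;
  qtgt : arrow -> vertex
}.

Section Paths.
Variable Q : quiver.

(* A path is its starting vertex together with its arrows in the order in
   which they are traversed, [:: a1; ...; ak] being the path ak ... a1 when
   written from right to left. *)
Fixpoint is_qpath (v : vertex Q) (w : seq (arrow Q)) : bool :=
  if w is a :: w' then (qsrc a == v) && is_qpath (qtgt a) w' else true.

Definition qend (v : vertex Q) (w : seq (arrow Q)) : vertex Q :=
  last v (map (@qtgt Q) w).

Record qpath := QPath {
  qpath_val : vertex Q * seq (arrow Q);
  _ : is_qpath qpath_val.1 qpath_val.2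
}.
HB.instance Definition _ := [isSub for qpath_val].
HB.instance Definition _ := [Choice of qpath by <:].

Definition path_src (p : qpath) : vertex Q := (val p).1.
Definition path_tgt (p : qpath) : vertex Q := qend (val p).1 (val p).2.

Lemma is_qpath_cat v w1 w2 :
  is_qpath v (w1 ++ w2) = is_qpath v w1 && is_qpath (qend v w1) w2.
Proof.
elim: w1 v => //= a w IH v; rewrite IH andbA; congr (_ && _).
Qed.

Lemma qend_cat v w1 w2 : qend v (w1 ++ w2) = qend (qend v w1) w2.
Proof. by rewrite /qend map_cat last_cat. Qed.

Lemma qpath_comp_subproof (q p : qpath) : path_src q = path_tgt p ->
  is_qpath (val p).1 ((val p).2 ++ (val q).2).
Proof.
move=> e; rewrite is_qpath_cat (valP p) /= -[qend _ _]/(path_tgt p) -e.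
exact: (valP q).
Qed.

(* The composite q p, first p and then q. *)
Definition qpath_comp (q p : qpath) : option qpath :=
  if path_src q =P path_tgt p is ReflectT e then
    Some (@QPath ((val p).1, (val p).2 ++ (val q).2) (qpath_comp_subproof e))
  else None.

Definition vertex_path (v : vertex Q) : qpath :=
  @QPath (v, [::]) isT.

Lemma arrow_path_subproof (a : arrow Q) : is_qpath (qsrc a) [:: a].
Proof. by rewrite /= eqxx. Qed.

Definition arrow_path (a : arrow Q) : qpath :=
  @QPath (qsrc a, [:: a]) (arrow_path_subproof a).

Lemma qpath_compP (q p : qpath) :
  (exists2 r, qpath_comp q p = Some r &
     [/\ path_src q = path_tgt p, val r = ((val p).1, (val p).2 ++ (val q).2),
         path_src r = path_src p & path_tgt r = path_tgt q]) \/
  (qpath_comp q p = None /\ path_src q != path_tgt p).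
Proof.
rewrite /qpath_comp; case: eqP => [e|ne]; [left|by right; split=> //; apply/eqP].
eexists; first by reflexivity.
split=> //; rewrite /path_tgt /= qend_cat.
by rewrite -[qend (val p).1 _]/(path_tgt p) -e.
Qed.

Lemma qpath_compA (r q p : qpath) :
  obind (fun s => qpath_comp r s) (qpath_comp q p) =
  obind (fun s => qpath_comp s p) (qpath_comp r q).
Proof.
case: (qpath_compP q p) => [[s -> [eqp vs ss ts]]|[-> nqp]];
case: (qpath_compP r q) => [[u -> [erq vu su tu]]|[-> nrq]] //=.
- case: (qpath_compP r s) => [[x -> [_ vx _ _]]|[_]]; last by rewrite ts erq eqxx.
  case: (qpath_compP u p) => [[y -> [_ vy _ _]]|[_]]; last by rewrite su eqp eqxx.
  by congr Some; apply: val_inj; rewrite vx vy vs vu /= catA.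
- by case: (qpath_compP r s) => [[x _ [e _ _ _]]|[-> //]]; rewrite e ts eqxx in nrq.
- by case: (qpath_compP u p) => [[x _ [e _ _ _]]|[-> //]]; rewrite -su e eqxx in nqp.
Qed.

Lemma vertex_path_compl v p :
  qpath_comp (vertex_path v) p = if v == path_tgt p then Some p else None.
Proof.
case: (qpath_compP (vertex_path v) p) => [[r -> [e vr _ _]]|[-> /negPf]].
  by rewrite -e eqxx; congr Some; apply: val_inj; rewrite vr cats0 -surjective_pairing.
by rewrite /path_src /= => ->.
Qed.

Lemma vertex_path_compr v p :
  qpath_comp p (vertex_path v) = if v == path_src p then Some p else None.
Proof.
case: (qpath_compP p (vertex_path v)) => [[r -> [e vr _ _]]|[-> /negPf]].
  rewrite e eqxx; congr Some; apply: val_inj; rewrite vr /=.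
  by rewrite -[v]/(path_tgt (vertex_path v)) -e -surjective_pairing.
by rewrite eq_sym => ->.
Qed.
End Paths.

Lemma malg_scaleU (T : choiceType) (K : nzRingType) (c : K) (p : T) :
  c *: (<< p >> : {malg K[T]}) = << c *g p >>.
Proof. by apply/malgP => q; rewrite mcoeffZ !mcoeffU mulrnAr mulr1. Qed.

Lemma sandwichl (A : pzRingType) (e a : A) : e * e = e -> e * (e * a * e) = e * a * e.
Proof. by move=> ee; rewrite !mulrA ee. Qed.

Lemma sandwichr (A : pzRingType) (e a : A) : e * e = e -> e * a * e * e = e * a * e.
Proof. by move=> ee; rewrite -mulrA ee. Qed.

(* The algebras below are equipped with a pzRingType and an lmodType structure
   rather than with an algType structure, which would require 1 != 0; the
   compatibility of scaling with products is in the lemmas *_scalerAl and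
   *_scalerAr.  Products of paths are written from right to left.  The keys
   only prevent unification from unfolding the operations. *)
Section PathAlgebra.
Variables (K : fieldType) (Q : quiver).

Definition path_algebra : Type := {malg K[qpath Q]}.
HB.instance Definition _ := GRing.Lmodule.on path_algebra.

Implicit Types f g h : path_algebra.

Definition of_path (p : qpath Q) : path_algebra := << p >>.
Definition of_opath (p : option (qpath Q)) : path_algebra :=
  if p is Some p then of_path p else 0.

Fact path_algebra_key : unit. Proof. by []. Qed.

Section Extend.
Variables (V : lmodType K) (phi : qpath Q -> V).
Definition path_ext : path_algebra -> V := locked_with path_algebra_key
  (fun f => \sum_(p <- msupp f) mcoeff p f *: phi p).

Lemma path_extE f : path_ext f = \sum_(p <- msupp f) mcoeff p f *: phi p.
Proof. by rewrite /path_ext unlock. Qed.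

Lemma path_extw (d : {fset qpath Q}) f : fsubset (msupp f) d ->
  path_ext f = \sum_(p <- d) mcoeff p f *: phi p.
Proof.
move=> sd; rewrite path_extE; apply: big_fset_incl => // p _ /mcoeff_outdom ->.
by rewrite scale0r.
Qed.

Lemma path_extD f g : path_ext (f + g) = path_ext f + path_ext g.
Proof.
pose d := fsetU (msupp f) (msupp g).
rewrite (@path_extw d f) ?fsubsetUl // (@path_extw d g) ?fsubsetUr //.
rewrite (@path_extw d) ?msuppD_le // -big_split /=.
by apply: eq_bigr => p _; rewrite mcoeffD scalerDl.
Qed.

Lemma path_extZ c f : path_ext (c *: f) = c *: path_ext f.
Proof.
rewrite (@path_extw (msupp f)) ?msuppZ_le // path_extE scaler_sumr.
by apply: eq_bigr => p _; rewrite mcoeffZ scalerA.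
Qed.

Lemma path_ext_path p : path_ext (of_path p) = phi p.
Proof.
rewrite (@path_extw [fset p]%fset) ?msuppU_le // big_seq_fset1.
by rewrite mcoeffUU scale1r.
Qed.

Lemma path_ext0 : path_ext 0 = 0.
Proof. by rewrite -(scale0r 0) path_extZ scale0r. Qed.

Lemma path_ext_sum I (r : seq I) (P : pred I) (F : I -> path_algebra) :
  path_ext (\sum_(i <- r | P i) F i) = \sum_(i <- r | P i) path_ext (F i).
Proof. exact: (big_morph path_ext path_extD path_ext0). Qed.
End Extend.

Lemma eq_path_ext (V : lmodType K) (phi psi : qpath Q -> V) f :
  phi =1 psi -> path_ext phi f = path_ext psi f.
Proof. by move=> e; rewrite !path_extE; apply: eq_bigr => p _; rewrite e. Qed.

Lemma path_ext_comp (V : lmodType K) (phi : qpath Q -> V)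
    (psi : qpath Q -> path_algebra) f :
  path_ext phi (path_ext psi f) = path_ext (fun p => path_ext phi (psi p)) f.
Proof.
rewrite (path_extE psi) path_ext_sum path_extE; apply: eq_bigr => p _.
exact: path_extZ.
Qed.

Lemma path_ext_lin (V : lmodType K) (phi psi : qpath Q -> V) c f :
  path_ext (fun p => c *: phi p + psi p) f = c *: path_ext phi f + path_ext psi f.
Proof.
rewrite !path_extE scaler_sumr -big_split; apply: eq_bigr => p _ /=.
by rewrite scalerDr !scalerA mulrC.
Qed.

Lemma path_ext_id f : path_ext of_path f = f.
Proof.
by rewrite path_extE [RHS]monalgE; apply: eq_bigr => p _; apply: malg_scaleU.
Qed.

Lemma path_ext_zero (V : lmodType K) f : path_ext (fun=> 0 : V) f = 0.
Proof. by rewrite path_extE big1 // => p _; rewrite scaler0. Qed.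

Definition path_mul : path_algebra -> path_algebra -> path_algebra :=
  locked_with path_algebra_key (fun g f =>
    path_ext (fun q => path_ext (fun p => of_opath (qpath_comp q p)) f) g).

Lemma path_mulE g f : path_mul g f =
  path_ext (fun q => path_ext (fun p => of_opath (qpath_comp q p)) f) g.
Proof. by rewrite /path_mul unlock. Qed.

Definition path_one : path_algebra := \sum_(v : vertex Q) of_path (vertex_path v).

Lemma path_mulDl : left_distributive path_mul +%R.
Proof. by move=> f g h; rewrite !path_mulE; apply: path_extD. Qed.

Lemma path_mulZl c f g : path_mul (c *: f) g = c *: path_mul f g.
Proof. by rewrite !path_mulE; apply: path_extZ. Qed.

Lemma path_mul_linr c f g h :
  path_mul h (c *: f + g) = c *: path_mul h f + path_mul h g.
Proof.
pose phi f q : path_algebra := path_ext (fun p => of_opath (qpath_comp q p)) f.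
rewrite !path_mulE -[RHS](path_ext_lin (phi f) (phi g) c h).
apply: (@eq_path_ext _ (phi (c *: f + g))) => q.
by rewrite /phi path_extD path_extZ.
Qed.

Lemma path_mulDr : right_distributive path_mul +%R.
Proof. by move=> f g h; rewrite -{1}[g]scale1r path_mul_linr scale1r. Qed.

Lemma path_mul0r f : path_mul f 0 = 0.
Proof.
rewrite path_mulE -[RHS](path_ext_zero _ f); apply: eq_path_ext => p; exact: path_ext0.
Qed.

Lemma path_mulZr c f g : path_mul f (c *: g) = c *: path_mul f g.
Proof. by rewrite -[c *: g]addr0 path_mul_linr path_mul0r addr0. Qed.

Lemma path_mulPP q p : path_mul (of_path q) (of_path p) = of_opath (qpath_comp q p).
Proof. by rewrite path_mulE !path_ext_path. Qed.

Lemma path_mulA : associative path_mul.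
Proof.
move=> f g h; rewrite !path_mulE.
pose phi q p := of_opath (qpath_comp q p).
pose Phi s := path_ext (phi s) h.
rewrite -[RHS]/(path_ext Phi (path_ext (fun r => path_ext (phi r) g) f)).
rewrite -[LHS]/(path_ext (fun r => path_ext (phi r) (path_ext Phi g)) f).
rewrite [RHS]path_ext_comp; apply: eq_path_ext => r.
rewrite [LHS]path_ext_comp [RHS]path_ext_comp; apply: eq_path_ext => q.
rewrite [LHS]path_ext_comp.
transitivity (path_ext (fun p =>
    of_opath (obind (fun s => qpath_comp s p) (qpath_comp r q))) h).
  apply: eq_path_ext => p; rewrite -qpath_compA /phi.
  by case: (qpath_comp q p) => [s|]; [apply: path_ext_path|apply: path_ext0].
rewrite /phi; case: (qpath_comp r q) => [s|] /=.
  by rewrite [RHS]path_ext_path.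
by rewrite [RHS]path_ext0 path_ext_zero.
Qed.

Lemma path_mul1l : left_id path_one path_mul.
Proof.
move=> f; rewrite path_mulE path_ext_sum -[RHS]path_ext_id.
transitivity (\sum_v path_ext
    (fun p => of_opath (qpath_comp (vertex_path v) p)) f).
  by apply: eq_bigr => v _; apply: path_ext_path.
under eq_bigr do rewrite path_extE.
rewrite path_extE exchange_big; apply: eq_bigr => p _ /=.
rewrite (bigD1 (path_tgt p)) //= big1 => [|v /negPf nv].
  by rewrite addr0 vertex_path_compl eqxx.
by rewrite vertex_path_compl nv scaler0.
Qed.

Lemma path_mul1r : right_id path_one path_mul.
Proof.
move=> f; rewrite path_mulE -[RHS]path_ext_id; apply: eq_path_ext => q.
rewrite path_ext_sum (bigD1 (path_src q)) //= path_ext_path.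
rewrite vertex_path_compr eqxx big1 ?addr0 // => v /negPf nv.
by rewrite path_ext_path vertex_path_compr nv.
Qed.

HB.instance Definition _ := GRing.Zmodule_isPzRing.Build path_algebra
  path_mulA path_mul1l path_mul1r path_mulDl path_mulDr.

Definition path_scalerAl (c : K) (f g : path_algebra) :
  c *: (f * g) = (c *: f) * g := esym (path_mulZl c f g).
Definition path_scalerAr (c : K) (f g : path_algebra) :
  c *: (f * g) = f * (c *: g) := esym (path_mulZr c f g).

Definition vtx (v : vertex Q) : path_algebra := of_path (vertex_path v).
Definition arr (a : arrow Q) : path_algebra := of_path (arrow_path a).

(* The path starting at v that traverses the arrows of w from head to tail. *)
Definition word (v : vertex Q) (w : seq (arrow Q)) : path_algebra :=
  foldl (fun f a => arr a * f) (vtx v) w.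

Lemma vtx_mul v w : vtx v * vtx w = if v == w then vtx v else 0.
Proof.
rewrite [LHS]path_mulPP vertex_path_compl /path_tgt /=.
by case: eqP => [->|].
Qed.

Section Quotient.
Variable relators : path_algebra -> Prop.

Inductive ideal_gen : path_algebra -> Prop :=
| ideal_gen_rel f : relators f -> ideal_gen f
| ideal_gen0 : ideal_gen 0
| ideal_genD f g : ideal_gen f -> ideal_gen g -> ideal_gen (f + g)
| ideal_genM f g h : ideal_gen g -> ideal_gen (f * g * h).

Definition ideal : {pred path_algebra} := fun f => `[< ideal_gen f >].

Lemma ideal_zmod_closed : zmod_closed ideal.
Proof.
split=> [|f g /asboolP If /asboolP Ig]; apply/asboolP; first exact: ideal_gen0.
apply: ideal_genD => //; rewrite -[g]mulr1 -mulN1r mulrA.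
exact: ideal_genM.
Qed.
HB.instance Definition _ :=
  GRing.isZmodClosed.Build path_algebra ideal ideal_zmod_closed.

Lemma idealM f g h : g \in ideal -> f * g * h \in ideal.
Proof. by move=> /asboolP Ig; apply/asboolP/ideal_genM. Qed.

Definition quiver_algebra : Type := Quotient.quot ideal.
HB.instance Definition _ := EqQuotient.on quiver_algebra.
HB.instance Definition _ := GRing.Zmodule.on quiver_algebra.

Definition qclass : path_algebra -> quiver_algebra :=
  locked_with path_algebra_key (fun f => \pi_quiver_algebra f)%qT.

Lemma classE f : qclass f = (\pi_quiver_algebra f)%qT.
Proof. by rewrite /qclass unlock. Qed.

Lemma classP f g : qclass f = qclass g <-> f - g \in ideal.
Proof. by rewrite !classE (Quotient.idealrBE ideal); split=> /eqP. Qed.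

Lemma class_repr q : qclass (repr q) = q.
Proof. by rewrite classE; exact: reprK. Qed.

Lemma class_ideal f : f - repr (qclass f) \in ideal.
Proof. by apply/classP; rewrite class_repr. Qed.

Lemma classD f g : qclass (f + g) = qclass f + qclass g.
Proof. by rewrite !classE; exact: (Quotient.pi_add ideal). Qed.

Definition qmul : quiver_algebra -> quiver_algebra -> quiver_algebra :=
  locked_with path_algebra_key (fun p q => qclass (repr p * repr q)).
Definition qscale : K -> quiver_algebra -> quiver_algebra :=
  locked_with path_algebra_key (fun c q => qclass (c *: repr q)).

Lemma qmulE f g : qmul (qclass f) (qclass g) = qclass (f * g).
Proof.
rewrite /qmul unlock; apply/esym/classP; set f' := repr _; set g' := repr _.
have -> : f * g - f' * g' = 1 * (f - f') * g + f' * (g - g') * 1.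
  by rewrite mul1r mulr1 mulrBl mulrBr addrA addrNK.
by rewrite rpredD // idealM // class_ideal.
Qed.

Lemma qscaleE c f : qscale c (qclass f) = qclass (c *: f).
Proof.
rewrite /qscale unlock; apply/esym/classP; rewrite -scalerBr -[X in X \in _]mulr1.
by rewrite -[f - _]mul1r path_scalerAl idealM // class_ideal.
Qed.

Lemma classW (P : quiver_algebra -> Prop) : (forall f, P (qclass f)) -> forall q, P q.
Proof. by move=> h q; rewrite -[q]class_repr. Qed.

Lemma qmulA : associative qmul.
Proof. by do 3!elim/classW => ?; rewrite !qmulE mulrA. Qed.
Lemma qmul1l : left_id (qclass 1) qmul.
Proof. by elim/classW => ?; rewrite qmulE mul1r. Qed.
Lemma qmul1r : right_id (qclass 1) qmul.
Proof. by elim/classW => ?; rewrite qmulE mulr1. Qed.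
Lemma qmulDl : left_distributive qmul +%R.
Proof. by do 3!elim/classW => ?; rewrite -classD !qmulE mulrDl classD. Qed.
Lemma qmulDr : right_distributive qmul +%R.
Proof. by do 3!elim/classW => ?; rewrite -classD !qmulE mulrDr classD. Qed.
HB.instance Definition _ := GRing.Zmodule_isPzRing.Build quiver_algebra
  qmulA qmul1l qmul1r qmulDl qmulDr.

Lemma qscaleA c d q : qscale c (qscale d q) = qscale (c * d) q.
Proof. by elim/classW: q => f; rewrite !qscaleE scalerA. Qed.
Lemma qscale1 : left_id 1 qscale.
Proof. by elim/classW => f; rewrite qscaleE scale1r. Qed.
Lemma qscaleDr : right_distributive qscale +%R.
Proof. by move=> c; do 2!elim/classW => ?; rewrite -classD !qscaleE scalerDr classD. Qed.
Lemma qscaleDl q : {morph qscale^~ q : c d / c + d}.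
Proof. by move=> c d; elim/classW: q => f; rewrite !qscaleE scalerDl classD. Qed.
HB.instance Definition _ := GRing.Zmodule_isLmodule.Build K quiver_algebra
  qscaleA qscale1 qscaleDr qscaleDl.

Lemma classM f g : qclass (f * g) = qclass f * qclass g.
Proof. exact/esym/qmulE. Qed.
Lemma class1 : qclass 1 = 1.
Proof. by []. Qed.
Lemma classZ c f : qclass (c *: f) = c *: qclass f.
Proof. exact/esym/qscaleE. Qed.

Lemma quiver_algebra_scalerAl (c : K) (p q : quiver_algebra) :
  c *: (p * q) = (c *: p) * q.
Proof.
elim/classW: p => f; elim/classW: q => g.
by rewrite -classM -!classZ -classM path_scalerAl.
Qed.
Lemma quiver_algebra_scalerAr (c : K) (p q : quiver_algebra) :
  c *: (p * q) = p * (c *: q).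
Proof.
elim/classW: p => f; elim/classW: q => g.
by rewrite -classM -!classZ -classM path_scalerAr.
Qed.

Section Corner.
Variable B : pred (vertex Q).

Definition vertex_idem : quiver_algebra := qclass (\sum_(v | B v) vtx v).

Lemma vertex_idemM : vertex_idem * vertex_idem = vertex_idem.
Proof.
rewrite -classM; congr qclass; rewrite mulr_suml; apply: eq_bigr => v Bv.
rewrite mulr_sumr (bigD1 v) //= vtx_mul eqxx big1 ?addr0 // => w /andP[_ nw].
by rewrite vtx_mul eq_sym (negPf nw).
Qed.

(* e A e is the set of the elements b of A such that e b e = b. *)
Definition in_corner : {pred quiver_algebra} :=
  fun b => vertex_idem * b * vertex_idem == b.

Lemma in_cornerP b : reflect (exists a, b = vertex_idem * a * vertex_idem)
  (b \in in_corner).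
Proof.
apply: (iffP eqP) => [<-|[a ->]]; first by exists b.
by rewrite sandwichl ?sandwichr //; apply: vertex_idemM.
Qed.

Lemma corner_zmod_closed : zmod_closed in_corner.
Proof.
split=> [|a b /eqP ea /eqP eb]; apply/eqP; first by rewrite mulr0 mul0r.
by rewrite mulrBr mulrBl ea eb.
Qed.
HB.instance Definition _ :=
  GRing.isZmodClosed.Build quiver_algebra in_corner corner_zmod_closed.

Record corner_algebra := Corner {
  corner_val : quiver_algebra;
  _ : corner_val \in in_corner
}.
HB.instance Definition _ := [isSub for corner_val].
HB.instance Definition _ := [Choice of corner_algebra by <:].
HB.instance Definition _ := [SubChoice_isSubZmodule of corner_algebra by <:].

Lemma corner_idem_subproof : vertex_idem \in in_corner.
Proof. by apply/in_cornerP; exists 1; rewrite mulr1 vertex_idemM. Qed.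

Lemma corner_mulel (a : corner_algebra) :
  vertex_idem * corner_val a = corner_val a.
Proof.
by case: a => /= a /in_cornerP[b ->]; apply/sandwichl/vertex_idemM.
Qed.
Lemma corner_muler (a : corner_algebra) :
  corner_val a * vertex_idem = corner_val a.
Proof.
by case: a => /= a /in_cornerP[b ->]; apply/sandwichr/vertex_idemM.
Qed.

Lemma corner_mul_subproof (a b : corner_algebra) :
  corner_val a * corner_val b \in in_corner.
Proof. by apply/eqP; rewrite mulrA corner_mulel -mulrA corner_muler. Qed.

Lemma corner_scale_subproof (c : K) (a : corner_algebra) :
  c *: corner_val a \in in_corner.
Proof.
apply/eqP; rewrite -quiver_algebra_scalerAr -quiver_algebra_scalerAl.
by rewrite corner_mulel corner_muler.
Qed.

Definition corner_one := Corner corner_idem_subproof.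
Definition corner_mul a b := Corner (corner_mul_subproof a b).
Definition corner_scale c a := Corner (corner_scale_subproof c a).

Lemma corner_mulA : associative corner_mul.
Proof. by move=> a b c; apply: val_inj; apply: mulrA. Qed.
Lemma corner_mul1l : left_id corner_one corner_mul.
Proof. by move=> a; apply: val_inj; apply: corner_mulel. Qed.
Lemma corner_mul1r : right_id corner_one corner_mul.
Proof. by move=> a; apply: val_inj; apply: corner_muler. Qed.
Lemma corner_mulDl : left_distributive corner_mul +%R.
Proof. by move=> a b c; apply: val_inj; apply: mulrDl. Qed.
Lemma corner_mulDr : right_distributive corner_mul +%R.
Proof. by move=> a b c; apply: val_inj; apply: mulrDr. Qed.
HB.instance Definition _ := GRing.Zmodule_isPzRing.Build corner_algebra
  corner_mulA corner_mul1l corner_mul1r corner_mulDl corner_mulDr.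

Lemma corner_scaleA c d a : corner_scale c (corner_scale d a) = corner_scale (c * d) a.
Proof. by apply: val_inj; apply: scalerA. Qed.
Lemma corner_scale1 : left_id 1 corner_scale.
Proof. by move=> a; apply: val_inj; apply: scale1r. Qed.
Lemma corner_scaleDr : right_distributive corner_scale +%R.
Proof. by move=> c a b; apply: val_inj; apply: scalerDr. Qed.
Lemma corner_scaleDl a : {morph corner_scale^~ a : c d / c + d}.
Proof. by move=> c d; apply: val_inj; apply: scalerDl. Qed.
HB.instance Definition _ := GRing.Zmodule_isLmodule.Build K corner_algebra
  corner_scaleA corner_scale1 corner_scaleDr corner_scaleDl.

Lemma corner_scalerAl (c : K) (a b : corner_algebra) : c *: (a * b) = (c *: a) * b.
Proof. by apply: val_inj; apply: quiver_algebra_scalerAl. Qed.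
Lemma corner_scalerAr (c : K) (a b : corner_algebra) : c *: (a * b) = a * (c *: b).
Proof. by apply: val_inj; apply: quiver_algebra_scalerAr. Qed.
End Corner.
End Quotient.
End PathAlgebra.

Notation pos0 := (@Ordinal 4 0 isT).
Notation pos1 := (@Ordinal 4 1 isT).
Notation pos2 := (@Ordinal 4 2 isT).
Notation pos3 := (@Ordinal 4 3 isT).

(* A dart is an end, at a crossing (inl) or at a marked point (inr), of a
   segment of a strand or of a boundary interval; the second component numbers
   the four darts around their common point in anticlockwise order:
   - at a crossing, pos0 and pos2 are the incoming and the outgoing end of one
     strand, pos1 and pos3 those of the other one, which crosses the former
     from right to left;
   - at a marked point, pos0 is the boundary interval leaving it with the
     surface on the left, pos1 the strand ending there, pos2 the strand
     starting there and pos3 the boundary interval arriving from the preceding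
     marked point; the exterior of the surface lies between pos3 and pos0.
   The order of the two strand ends at a marked point is not forced by the
   axioms of a weak Postnikov diagram; only this one occurs in the diagrams of
   triangulations. *)
Definition dart (C M : finType) : finType := ((C + M) * 'I_4)%type.

Section Darts.
Variables C M : finType.
Implicit Type d : dart C M.

Definition strand_in d : bool :=
  if d.1 is inl _ then (d.2 < 2)%N else d.2 == pos1.
Definition strand_out d : bool :=
  if d.1 is inl _ then (2 <= d.2)%N else d.2 == pos2.
Definition bd_out d : bool := if d.1 is inl _ then false else d.2 == pos0.
Definition bd_in d : bool := if d.1 is inl _ then false else d.2 == pos3.
Definition on_strand d := strand_in d || strand_out d.

Definition dart_rot d : dart C M := (d.1, ordS d.2).
Definition dart_unrot d : dart C M := (d.1, ord_pred d.2).
End Darts.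

(* The curve system of a weak Postnikov diagram all of whose regions are discs,
   as a map on an oriented surface: opp exchanges the two ends of each strand
   segment and of each boundary interval.  By opp_alternate the strands
   crossing a given strand alternately do so from right to left (even
   positions) and from left to right (odd positions), its end points at the
   marked points being counted as crossings. *)
Record strand_diagram := StrandDiagram {
  crossing : finType;
  marked : finType;
  opp : dart crossing marked -> dart crossing marked;
  oppK : involutive opp;
  opp_strand : forall d, strand_in (opp d) = strand_out d;
  opp_bd : forall d, bd_in (opp d) = bd_out d;
  opp_alternate : forall d, strand_out d -> odd (opp d).2 = ~~ odd d.2
}.

Section Diagram.
Variable D : strand_diagram.
Local Notation dart := (dart (crossing D) (marked D)).
Implicit Types (d : dart) (A : {set dart}).

(* The dart d also stands for the corner between d and dart_rot d.  Travelling away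
   along d with a region on the left, the next dart on the boundary of that
   region is face d. *)
Definition face d : dart := dart_unrot (opp d).
Definition face_back d : dart := opp (dart_rot d).

Definition region_of d : {set dart} := [set d' | fconnect face d d'].

(* Boundary intervals travelled backwards have the exterior on their left. *)
Definition is_region A : bool :=
  [exists d, A == region_of d] && [forall d in A, ~~ bd_in d].

(* The two sides of A that meet at its corner d are the edges of d and dart_rot d;
   they have opposite orientations around A if they both point towards the
   corner or both away from it. *)
Definition alternating_region A : bool :=
  is_region A && [forall d in A,
    (on_strand d && on_strand (dart_rot d)) ==> (strand_out d == strand_out (dart_rot d))].

Definition anticlockwise_region A : bool :=
  is_region A && [forall d in A, on_strand d ==> strand_out d].
Definition clockwise_region A : bool :=
  is_region A && [forall d in A, on_strand d ==> strand_in d].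

Definition boundary_region A : bool := [exists d in A, bd_out d].

Lemma dart_rotK : cancel (@dart_rot (crossing D) (marked D)) (@dart_unrot _ _).
Proof. by case=> x i; rewrite /dart_rot /dart_unrot /= ordSK. Qed.
Lemma dart_unrotK : cancel (@dart_unrot (crossing D) (marked D)) (@dart_rot _ _).
Proof. by case=> x i; rewrite /dart_rot /dart_unrot /= ord_predK. Qed.
Lemma faceK : cancel face face_back.
Proof. by move=> d; rewrite /face /face_back dart_unrotK oppK. Qed.
Lemma face_backK : cancel face_back face.
Proof. by move=> d; rewrite /face /face_back oppK dart_rotK. Qed.

Lemma opp_strand_in d : strand_out (opp d) = strand_in d.
Proof. by rewrite -opp_strand oppK. Qed.
Lemma opp_bd_in d : bd_out (opp d) = bd_in d.
Proof. by rewrite -opp_bd oppK. Qed.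

Lemma odd_opp d : odd (opp d).2 = ~~ odd d.2.
Proof.
have [dout|/negbTE dout] := boolP (strand_out d); first exact: opp_alternate.
have [din|/negbTE din] := boolP (strand_in d).
  by rewrite -[in RHS](oppK d) [in RHS]opp_alternate ?opp_strand_in // negbK.
have E (e : dart) : strand_out e = false -> strand_in e = false ->
    (bd_out e /\ ~~ odd e.2) \/ (bd_in e /\ odd e.2).
  by case: e => [[c|p] [[|[|[|[|]]]] ltj]] //= _ _; [left|right].
have := E _ dout din; have := E (opp d).
rewrite opp_strand opp_strand_in dout din => /(_ erefl erefl).
rewrite opp_bd opp_bd_in.
have bdN : bd_out d -> bd_in d -> False.
  by case: (d) => [[c|p] [[|[|[|[|]]]] ltj]].
case=> [[b1 o1]|[b1 o1]] [[b2 o2]|[b2 o2]].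
- by case: (bdN b2 b1).
- by rewrite (negbTE o1) o2.
- by rewrite o1 (negbTE o2).
- by case: (bdN b1 b2).
Qed.

Lemma odd_face d : odd (face d).2 = odd d.2.
Proof.
rewrite -[RHS]negbK -odd_opp /face /dart_unrot /=.
by case: (opp d) => x [[|[|[|[|]]]] ltj].
Qed.

Lemma odd_region d d' : d' \in region_of d -> odd d'.2 = odd d.2.
Proof.
rewrite inE => /connectP[p + ->]; elim: p d => //= e p IH d /andP[/eqP de pe].
by rewrite (IH _ pe) -de odd_face.
Qed.

Lemma even_alternating_region d : ~~ odd d.2 -> alternating_region (region_of d).
Proof.
move=> evd; apply/andP; split; last first.
  apply/forall_inP => d' /odd_region; rewrite (negbTE evd).
  by case: d' => [[c|p] [[|[|[|[|]]]] ltj]].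
apply/andP; split; first by apply/existsP; exists d.
apply/forall_inP => d' /odd_region; rewrite (negbTE evd).
by case: d' => [[c|p] [[|[|[|[|]]]] ltj]].
Qed.

Lemma mem_region_of d : d \in region_of d.
Proof. by rewrite inE connect0. Qed.

Lemma region_of_closed d (P : pred dart) : P d ->
  (forall d', P d' -> P (face d')) -> {in region_of d, forall d', P d'}.
Proof.
move=> Pd Pface d'; rewrite inE => /connectP[p + ->].
by elim: p d Pd => //= e p IH d Pd /andP[/eqP <- /IH]; apply; apply: Pface.
Qed.

(* Every crossing lies on a face of either orientation. *)
Lemma crossing_anticlockwise (c : crossing D) :
  anticlockwise_region (region_of (inl c, pos3)).
Proof.
pose P (d : dart) := if d.1 is inl _ then d.2 == pos3 else false.
have Pface d : P d -> P (face d).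
  case: d => [[a|//] i] /eqP /= ->.
  have := opp_strand (inl a, pos3); have := @opp_alternate D (inl a, pos3) isT.
  rewrite /face /dart_unrot /P.
  by case: (opp _) => [[b|b] [[|[|[|[|//]]]] ltj]].
have PR := @region_of_closed (inl c, pos3) P (eqxx _) Pface.
apply/andP; split; [apply/andP; split|].
- by apply/existsP; exists (inl c, pos3).
- by apply/forall_inP => -[[a|a] i] /PR.
- by apply/forall_inP => -[[a|a] i] /PR //= /eqP /= ->.
Qed.

Lemma crossing_clockwise (c : crossing D) :
  clockwise_region (region_of (inl c, pos1)).
Proof.
pose P (d : dart) := d.2 == pos1.
have Pface d : P d -> P (face d).
  case: d => x i /eqP /= ->.
  have sx : strand_in ((x, pos1) : dart) by case: x.
  have := opp_strand_in (x, pos1); have := odd_opp (x, pos1).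
  rewrite sx /face /dart_unrot /P.
  by case: (opp _) => [[b|b] [[|[|[|[|//]]]] ltj]].
have PR := @region_of_closed (inl c, pos1) P (eqxx _) Pface.
apply/andP; split; [apply/andP; split|].
- by apply/existsP; exists (inl c, pos1).
- by apply/forall_inP => -[[a|a] i] /PR /eqP /= i1; rewrite /bd_in /= ?i1.
- by apply/forall_inP => -[[a|a] i] /PR /eqP /= i1; rewrite /strand_in /= i1.
Qed.

Record alternating := Alternating {
  alternating_val : {set dart};
  _ : alternating_region alternating_val
}.
HB.instance Definition _ := [isSub for alternating_val].
HB.instance Definition _ := [Finite of alternating by <:].

(* At a crossing pos0 is the corner between the two incoming ends and pos2 the
   one between the two outgoing ends.  At a marked point pos0 is the corner
   next to the incoming strand and pos2 the one next to the outgoing strand. *)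
Definition arrow_src (x : crossing D + marked D) : alternating :=
  Alternating (@even_alternating_region (x, pos0) isT).
Definition arrow_tgt (x : crossing D + marked D) : alternating :=
  Alternating (@even_alternating_region (x, pos2) isT).

Definition diagram_quiver : quiver :=
  @Quiver alternating (crossing D + marked D)%type arrow_src arrow_tgt.

Definition boundary_vertex : pred (vertex diagram_quiver) :=
  fun A : alternating => boundary_region (alternating_val A).

(* The arrows at the corners met after d when following f around a region. *)
Definition arrows_after (f : dart -> dart) d : seq (arrow diagram_quiver) :=
  [seq d'.1 | d' <- behead (fingraph.orbit f d)].

(* The boundary cycle of a face runs in the direction of the strands around it,
   that is along face for an anticlockwise region and along face_back for a
   clockwise one. *)
Variant dimer_relator (K : fieldType) : path_algebra K diagram_quiver -> Prop :=
| DimerRelator (c : crossing D) (dp dm : dart)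
    of dp.1 = inl c & anticlockwise_region (region_of dp)
     & dm.1 = inl c & clockwise_region (region_of dm) :
    let v := @qtgt diagram_quiver (inl c) in
    dimer_relator (word K v (arrows_after face dp)
                   - word K v (arrows_after face_back dm)).

Definition dimer_algebra (K : fieldType) :=
  quiver_algebra (@dimer_relator K).
Definition boundary_algebra (K : fieldType) :=
  corner_algebra (@dimer_relator K) boundary_vertex.
End Diagram.

Section Annulus.
Variables n m : nat.

(* The marked points of the annulus: inl i on the outer and inr j on the inner
   boundary component, both numbered anticlockwise as seen in the plane. *)
Definition mark : finType := ('I_n + 'I_m)%type.

(* The next and the preceding marked point, moving along the boundary component
   with the surface on the left. *)
Definition mark_next (p : mark) : mark :=
  match p with inl i => inl (ordS i) | inr j => inr (ord_pred j) end.
Definition mark_prev (p : mark) : mark :=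
  match p with inl i => inl (ord_pred i) | inr j => inr (ordS j) end.

(* The marked points of the universal cover of the annulus, a horizontal strip
   with the outer boundary component at the bottom and the inner one at the
   top, both numbered from left to right.  Arcs of the annulus up to isotopy
   are pairs of marked points of the strip up to deck transformations, and two
   arcs have disjoint interiors up to isotopy iff no lifts of them cross. *)
Definition strip_point : Type := (int + int)%type.

Definition strip_mark (p : mark) : strip_point :=
  match p with inl i => inl (i : nat)%:Z | inr j => inr (j : nat)%:Z end.
Definition deck (k : int) (p : strip_point) : strip_point :=
  match p with inl i => inl (i + k * n%:Z) | inr j => inr (j + k * m%:Z) end.
Definition strip_next (p : strip_point) : strip_point :=
  match p with inl i => inl (i + 1) | inr j => inr (j - 1) end.

(* The boundary of the strip from bottom left to bottom right and then from top
   right to top left, and the induced anticlockwise cyclic order. *)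
Definition strip_lt (p q : strip_point) : bool :=
  match p, q with
  | inl i, inl j => i < j
  | inl _, inr _ => true
  | inr _, inl _ => false
  | inr i, inr j => j < i
  end.
Definition ccw (p q r : strip_point) : bool :=
  [|| strip_lt p q && strip_lt q r, strip_lt q r && strip_lt r p
    | strip_lt r p && strip_lt p q].
Definition strip_cross (p q r s : strip_point) : bool :=
  (ccw p r q && ccw q s p) || (ccw p s q && ccw q r p).

(* A triangulation is a finite set of triangles with corners P_0, P_1, P_2 in
   anticlockwise order, represented by lifts to the strip, and with (t, i) both
   its corner P_i and its side from P_i to P_(i+1).  The boundary interval from
   the marked point p to mark_next p is inr p; seen from the exterior of the
   annulus, hence with the surface on the right, it runs from the latter to the
   former.  By glue every side of a triangle is identified, with opposite
   orientations and up to a deck transformation, with a side of a triangle or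
   with a boundary interval, and every boundary interval with the side of
   exactly one triangle. *)
Record annulus_triangulation := AnnulusTriangulation {
  triangle : finType;
  corner : triangle -> 'I_3 -> strip_point;
  glue : (triangle * 'I_3) + mark -> (triangle * 'I_3) + mark;
  side_src := fun s => match s with
    | inl (t, i) => corner t i
    | inr p => strip_next (strip_mark p)
    end;
  side_tgt := fun s => match s with
    | inl (t, i) => corner t (ordS i)
    | inr p => strip_mark p
    end;
  corner_ccw : forall t i, ccw (corner t i) (corner t (ordS i)) (corner t (ord_pred i));
  sides_noncrossing : forall s s' k,
    ~~ strip_cross (side_src s) (side_tgt s)
         (deck k (side_src s')) (deck k (side_tgt s'));
  glueK : involutive glue;
  glue_boundary : forall p, exists s, glue (inr p) = inl s;
  glue_sides : forall s, exists k : int,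
    side_src (glue s) = deck k (side_tgt s) /\
    side_tgt (glue s) = deck k (side_src s)
}.

Section TriangulationDiagram.
Variable T : annulus_triangulation.
Local Notation node := ((triangle T * 'I_3) + mark)%type.

(* The three segments of the triangle t cross pairwise, and (t, i) is the
   crossing near P_i of the segment i-1, parallel to the side from P_(i-1) to
   P_i, with the segment i, parallel to the side from P_i to P_(i+1), which
   crosses the former from right to left.  Hence, at the crossing (t, i):
   - pos0 comes from the crossing (t, i-1) along the segment i-1;
   - pos1 comes along the segment i from the side (t, i-1), near P_i;
   - pos2 leads along the segment i-1 to the side (t, i), near P_i;
   - pos3 leads to the crossing (t, i+1) along the segment i.
   A strand thus leaves t through the side (t, i) near its source from pos2 at
   (t, i), and enters t through it near its target to pos1 at (t, i+1).  On a
   boundary interval from p to mark_next p, the strand leaving the triangle is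
   slid to p, where it ends, and the strand entering it is slid to mark_next p,
   where it starts. *)
Definition leaving_side (x : node) : node :=
  match x with inl c => inl c | inr p => inr (mark_prev p) end.
Definition leaving_node (s : node) : node :=
  match s with inl c => inl c | inr p => inr (mark_next p) end.
Definition entering_side (x : node) : node :=
  match x with inl (t, i) => inl (t, ord_pred i) | inr p => inr p end.
Definition entering_node (s : node) : node :=
  match s with inl (t, i) => inl (t, ordS i) | inr p => inr p end.

(* At marked points these are the neighbours along the boundary. *)
Definition pos0_node (x : node) : node :=
  match x with inl (t, i) => inl (t, ord_pred i) | inr p => inr (mark_next p) end.
Definition pos3_node (x : node) : node :=
  match x with inl (t, i) => inl (t, ordS i) | inr p => inr (mark_prev p) end.

Definition triangulation_opp (d : dart (triangle T * 'I_3)%type mark) :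
    dart (triangle T * 'I_3)%type mark :=
  let: (x, i) := d in
  match val i with
  | 0 => (pos0_node x, pos3)
  | 1 => (leaving_node (glue (entering_side x)), pos2)
  | 2 => (entering_node (glue (leaving_side x)), pos1)
  | _ => (pos3_node x, pos0)
  end.

Lemma mark_nextK : cancel mark_next mark_prev.
Proof. by case=> i /=; rewrite ?ordSK ?ord_predK. Qed.
Lemma mark_prevK : cancel mark_prev mark_next.
Proof. by case=> i /=; rewrite ?ordSK ?ord_predK. Qed.

Lemma triangulation_oppK : involutive triangulation_opp.
Proof.
have lK : cancel leaving_side leaving_node by case=> [c|p] //=; rewrite mark_prevK.
have lK' : cancel leaving_node leaving_side by case=> [c|p] //=; rewrite mark_nextK.
have eK : cancel entering_side entering_node by case=> [[t i]|p] //=; rewrite ord_predK.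
have eK' : cancel entering_node entering_side by case=> [[t i]|p] //=; rewrite ordSK.
have pK : cancel pos0_node pos3_node.
  by case=> [[t i]|p] /=; rewrite ?ord_predK ?mark_nextK.
have pK' : cancel pos3_node pos0_node.
  by case=> [[t i]|p] /=; rewrite ?ordSK ?mark_prevK.
case=> x [[|[|[|[|//]]]] lti] /=; rewrite ?pK ?pK' ?lK' ?eK' ?glueK ?lK ?eK //;
  by congr pair; apply: val_inj.
Qed.

Lemma triangulation_opp_strand d : strand_in (triangulation_opp d) = strand_out d.
Proof.
case: d => x [[|[|[|[|//]]]] lti] /=; rewrite /strand_in /strand_out /=.
- by case: x => [[t i]|p].
- by case: x => [[t i]|p] /=; case: (glue _).
- by case: x => [[t i]|p] /=; case: (glue _) => [[]|].
- by case: x => [[t i]|p].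
Qed.

Lemma triangulation_opp_bd d : bd_in (triangulation_opp d) = bd_out d.
Proof.
case: d => x [[|[|[|[|//]]]] lti] /=; rewrite /bd_in /bd_out /=.
- by case: x => [[t i]|p].
- by case: x => [[t i]|p] /=; case: (glue _).
- by case: x => [[t i]|p] /=; case: (glue _) => [[]|].
- by case: x => [[t i]|p].
Qed.

Lemma triangulation_opp_alternate d :
  strand_out d -> odd (triangulation_opp d).2 = ~~ odd d.2.
Proof. by case: d => x [[|[|[|[|//]]]] lti]. Qed.

Definition triangulation_diagram : strand_diagram :=
  StrandDiagram triangulation_oppK triangulation_opp_strand
    triangulation_opp_bd triangulation_opp_alternate.
End TriangulationDiagram.
End Annulus.

Section LambdaAlgebra.
Variables (K : fieldType) (n m : nat) (n_gt0 : (0 < n)%N) (m_gt0 : (0 < m)%N).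

(* Residues modulo n and m; inl is for the vertices without a bar and inr for
   those with a bar. *)
Definition lambda_vertex : finType := ('I_n + 'I_m)%type.
Definition outer (k : nat) : lambda_vertex := inl (Ordinal (ltn_pmod k n_gt0)).
Definition inner (k : nat) : lambda_vertex := inr (Ordinal (ltn_pmod k m_gt0)).

Definition lambda_arrow : finType := ('I_n + 'I_n + 'I_m + 'I_m + bool)%type.
Definition arrow_x (i : 'I_n) : lambda_arrow := inl (inl (inl (inl i))).
Definition arrow_y (i : 'I_n) : lambda_arrow := inl (inl (inl (inr i))).
Definition arrow_xbar (i : 'I_m) : lambda_arrow := inl (inl (inr i)).
Definition arrow_ybar (i : 'I_m) : lambda_arrow := inl (inr i).
Definition arrow_r : lambda_arrow := inr true.
Definition arrow_s : lambda_arrow := inr false.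

Definition lambda_src (a : lambda_arrow) : lambda_vertex :=
  match a with
  | inl (inl (inl (inl i))) => inl (ord_pred i)
  | inl (inl (inl (inr i))) => inl i
  | inl (inl (inr i)) => inr i
  | inl (inr i) => inr (ord_pred i)
  | inr true => outer 1
  | inr false => inner m
  end.
Definition lambda_tgt (a : lambda_arrow) : lambda_vertex :=
  match a with
  | inl (inl (inl (inl i))) => inl i
  | inl (inl (inl (inr i))) => inl (ord_pred i)
  | inl (inl (inr i)) => inr (ord_pred i)
  | inl (inr i) => inr i
  | inr true => inner 1
  | inr false => outer n
  end.

Definition lambda_quiver : quiver :=
  @Quiver lambda_vertex lambda_arrow lambda_src lambda_tgt.

Local Notation larr := (@arr K lambda_quiver).
Local Notation e := (@vtx K lambda_quiver).
Local Notation x := (\sum_(i < n) larr (arrow_x i)).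
Local Notation y := (\sum_(i < n) larr (arrow_y i)).
Local Notation xbar := (\sum_(i < m) larr (arrow_xbar i)).
Local Notation ybar := (\sum_(i < m) larr (arrow_ybar i)).
Local Notation r := (larr arrow_r).
Local Notation s := (larr arrow_s).

(* Multiplication on the right by e v selects the paths starting at v; findex
   is the least number of steps from its second to its third argument. *)
Variant lambda_relator : path_algebra K lambda_quiver -> Prop :=
| lambda_xy (v : 'I_n) :
    lambda_relator (x * y * e (inl v) - y * x * e (inl v))
| lambda_xybar (v : 'I_m) :
    lambda_relator (xbar * ybar * e (inr v) - ybar * xbar * e (inr v))
| lambda_yy (v : 'I_n) :
    let i := findex (@ordS n) v (Ordinal (ltn_pmod 1 n_gt0)) in
    lambda_relator (y ^+ 2 * e (inl v)
      - x ^+ (n - 1 - i) * s * xbar ^+ m.+1 * r * x ^+ i * e (inl v))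
| lambda_yybar (v : 'I_m) :
    let i := findex (@ord_pred m) v (Ordinal (ltn_pmod m m_gt0)) in
    lambda_relator (ybar ^+ 2 * e (inr v)
      - xbar ^+ (m - 1 - i) * r * x ^+ n.+1 * s * xbar ^+ i * e (inr v))
| lambda_r : lambda_relator (r - xbar ^+ m * r * x ^+ n)
| lambda_s : lambda_relator (s - x ^+ n * s * xbar ^+ m)
| lambda_yxs : lambda_relator (y * x * s - s * xbar * ybar)
| lambda_xyr : lambda_relator (xbar * ybar * r - r * y * x).

Definition Lambda := quiver_algebra lambda_relator.
End LambdaAlgebra.

(* Main.v *)
(* Every side of the triangulation, directed, gives a path zz across it between
   boundary vertices, and the dimer relations at the arrows of a triangle
   express one such path through the other two: zz b = zz b' x zz b'', with x
   the sum of the boundary arrows.  Induction over the triangulation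
   shows that zz is a power of x for a side cutting off a polygon, that it is
   x^a r x^b or x^a s x^b for a side joining the two boundary components, where
   r and s cross one fixed such side, and that it is x^a s x^b r x^c or
   x^a r x^b s x^c for a side going around the annulus; in particular so is y^2.
   Hence Lambda maps onto the boundary algebra.

   The dimer algebra is graded by Z^2, the degree of a path being a cocycle
   attached to the sides lifted to the strip.  In Lambda every path is a power
   of the central element xy times one of the words x^a, y, x^a r x^b,
   x^a s x^b, x^a s x^b r x^c and x^a r x^b s x^c, so that it is determined by
   its ends and the degree of its image.  Sending a path of the dimer algebra to
   the path of Lambda with the same ends and degree is therefore well defined,
   and inverts the above map. *)
From HB Require Import structures.
Require Import Defs.
From mathcomp Require Import all_boot all_order all_algebra finmap boolp complex reals.
From mathcomp Require Import ring zify.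
From mathcomp.multinomials Require Import monalg.

Set Implicit Arguments.
Unset Strict Implicit.
Unset Printing Implicit Defensive.

Import Order.TTheory GRing.Theory Num.Theory.
Local Open Scope ring_scope.

(** * Path algebras and their quotients *)

(** The obstacle is injectivity: paths in the dimer algebra of an arbitrary triangulation have no
    evident normal form. The grading makes one unnecessary. Once the dimer relations are known to be
    homogeneous, every function of the ends and the degree of a path extends to a linear map on the
    dimer algebra; this gives the inverse, and also shows that path classes are nonzero and
    determine their ends and degree. Normal forms are computed in Lambda alone, with degrees read
    off from the images. The degree comes from a weight [phi] of directed sides: reversing a side
    replaces [phi] by (1, 0) - [phi], and the weights around a triangle add up to (2, 0). An arrow
    gets the increment of [phi] as the side turns about a corner, plus (1, 0) if the arrow is at a
    marked point. Then triangles and fans both have degree (1, 0). The degree also fixes the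
    relation for y^2. The induction over triangles gives y^2 with uncontrolled exponents only; but
    two words with two crossings, equal ends and equal degree agree, since the shift relations of r
    and s allow exponents to be traded. *)

Section Words.
Variables (K : fieldType) (Q : quiver).
Implicit Types (v : vertex Q) (w : seq (arrow Q)) (a : arrow Q).

Lemma is_qpath_rcons v w a :
  is_qpath v (rcons w a) = is_qpath v w && (qsrc a == qend v w).
Proof. by rewrite -cats1 is_qpath_cat /= andbT. Qed.

Lemma qend_rcons v w a : qend v (rcons w a) = qtgt a.
Proof. by rewrite /qend map_rcons last_rcons. Qed.

Lemma word_rcons v w a : word K v (rcons w a) = arr K a * word K v w.
Proof. exact: foldl_rcons. Qed.

Lemma of_path_word (p : qpath Q) : of_path K p = word K (val p).1 (val p).2.
Proof.
case: p => [[v w] h] /=; elim/last_ind: w h => [|w a IH] h.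
  by congr (of_path K _); apply: val_inj.
have := h; rewrite /= is_qpath_rcons => /andP[h' /eqP e].
pose p : qpath Q := @QPath Q (v, w) h'.
rewrite word_rcons -(IH h') -/p [RHS]path_mulPP.
case: (qpath_compP (arrow_path a) p) => [[r -> [_ vr _ _]]|[_]].
  by congr (of_path K _); apply: val_inj; rewrite vr /= cats1.
by rewrite /path_src /path_tgt /= e eqxx.
Qed.

Lemma path_algebra_sum (f : path_algebra K Q) :
  f = \sum_(p <- msupp f) mcoeff p f *: of_path K p.
Proof. by rewrite -path_extE path_ext_id. Qed.

Lemma of_pathM (q p : qpath Q) : of_path K q * of_path K p = of_opath K (qpath_comp q p).
Proof. exact: path_mulPP. Qed.

Lemma path_algebra_ind (P : path_algebra K Q -> Prop) :
  P 0 -> (forall f g, P f -> P g -> P (f + g)) ->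
  (forall c p, P (c *: of_path K p)) -> forall f, P f.
Proof.
by move=> P0 PD Pp f; rewrite [f]path_algebra_sum; apply: big_ind.
Qed.
End Words.

(** * Classes of paths, and linear maps out of a quotient of a path algebra *)

Section Classes.
Variables (K : fieldType) (Q : quiver) (rel : path_algebra K Q -> Prop).
Implicit Types (v : vertex Q) (w : seq (arrow Q)) (a : arrow Q).
Local Notation qA := (quiver_algebra rel).

(* Opaque, since unification would otherwise unfold these classes. *)
Fact vcl_key : {f : vertex Q -> qA | forall v, f v = qclass rel (vtx K v)}.
Proof. by exists (fun v => qclass rel (vtx K v)). Qed.
Fact acl_key : {f : arrow Q -> qA | forall a, f a = qclass rel (arr K a)}.
Proof. by exists (fun a => qclass rel (arr K a)). Qed.
Fact pcl_key : {f : vertex Q -> seq (arrow Q) -> qA |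
  forall v w, f v w = qclass rel (word K v w)}.
Proof. by exists (fun v w => qclass rel (word K v w)). Qed.

Definition vcl := sval vcl_key.
Definition acl := sval acl_key.
Definition pcl := sval pcl_key.

Lemma vclE v : vcl v = qclass rel (vtx K v). Proof. exact: (svalP vcl_key). Qed.
Lemma aclE a : acl a = qclass rel (arr K a). Proof. exact: (svalP acl_key). Qed.
Lemma pclE v w : pcl v w = qclass rel (word K v w).
Proof. exact: (svalP pcl_key). Qed.

Lemma pcl_nil v : pcl v [::] = vcl v. Proof. by rewrite pclE vclE. Qed.

Lemma pcl_rcons v w a : pcl v (rcons w a) = acl a * pcl v w.
Proof. by rewrite !pclE word_rcons classM aclE. Qed.

Lemma class0 : qclass rel 0 = 0.
Proof. by apply: (addrI (qclass rel 0)); rewrite -classD !addr0. Qed.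

Lemma classN f : qclass rel (- f) = - qclass rel f.
Proof. by apply: (addrI (qclass rel f)); rewrite -classD !subrr class0. Qed.

Lemma classB f g : qclass rel (f - g) = qclass rel f - qclass rel g.
Proof. by rewrite classD classN. Qed.

Lemma class_sum I (s : seq I) (P : pred I) (F : I -> path_algebra K Q) :
  qclass rel (\sum_(i <- s | P i) F i) = \sum_(i <- s | P i) qclass rel (F i).
Proof. exact: (big_morph _ (@classD _ _ rel) class0). Qed.

Lemma class_exp f k : qclass rel (f ^+ k) = qclass rel f ^+ k.
Proof. by elim: k => [|k IH]; rewrite ?expr0 ?class1 // !exprS classM IH. Qed.

Lemma class_rel f : rel f -> qclass rel f = 0.
Proof.
move=> rf; rewrite -class0; apply/classP; rewrite subr0.
by apply/asboolP/ideal_gen_rel.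
Qed.

Lemma vclM v v' : vcl v * vcl v' = if v == v' then vcl v else 0.
Proof. by rewrite !vclE -classM vtx_mul; case: eqP => // _; rewrite class0. Qed.

Lemma vclK v : vcl v * vcl v = vcl v. Proof. by rewrite vclM eqxx. Qed.

Lemma vcl_acl v a : vcl v * acl a = if v == qtgt a then acl a else 0.
Proof.
rewrite vclE aclE -classM [vtx K v * _]path_mulPP vertex_path_compl.
by rewrite /path_tgt /=; case: eqP; rewrite ?class0.
Qed.

Lemma acl_vcl a v : acl a * vcl v = if v == qsrc a then acl a else 0.
Proof.
rewrite vclE aclE -classM [arr K a * _]path_mulPP vertex_path_compr.
by rewrite /path_src /=; case: eqP; rewrite ?class0.
Qed.

Lemma acl_tgt a : vcl (qtgt a) * acl a = acl a.
Proof. by rewrite vcl_acl eqxx. Qed.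
Lemma acl_src a : acl a * vcl (qsrc a) = acl a.
Proof. by rewrite acl_vcl eqxx. Qed.

Lemma pcl_seq1 a : pcl (qsrc a) [:: a] = acl a.
Proof. by rewrite (pcl_rcons _ [::]) pcl_nil acl_src. Qed.

Lemma pcl_vcl v w : pcl v w * vcl v = pcl v w.
Proof.
by elim/last_ind: w => [|w a IH]; rewrite ?pcl_nil ?vclK // pcl_rcons -mulrA IH.
Qed.

Lemma vcl_pcl v w : vcl (qend v w) * pcl v w = pcl v w.
Proof.
elim/last_ind: w => [|w a _]; first by rewrite pcl_nil vclK.
by rewrite pcl_rcons qend_rcons mulrA acl_tgt.
Qed.

Lemma pcl_cat v w1 w2 : pcl v (w1 ++ w2) = pcl (qend v w1) w2 * pcl v w1.
Proof.
elim/last_ind: w2 => [|w a IH]; first by rewrite cats0 pcl_nil vcl_pcl.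
by rewrite -rcons_cat !pcl_rcons IH mulrA.
Qed.

Lemma pcl_cons v a w : qsrc a = v -> pcl v (a :: w) = pcl (qtgt a) w * acl a.
Proof. by move=> <-; rewrite -cat1s pcl_cat pcl_seq1. Qed.

Section Lift.
Variables (V : lmodType K) (Phi : vertex Q -> seq (arrow Q) -> V).
Hypothesis relP : forall f, rel f -> exists v w1 w2,
  [/\ f = word K v w1 - word K v w2, is_qpath v w1, is_qpath v w2,
      qend v w1 = qend v w2 &
      forall u (a b : seq (arrow Q)), is_qpath u a -> qend u a = v -> is_qpath (qend v w1) b ->
        Phi u (a ++ w1 ++ b) = Phi u (a ++ w2 ++ b)].

Definition path_lift : path_algebra K Q -> V :=
  path_ext (fun p => Phi (val p).1 (val p).2).

Lemma path_liftD f g : path_lift (f + g) = path_lift f + path_lift g.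
Proof. exact: path_extD. Qed.
Lemma path_liftZ c f : path_lift (c *: f) = c *: path_lift f.
Proof. exact: path_extZ. Qed.
Lemma path_lift0 : path_lift 0 = 0.
Proof. exact: path_ext0. Qed.
Lemma path_liftB f g : path_lift (f - g) = path_lift f - path_lift g.
Proof. by rewrite path_liftD -[- g]scaleN1r path_liftZ scaleN1r. Qed.
Lemma path_lift_word v w : is_qpath v w -> path_lift (word K v w) = Phi v w.
Proof.
by move=> h; rewrite -(of_path_word K (@QPath Q (v, w) h)) [LHS]path_ext_path.
Qed.

Lemma word_sandwich q p v w : is_qpath v w ->
  of_path K q * word K v w * of_path K p =
  if (path_tgt p == v) && (path_src q == qend v w)
  then word K (val p).1 ((val p).2 ++ w ++ (val q).2) else 0.
Proof.
move=> h; rewrite -(of_path_word K (@QPath Q (v, w) h)).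
set m := QPath _.
rewrite -(mulrA (of_path K q)) (of_pathM K m).
case: (qpath_compP m p) => [[s -> [e vs ss ts]]|[-> ne]] /=; last first.
  by rewrite mulr0 eq_sym (negPf ne).
rewrite -e eqxx /= of_pathM.
case: (qpath_compP q s) => [[t -> [e' vt _ _]]|[-> ne]] /=; last first.
  by rewrite ts in ne; rewrite (negPf ne).
by rewrite e' ts eqxx of_path_word vt vs /= catA.
Qed.

Lemma path_lift_kill g :
  (forall q p, path_lift (of_path K q * g * of_path K p) = 0) ->
  forall f h, path_lift (f * g * h) = 0.
Proof.
move=> H f h; elim/path_algebra_ind: f => [|f f' IH IH'|c q].
- by rewrite !mul0r path_lift0.
- by rewrite !mulrDl path_liftD IH IH' addr0.
rewrite -!path_scalerAl path_liftZ; apply/eqP; rewrite scaler_eq0; apply/orP; right.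
apply/eqP; elim/path_algebra_ind: h => [|h h' IH IH'|d p].
- by rewrite mulr0 path_lift0.
- by rewrite mulrDr path_liftD IH IH' addr0.
by rewrite -path_scalerAr path_liftZ H scaler0.
Qed.

(** [V] is only a vector space, so that the kernel of [path_lift] is not an ideal for free. The
    induction therefore carries two outer factors; by linearity they may be taken to be paths, and
    [relP] compares the two sides of a relator inside such a longer path. *)
Lemma path_lift_ideal g : ideal_gen rel g ->
  forall f h, path_lift (f * g * h) = 0.
Proof.
elim=> [{}g rg|f h|{}f {}g _ IHf _ IHg u h|f1 {}g h1 _ IH f h].
- apply: path_lift_kill => q p.
  have [v [w1 [w2 [-> h1 h2 e H]]]] := relP rg.
  rewrite mulrBr mulrBl !word_sandwich // -e.
  case: ifP => [/andP[/eqP e1 /eqP e2]|_]; last by rewrite subrr path_lift0.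
  have hq : is_qpath (qend v w1) (val q).2 by rewrite -e2; exact: (valP q).
  have hp := valP p; rewrite -e1 in h1 h2 hq.
  rewrite path_liftB !path_lift_word; last 2 first.
  + rewrite !is_qpath_cat hp -[qend _ _]/(path_tgt p) h2 /=.
    by rewrite -[qend _ w2]/(qend (path_tgt p) w2) e1 -e -{1}e1.
  + by rewrite !is_qpath_cat hp -[qend _ _]/(path_tgt p) h1.
  by rewrite (H _ _ _ hp) ?subrr // -{1}e1.
- by rewrite mulr0 mul0r path_lift0.
- by rewrite mulrDr mulrDl path_liftD IHf IHg addr0.
- by rewrite !(mulrA f) -(mulrA _ h1) IH.
Qed.

Definition class_lift (q : qA) : V := path_lift (repr q).

Lemma class_liftE f : class_lift (qclass rel f) = path_lift f.
Proof.
have /asboolP /path_lift_ideal /(_ 1 1) := class_ideal rel f.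
by rewrite mul1r mulr1 path_liftB => /eqP; rewrite subr_eq0 => /eqP.
Qed.

Lemma class_liftD p q : class_lift (p + q) = class_lift p + class_lift q.
Proof.
elim/classW: p => f; elim/classW: q => g.
by rewrite -classD !class_liftE path_liftD.
Qed.

Lemma class_liftZ c p : class_lift (c *: p) = c *: class_lift p.
Proof. by elim/classW: p => f; rewrite -classZ !class_liftE path_liftZ. Qed.

Lemma class_lift_pcl v w : is_qpath v w -> class_lift (pcl v w) = Phi v w.
Proof. by move=> h; rewrite pclE class_liftE path_lift_word. Qed.
End Lift.
End Classes.

(** * Multiplicative maps between quotients of path algebras, not necessarily unital *)

Section UniversalProperty.
Variables (K : fieldType) (Q Q' : quiver).
Variables (rel : path_algebra K Q -> Prop) (rel' : path_algebra K Q' -> Prop).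
Local Notation qA := (quiver_algebra rel).
Local Notation qA' := (quiver_algebra rel').
Variables (iv : vertex Q -> qA') (ia : arrow Q -> qA').
Hypothesis ivM : forall v v', iv v * iv v' = if v == v' then iv v else 0.
Hypothesis ia_tgt : forall a, iv (qtgt a) * ia a = ia a.
Hypothesis ia_src : forall a, ia a * iv (qsrc a) = ia a.

Definition iword (v : vertex Q) (w : seq (arrow Q)) : qA' :=
  foldl (fun f a => ia a * f) (iv v) w.

Lemma iword_rcons v w a : iword v (rcons w a) = ia a * iword v w.
Proof. exact: foldl_rcons. Qed.

Lemma iword_src v w : iword v w * iv v = iword v w.
Proof.
elim/last_ind: w => [|w a IH]; first by rewrite ivM eqxx.
by rewrite iword_rcons -mulrA IH.
Qed.

Lemma iword_tgt v w : iv (qend v w) * iword v w = iword v w.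
Proof.
elim/last_ind: w => [|w a _]; first by rewrite ivM eqxx.
by rewrite iword_rcons qend_rcons mulrA ia_tgt.
Qed.

Lemma iword_cat v w1 w2 : iword v (w1 ++ w2) = iword (qend v w1) w2 * iword v w1.
Proof.
elim/last_ind: w2 => [|w a IH]; first by rewrite cats0 iword_tgt.
by rewrite -rcons_cat !iword_rcons IH mulrA.
Qed.

Definition imap : path_algebra K Q -> qA' := path_lift iword.

Lemma imapD f g : imap (f + g) = imap f + imap g. Proof. exact: path_extD. Qed.
Lemma imapZ c f : imap (c *: f) = c *: imap f. Proof. exact: path_extZ. Qed.
Lemma imap0 : imap 0 = 0. Proof. exact: path_ext0. Qed.
Lemma imapB f g : imap (f - g) = imap f - imap g.
Proof. exact: path_liftB. Qed.
Lemma imap_sum I (s : seq I) (P : pred I) F :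
  imap (\sum_(i <- s | P i) F i) = \sum_(i <- s | P i) imap (F i).
Proof. exact: (big_morph imap imapD imap0). Qed.

Lemma imap_path p : imap (of_path K p) = iword (val p).1 (val p).2.
Proof. exact: path_ext_path. Qed.

Lemma imapM f g : imap (f * g) = imap f * imap g.
Proof.
have paths q p : imap (of_path K q * of_path K p) =
    imap (of_path K q) * imap (of_path K p).
  rewrite (of_pathM K q p) !imap_path.
  case: (qpath_compP q p) => [[r -> [e vr _ _]]|[-> ne]] /=.
    by rewrite imap_path vr iword_cat -[qend _ _]/(path_tgt p) -e.
  rewrite imap0 -[iword (val p).1 _]iword_tgt -[iword (val q).1 _]iword_src.
  by rewrite -mulrA (mulrA (iv _)) ivM (negPf ne) mul0r mulr0.
elim/path_algebra_ind: f => [|f f' IH IH'|c q].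
- by rewrite mul0r imap0 mul0r.
- by rewrite mulrDl !imapD mulrDl IH IH'.
rewrite -path_scalerAl !imapZ -quiver_algebra_scalerAl; congr (_ *: _).
elim/path_algebra_ind: g => [|g g' IH IH'|d p].
- by rewrite mulr0 imap0 mulr0.
- by rewrite mulrDr !imapD mulrDr IH IH'.
by rewrite -path_scalerAr !imapZ -quiver_algebra_scalerAr paths.
Qed.

Lemma imap_vtx v : imap (vtx K v) = iv v.
Proof. exact: imap_path. Qed.

Lemma imap_arr a : imap (arr K a) = ia a.
Proof. by rewrite [LHS]imap_path -(ia_src a). Qed.

Lemma imap1 : imap 1 = \sum_v iv v.
Proof. rewrite [LHS]imap_sum; apply: eq_bigr => v _; exact: imap_vtx. Qed.

(** [f ^+ 0] goes to [imap 1], the sum of the [iv v], which need not be 1: in the application it is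
    the idempotent of the boundary vertices. The factor [t] absorbs it. *)
Lemma imap_exp f k t : imap 1 * t = t -> imap (f ^+ k) * t = imap f ^+ k * t.
Proof.
move=> h; elim: k => [|k IH]; first by rewrite !expr0 h mul1r.
by rewrite !exprS imapM -mulrA IH mulrA.
Qed.

(** This lemma and the next two treat the three shapes of relators of Lambda: equalities of products
    of three factors, the shift relations of r and s, and the formulas for the squares. *)
Lemma imap_rel3 f1 f2 f3 g1 g2 g3 c1 c2 c3 d1 d2 d3 :
  imap f1 = c1 -> imap f2 = c2 -> imap f3 = c3 ->
  imap g1 = d1 -> imap g2 = d2 -> imap g3 = d3 ->
  c1 * c2 * c3 = d1 * d2 * d3 -> imap (f1 * f2 * f3 - g1 * g2 * g3) = 0.
Proof.
by do 6!move=> <-; move=> e; rewrite imapB !imapM e subrr.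
Qed.

Lemma imap_shift f g1 k g2 l g3 c d1 d2 d3 :
  imap f = c -> imap g1 = d1 -> imap g2 = d2 -> imap g3 = d3 ->
  c * imap 1 = c -> imap 1 * d2 = d2 -> c = d1 ^+ k * d2 * d3 ^+ l ->
  imap (f - g1 ^+ k * g2 * g3 ^+ l) = 0.
Proof.
do 4!move=> <-; move=> hc hd e.
have h1 : imap 1 * imap 1 = imap 1 by rewrite -imapM mulr1.
rewrite imapB !imapM (@imap_exp g1) // -[g3 ^+ l]mulr1 imapM (@imap_exp g3) //.
by rewrite mulrA -e hc subrr.
Qed.

Lemma imap_square f f' g1 k1 g2 g3 k3 g4 g5 k5 g6 c c' d1 d2 d3 d4 d5 d6 :
  imap f = c -> imap f' = c' -> imap g1 = d1 -> imap g2 = d2 -> imap g3 = d3 ->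
  imap g4 = d4 -> imap g5 = d5 -> imap g6 = d6 ->
  imap 1 * d2 = d2 -> imap 1 * d4 = d4 -> imap 1 * d6 = d6 ->
  c ^+ 2 * c' = d1 ^+ k1 * d2 * d3 ^+ k3 * d4 * d5 ^+ k5 * d6 ->
  imap (f ^+ 2 * f' - g1 ^+ k1 * g2 * g3 ^+ k3 * g4 * g5 ^+ k5 * g6) = 0.
Proof.
do 8!move=> <-; move=> h2 h4 h6 e.
rewrite imapB !imapM -expr2 e; apply/eqP; rewrite subr_eq0; apply/eqP.
rewrite -!(mulrA (imap (g1 ^+ k1))) (@imap_exp g1); last by rewrite !mulrA h2.
rewrite -!mulrA; congr (_ * (_ * _)).
rewrite (@imap_exp g3); last by rewrite mulrA h4.
by rewrite (@imap_exp g5).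
Qed.

Hypothesis relK : forall f, rel f -> imap f = 0.

Lemma imap_ideal f : f \in ideal rel -> imap f = 0.
Proof.
move=> /asboolP; elim=> [g /relK //||g h _ eg _ eh|g h k _ e].
- exact: imap0.
- by rewrite imapD eg eh addr0.
- by rewrite !imapM e mulr0 mul0r.
Qed.

Definition cmap (q : qA) : qA' := imap (repr q).

Lemma cmapE f : cmap (qclass rel f) = imap f.
Proof.
have /imap_ideal := class_ideal rel f.
by rewrite imapB => /eqP; rewrite subr_eq0 => /eqP.
Qed.

Lemma cmapD p q : cmap (p + q) = cmap p + cmap q.
Proof. by elim/classW: p => f; elim/classW: q => g; rewrite -classD !cmapE imapD. Qed.
Lemma cmapZ c p : cmap (c *: p) = c *: cmap p.
Proof. by elim/classW: p => f; rewrite -classZ !cmapE imapZ. Qed.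
Lemma cmapM p q : cmap (p * q) = cmap p * cmap q.
Proof. by elim/classW: p => f; elim/classW: q => g; rewrite -classM !cmapE imapM. Qed.
Lemma cmap_vcl v : cmap (vcl rel v) = iv v.
Proof. by rewrite vclE cmapE imap_vtx. Qed.
Lemma cmap_acl a : cmap (acl rel a) = ia a.
Proof. by rewrite aclE cmapE imap_arr. Qed.
Lemma cmap1 : cmap 1 = \sum_v iv v.
Proof.
by rewrite -class1 cmapE imap1.
Qed.
End UniversalProperty.

(** * Sides of the triangulation *)

Section Strip.
Implicit Types p q r s : strip_point.

Lemma strip_lt_irr p : strip_lt p p = false.
Proof. by case: p => i /=; lia. Qed.

Lemma strip_lt_neg p q : p <> q -> strip_lt p q = ~~ strip_lt q p.
Proof.
by case: p q => i [] j //= ne; have : i <> j by [move=> e; rewrite e in ne];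
  lia.
Qed.

(** Together with [ccw_pivot_irr]: for fixed [q] the cyclic order gives a strict order on the other
    points. A side that turns around [q] moves strictly in it and cannot come back to where it
    started. *)
Lemma ccw_pivot_trans q p r s : ccw p q r -> ccw r q s -> ccw p q s.
Proof. by rewrite /ccw; case: p q r s => i [] j [] k [] l /=; lia. Qed.

Lemma ccw_pivot_irr p q : ccw p q p = false.
Proof. by rewrite /ccw; case: p q => i [] j /=; lia. Qed.

Lemma strip_nextP p : strip_lt p (strip_next p).
Proof. by case: p => i /=; lia. Qed.

Definition same_side p q :=
  match p, q with inl _, inl _ => true | inr _, inr _ => true | _, _ => false end.

(* The number of steps along strip_next from p to q, on the same boundary
   component. *)
Definition strip_dist p q : int :=
  match p, q with inl i, inl j => j - i | inr i, inr j => i - j | _, _ => 0 end.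

Lemma strip_distD p q r : same_side p q -> same_side q r ->
  strip_dist p r = strip_dist p q + strip_dist q r.
Proof. by case: p q r => i [] j [] k //= _ _; lia. Qed.

End Strip.

(** * Deck transformations and the marked points below a point of the strip *)

Section Deck.
Variables n m : nat.
Local Notation deck := (deck n m).
Local Notation mark := (mark n m).
Implicit Types (p q r : strip_point) (k l : int).

Lemma deckD k l p : deck k (deck l p) = deck (k + l) p.
Proof. by case: p => i /=; congr (_ _); ring. Qed.
Lemma deck0 p : deck 0 p = p.
Proof. by case: p => i /=; congr (_ _); ring. Qed.
Lemma deckK k : cancel (deck k) (deck (- k)).
Proof. by move=> p; rewrite deckD addNr deck0. Qed.
Lemma deckVK k : cancel (deck (- k)) (deck k).
Proof. by move=> p; rewrite deckD subrr deck0. Qed.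

Lemma strip_lt_deck k p q : strip_lt (deck k p) (deck k q) = strip_lt p q.
Proof. by case: p q => i [] j //=; lia. Qed.
Lemma ccw_deck k p q r : ccw (deck k p) (deck k q) (deck k r) = ccw p q r.
Proof. by rewrite /ccw !strip_lt_deck. Qed.
Lemma strip_next_deck k p : strip_next (deck k p) = deck k (strip_next p).
Proof. by case: p => i /=; congr (_ _); ring. Qed.

Hypotheses (n_gt0 : (0 < n)%N) (m_gt0 : (0 < m)%N).

Lemma deck_free k p : deck k p = p -> k = 0.
Proof. by case: p => i /= [] /eqP; rewrite -subr_eq0 addrAC subrr add0r mulf_eq0;
 case/orP => /eqP; lia. Qed.

Lemma mod_nat_lt (d : nat) : (0 < d)%N -> forall i : int, (`|(i %% d%:Z)%Z|%N < d)%N.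
Proof. by move=> d0 i; have := @ltz_pmod i d%:Z; have := @modz_ge0 i d%:Z; lia. Qed.

Definition mark_of p : mark :=
  match p with
  | inl i => inl (Ordinal (mod_nat_lt n_gt0 i))
  | inr i => inr (Ordinal (mod_nat_lt m_gt0 i))
  end.

Lemma mod_natE (d : nat) (i : int) : (0 < d)%N -> (`|(i %% d%:Z)%Z|%N%:Z = (i %% d%:Z)%Z).
Proof. by move=> d0; have := @modz_ge0 i d%:Z; lia. Qed.

Lemma strip_mark_of p : exists k, p = deck k (strip_mark (mark_of p)).
Proof.
case: p => i /=; [exists (i %/ n%:Z)%Z|exists (i %/ m%:Z)%Z]; congr (_ _);
  by rewrite mod_natE // addrC -divz_eq.
Qed.

Lemma mark_of_mark (p : mark) : mark_of (strip_mark p) = p.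
Proof.
by case: p => i /=; congr (_ _); apply: val_inj => /=; have := ltn_ord i;
  rewrite modz_nat /= => h; rewrite modn_small.
Qed.

Lemma mark_of_deck k p : mark_of (deck k p) = mark_of p.
Proof. by case: p => i /=; congr (_ _); apply: val_inj => /=; rewrite addrC modzMDl. Qed.

Lemma strip_next_mark (p : mark) :
  exists k, strip_next (strip_mark p) = deck k (strip_mark (mark_next p)).
Proof.
case: p => i /=; have := ltn_ord i.
  case: (ltngtP i.+1 n) => h _.
  - by exists 0; rewrite modn_small // mul0r addr0; congr (_ _); lia.
  - by have := ltn_ord i; lia.
  by exists 1; rewrite h modnn; congr (_ _); lia.
case: (posnP i) => h _.
  by exists (-1); rewrite h add0n modn_small ?ltn_predL //; congr (_ _); lia.
exists 0; rewrite mul0r addr0; congr (_ _).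
have -> : ((i + m).-1 = i.-1 + m)%N by lia.
by rewrite modnDr modn_small; have := ltn_ord i; lia.
Qed.

Lemma mark_of_next p : mark_of (strip_next p) = mark_next (mark_of p).
Proof.
have [k {1}->] := strip_mark_of p; rewrite strip_next_deck mark_of_deck.
by have [l ->] := strip_next_mark (mark_of p); rewrite mark_of_deck mark_of_mark.
Qed.
End Deck.

(** * Arrows as turns of a side around one of its ends, and the fans of the marked points *)

Section Nodes.
Variables (n m : nat) (n_gt0 : (0 < n)%N) (m_gt0 : (0 < m)%N).
Variable T : annulus_triangulation n m.
Local Notation node := ((triangle T * 'I_3) + mark n m)%type.
Local Notation deck := (deck n m).
Local Notation mark_of := (mark_of n_gt0 m_gt0).
Implicit Types x y : node.

(* The nodes are the arrows.  gm x is the other arrow with the same target as x,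
   and sg x and nxt x = sg (gm x) are the arrows starting there; iterating sg
   runs around a triangle, iterating nxt around a marked point. *)
Definition sg x : node := pos3_node x.
Definition gm x : node := leaving_node (glue (leaving_side x)).
Definition nxt x : node := entering_node (glue (leaving_side x)).
Definition is_mark x : bool := if x is inr _ then true else false.

Lemma leaving_sideK x : leaving_node (leaving_side x) = x.
Proof. by case: x => [[t i]|p] //=; rewrite mark_prevK. Qed.
Lemma leaving_nodeK x : leaving_side (leaving_node x) = x.
Proof. by case: x => [[t i]|p] //=; rewrite mark_nextK. Qed.

Lemma gmK : involutive gm.
Proof. by move=> x; rewrite /gm leaving_nodeK glueK leaving_sideK. Qed.

Lemma nxtE x : nxt x = sg (gm x).
Proof. by rewrite /nxt /gm; case: (glue _) => [[t i]|p] //=; rewrite /sg /= mark_nextK. Qed.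

Lemma sg_inj : injective sg.
Proof.
apply: (can_inj (g := pos0_node (T := T))) => -[[t i]|p] /=;
  by rewrite ?ordSK ?mark_prevK.
Qed.

Lemma nxt_inj : injective nxt.
Proof. by move=> x y; rewrite !nxtE => /sg_inj /(can_inj gmK). Qed.

Lemma is_mark_sg x : is_mark (sg x) = is_mark x.
Proof. by case: x => [[t i]|p]. Qed.

Lemma ordS3 (i : 'I_3) : ordS (ordS (ordS i)) = i.
Proof. by case: i => [[|[|[|//]]] h]; apply: val_inj. Qed.

Lemma ordSS3 (i : 'I_3) : ordS (ordS i) = ord_pred i.
Proof. by case: i => [[|[|[|//]]] h]; apply: val_inj. Qed.

Lemma sg3 x : ~~ is_mark x -> sg (sg (sg x)) = x.
Proof. by case: x => [[t i]|p] //= _; rewrite /sg /= ordS3. Qed.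

(* The target of the arrow at x is a side of the triangulation, around whose
   end point edge_piv x the arrow turns. *)
Definition edge_piv x : strip_point := side_src (leaving_side x).
Definition edge_end x : strip_point := side_tgt (leaving_side x).

Lemma edge_gm x : exists k,
  edge_piv (gm x) = deck k (edge_end x) /\ edge_end (gm x) = deck k (edge_piv x).
Proof.
have [k [h1 h2]] := glue_sides (leaving_side x); exists k.
by rewrite /edge_piv /edge_end /gm leaving_nodeK h1 h2.
Qed.

Lemma edge_piv_sg x : ~~ is_mark x -> edge_piv (sg x) = edge_end x.
Proof. by case: x => [[t i]|p]. Qed.

Lemma edge_end_sg x : ~~ is_mark x -> edge_end (sg (sg x)) = edge_piv x.
Proof. by case: x => [[t i]|p] //= _; rewrite /edge_end /= ordS3. Qed.

Lemma edge_ccw x : ~~ is_mark x ->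
  ccw (edge_piv x) (edge_end x) (edge_end (sg x)).
Proof.
case: x => [[t i]|p] //= _; rewrite /edge_end /edge_piv /= ordSS3.
exact: corner_ccw.
Qed.

Lemma edge_mark (p : mark n m) : exists k,
  edge_piv (inr p) = deck k (strip_mark p) /\
  edge_end (inr p) = strip_mark (mark_prev p).
Proof.
rewrite /edge_piv /edge_end /=; have [k ->] := strip_next_mark n_gt0 m_gt0 (mark_prev p).
by exists k; rewrite mark_prevK.
Qed.

Lemma edge_mark_next (p : mark n m) : edge_piv (inr p) = strip_next (edge_end (inr p)).
Proof. by []. Qed.

Lemma edge_piv_nxt x : exists k, edge_piv (nxt x) = deck k (edge_piv x).
Proof.
have [k [h1 h2]] := edge_gm x; rewrite nxtE.
case: (boolP (is_mark (gm x))) => [|h]; last by exists k; rewrite edge_piv_sg.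
case: (gm x) h2 => // p h2 _; rewrite /sg /=.
have [l [-> _]] := edge_mark (mark_prev p); have [_ [_ e]] := edge_mark p.
by exists (l + k); rewrite -e h2 deckD.
Qed.

Definition piv_mark x : mark n m := mark_of (edge_piv x).

Lemma piv_mark_nxt x : piv_mark (nxt x) = piv_mark x.
Proof. by rewrite /piv_mark; have [k ->] := edge_piv_nxt x; rewrite mark_of_deck. Qed.
Lemma piv_mark_iter k x : piv_mark (iter k nxt x) = piv_mark x.
Proof. by elim: k => //= k IH; rewrite piv_mark_nxt. Qed.
Lemma piv_mark_inr p : piv_mark (inr p) = p.
Proof. by rewrite /piv_mark; have [k [-> _]] := edge_mark p; rewrite mark_of_deck mark_of_mark. Qed.
Lemma mark_end_gm x : mark_of (edge_end (gm x)) = piv_mark x.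
Proof. by have [k [_ ->]] := edge_gm x; rewrite mark_of_deck. Qed.
Lemma piv_mark_gm x : piv_mark (gm x) = mark_of (edge_end x).
Proof. by rewrite -[x in RHS]gmK mark_end_gm. Qed.

(** Gluing moves the pivot by some deck transformation; [deck (- k)] moves the new side back, so
    that the two sides are compared around the same lift of the pivot. *)
Lemma edge_nxt_ccw x : ~~ is_mark (nxt x) -> exists k,
  edge_piv (nxt x) = deck k (edge_piv x) /\
  ccw (edge_end x) (edge_piv x) (deck (- k) (edge_end (nxt x))).
Proof.
rewrite nxtE is_mark_sg => h; have [k [h1 h2]] := edge_gm x.
exists k; rewrite edge_piv_sg // h2; split=> //.
by rewrite -(ccw_deck n m k) deckVK -h1 -h2; apply: edge_ccw.
Qed.

Lemma edge_iter_ccw k x : (0 < k)%N ->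
  (forall i, (0 < i <= k)%N -> ~~ is_mark (iter i nxt x)) -> exists l,
  edge_piv (iter k nxt x) = deck l (edge_piv x) /\
  ccw (edge_end x) (edge_piv x) (deck (- l) (edge_end (iter k nxt x))).
Proof.
elim: k => // -[|k] IH _ H.
  by have [|l [h1 h2]] := @edge_nxt_ccw x; [apply: (H 1%N)|exists l].
have [//|i hi|l [h1 h2]] := IH; first by apply: H; lia.
have [|j [h3 h4]] := @edge_nxt_ccw (iter k.+1 nxt x).
  by apply: (H k.+2); lia.
exists (j + l); rewrite iterS h3 h1 deckD; split=> //.
apply: (ccw_pivot_trans h2); move: h4.
by rewrite h1 -(ccw_deck n m (- l)) deckK deckD opprD addrC.
Qed.

(** Otherwise a whole orbit of [nxt] would turn strictly around the pivot and end at the side where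
    it began. The deck transformation picked up on the way fixes the pivot, hence is trivial, and
    the side would lie strictly after itself. *)
Lemma nxt_mark x : exists k, is_mark (iter k nxt x).
Proof.
have [[k hk]|H] := pselect (exists k, is_mark (iter k nxt x)); first by exists k.
have Hn k : ~~ is_mark (iter k nxt x) by apply/negP => h; apply: H; exists k.
have [|i _|l [h1 h2]] := @edge_iter_ccw (fingraph.order nxt x) x; rewrite ?order_gt0 //.
move: h1 h2; rewrite iter_order; last exact: nxt_inj.
by move=> /esym /(deck_free n_gt0 m_gt0) ->; rewrite oppr0 deck0 ccw_pivot_irr.
Qed.

Lemma fan_connect x : fconnect nxt (inr (piv_mark x)) x.
Proof.
have [k] := nxt_mark x; case e: (iter k nxt x) => [//|p] _.
rewrite (fconnect_sym nxt_inj).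
suff -> : inr (piv_mark x) = iter k nxt x by exact: fconnect_iter.
by rewrite e -(piv_mark_iter k) e piv_mark_inr.
Qed.

(* The fan of p consists of inr p and of the arrows that turn around p. *)
Definition fan_size (p : mark n m) := fingraph.order nxt (inr p).
Definition fan_pos x := findex nxt (inr (piv_mark x)) x.

Lemma fan_posP x : iter (fan_pos x) nxt (inr (piv_mark x)) = x.
Proof. exact/iter_findex/fan_connect. Qed.
Lemma fan_pos_lt x : (fan_pos x < fan_size (piv_mark x))%N.
Proof. exact/findex_max/fan_connect. Qed.

Lemma fan_pos_mark p : fan_pos (inr p) = 0%N.
Proof. by rewrite /fan_pos piv_mark_inr findex0. Qed.

Lemma fan_size_iter p : iter (fan_size p) nxt (inr p) = inr p.
Proof. exact: (iter_order nxt_inj). Qed.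

Lemma fan_pos_iter p k : (k < fan_size p)%N -> fan_pos (iter k nxt (inr p)) = k.
Proof.
move=> h; rewrite /fan_pos piv_mark_iter piv_mark_inr.
exact: findex_iter.
Qed.

Lemma fan_iter_mark p k : (0 < k < fan_size p)%N -> ~~ is_mark (iter k nxt (inr p)).
Proof.
move=> /andP[k0 kl]; apply/negP; case e: (iter k nxt (inr p)) => [//|q] _.
have := fan_pos_iter kl; rewrite e fan_pos_mark => h; by rewrite -h in k0.
Qed.

Lemma nxt_mark_fan x : is_mark (nxt x) = (fan_pos x == (fan_size (piv_mark x)).-1).
Proof.
have := fan_pos_lt x; have := fan_posP x.
set k := fan_pos x; set o := fan_size _ => e lt.
case: eqP => [ek|nk].
  rewrite -e -iterS ek prednK; last by apply: leq_ltn_trans lt.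
  by rewrite fan_size_iter.
rewrite -e -iterS; apply/negbTE/fan_iter_mark; rewrite /= -/o; lia.
Qed.

Lemma fan_pos_nxt x : ~~ is_mark (nxt x) -> fan_pos (nxt x) = (fan_pos x).+1.
Proof.
rewrite nxt_mark_fan => ne; rewrite -{1}(fan_posP x) -iterS fan_pos_iter //.
have := fan_pos_lt x; lia.
Qed.

Lemma nxt_markE x : is_mark (nxt x) -> nxt x = inr (piv_mark x).
Proof.
by case e: (nxt x) => [//|p] _; rewrite -piv_mark_nxt e piv_mark_inr.
Qed.

(** Both arrows lie in the fan of one marked point. Between two different positions of a fan the
    boundary arrow is not met again, so the side turns strictly and does not return to the same
    lift; hence the positions agree. *)
Lemma edge_unique x y k : edge_piv y = deck k (edge_piv x) ->
  edge_end y = deck k (edge_end x) -> x = y.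
Proof.
wlog le : x y k / (fan_pos x <= fan_pos y)%N => [H h1 h2|h1 h2].
  have [le|lt] := leqP (fan_pos x) (fan_pos y); first exact: (H x y k).
  by apply/esym/(H y x (- k)); rewrite ?(ltnW lt) // ?h1 ?h2 deckK.
have ep : piv_mark y = piv_mark x by rewrite /piv_mark h1 mark_of_deck.
have lty := fan_pos_lt y; have Hx := fan_posP x; have Hy := fan_posP y.
move: le lty Hx Hy; rewrite ep; set i := fan_pos x; set j := fan_pos y => le lty Hx Hy.
case: (ltngtP i j) le => // [lt|e] _; last by rewrite -Hx -Hy e.
have yx : iter (j - i) nxt x = y by rewrite -Hx -iterD subnK // ltnW.
have [||l] := @edge_iter_ccw (j - i) x; first by lia.
  by move=> d hd; rewrite -Hx -iterD; apply: fan_iter_mark; lia.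
rewrite yx h1 h2 => -[e1 c].
have := deckK n m l (edge_piv x); rewrite -e1 deckD.
move=> /(deck_free n_gt0 m_gt0) kl; move: c.
by rewrite deckD kl deck0 ccw_pivot_irr.
Qed.
End Nodes.

(** * Lifts of the sides to the strip, and sides joining the two boundary components *)

Section Lifts.
Variables (n m : nat) (n_gt0 : (0 < n)%N) (m_gt0 : (0 < m)%N).
Variable T : annulus_triangulation n m.
Local Notation node := ((triangle T * 'I_3) + mark n m)%type.
Local Notation deck := (deck n m).
Implicit Types (x y b c : node) (P Q R S : strip_point).

(* The side at b lifts to the side from P to Q of the triangulation of the strip. *)
Definition elift b P Q := exists k, edge_piv b = deck k P /\ edge_end b = deck k Q.

Lemma elift_refl b : elift b (edge_piv b) (edge_end b).
Proof. by exists 0; rewrite !deck0. Qed.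

Lemma elift_deck k b P Q : elift b P Q -> elift b (deck k P) (deck k Q).
Proof. by case=> j [h1 h2]; exists (j - k); rewrite h1 h2 !deckD !subrK. Qed.

Lemma elift_gm b P Q : elift b P Q -> elift (gm b) Q P.
Proof.
case=> j [h1 h2]; have [k [h3 h4]] := edge_gm b.
by exists (k + j); rewrite h3 h4 h1 h2 !deckD.
Qed.

Lemma elift_sg b P Q : ~~ is_mark b -> elift b P Q ->
  exists S, [/\ ccw P Q S, elift (sg b) Q S & elift (sg (sg b)) S P].
Proof.
move=> nb [k [h1 h2]]; exists (deck (- k) (edge_end (sg b))); split.
- by rewrite -(ccw_deck n m k) deckVK -h1 -h2; apply: edge_ccw.
- by exists k; rewrite edge_piv_sg // deckVK.
exists k; rewrite deckVK edge_piv_sg ?is_mark_sg //.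
by rewrite edge_end_sg.
Qed.

Lemma elift_unique x y P Q : elift x P Q -> elift y P Q -> x = y.
Proof.
case=> k [h1 h2] [l [h3 h4]].
apply: (@edge_unique n m n_gt0 m_gt0 T x y (l - k)).
  by rewrite h1 h3 deckD subrK.
by rewrite h2 h4 deckD subrK.
Qed.

Lemma elift_noncross x y P Q R S : elift x P Q -> elift y R S -> ~~ strip_cross P Q R S.
Proof.
case=> k [h1 h2] [l [h3 h4]].
have := sides_noncrossing (leaving_side x) (leaving_side y) (k - l).
rewrite -[side_src (leaving_side x)]/(edge_piv x) -[side_src (leaving_side y)]/(edge_piv y).
rewrite -[side_tgt (leaving_side x)]/(edge_end x) -[side_tgt (leaving_side y)]/(edge_end y).
by rewrite h1 h2 h3 h4 !deckD subrK /strip_cross !ccw_deck.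
Qed.

Lemma elift_mark b P Q : is_mark b -> elift b P Q -> P = strip_next Q.
Proof.
case: b => [//|p] _ [k [h1 h2]]; apply: (can_inj (deckK n m k)).
by rewrite -strip_next_deck -h1 -h2 -edge_mark_next.
Qed.

Lemma elift_piv_mark b P Q : elift b P Q -> piv_mark n_gt0 m_gt0 b = mark_of n_gt0 m_gt0 P.
Proof. by rewrite /piv_mark; case=> k [-> _]; rewrite mark_of_deck. Qed.

Lemma gm_mark p : is_mark (gm (inr p : node)) = false.
Proof.
by rewrite /gm /=; have [s ->] := glue_boundary T (mark_prev p).
Qed.

(** A side longer than [n] on the outer component, or than [m] on the inner one, would cross its
    translate by one turn. The sum is a bound common to both components. *)
Lemma elift_dist_le b P Q : elift b P Q -> same_side P Q ->
  strip_dist P Q <= (n + m)%:Z.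
Proof.
move=> h; have := @elift_noncross b b P Q (deck 1 P) (deck 1 Q) h (elift_deck 1 h).
have := @elift_noncross b b P Q (deck (-1) P) (deck (-1) Q) h (elift_deck (-1) h).
by case: P Q h => i [] j //= _; rewrite /strip_cross /ccw /=; lia.
Qed.

(* Passing from a triangle to the neighbouring one over a longer side, as
   long as all three corners are on the same boundary component. *)
Lemma elift_ind_outward (Prop_ : node -> Prop) :
  (forall c P Q S, ~~ is_mark c -> elift c P Q -> same_side P Q -> strip_lt P Q ->
     ccw P Q S -> elift (sg c) Q S -> elift (sg (sg c)) S P ->
     (same_side P S -> strip_lt P S -> Prop_ (gm (sg (sg c)))) ->
     (same_side P S -> strip_lt S Q -> Prop_ (gm (sg c))) -> Prop_ c) ->
  forall c P Q, elift c P Q -> same_side P Q -> strip_lt P Q -> Prop_ c.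
Proof.
move=> H c P Q; have [k] := ubnP `|(n + m)%:Z - strip_dist P Q|%N.
elim: k c P Q => // k IH c P Q lek h sPQ ltPQ.
have dle := elift_dist_le h sPQ.
have nc : ~~ is_mark c.
  apply/negP => /elift_mark /(_ h) e; move: ltPQ; rewrite e.
  by case: (Q) => i /=; lia.
have [S [cS h1 h2]] := elift_sg nc h.
apply: (H c P Q S nc h sPQ ltPQ cS h1 h2) => sPS ltS.
- have h3 := elift_gm h2; apply: (IH _ P S _ h3) => //.
  have := elift_dist_le h3 sPS.
  by move: sPQ sPS cS lek ltPQ ltS dle; rewrite /ccw; case: (P) (Q) (S) => i [] j [] k' //=; lia.
- have h3 := elift_gm h1.
  have sSQ : same_side S Q by move: sPQ sPS; case: (P) (Q) (S) => i [] j [] k'.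
  apply: (IH _ S Q _ h3) => //.
  have := elift_dist_le h3 sSQ.
  by move: sPQ sPS cS lek ltPQ ltS dle; rewrite /ccw; case: (P) (Q) (S) => i [] j [] k' //=; lia.
Qed.

(** Going outwards from the triangle at a boundary interval has to stop, and it stops only at a
    triangle with corners on both components, which has a side joining them. *)
Lemma exists_bridge : exists b i j, elift b (inl i) (inr j).
Proof.
pose p : mark n m := inl (Ordinal n_gt0).
have := elift_gm (elift_refl (inr p)); rewrite edge_mark_next.
set P := edge_end _; have : same_side P (strip_next P) by case: (P).
have : strip_lt P (strip_next P) by exact: strip_nextP.
move: (gm _) => c; move: P (strip_next P) => P Q lt sPQ h.
suff main : forall c P Q, elift c P Q -> same_side P Q -> strip_lt P Q ->
    exists b R S, elift b R S /\ ~~ same_side R S.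
  have [b [R [S [hb ns]]]] := main _ _ _ h sPQ lt.
  case: R S hb ns => R [] S hb // _; first by exists b, R, S.
  by exists (gm b), S, R; apply: elift_gm.
apply: elift_ind_outward => {}c {}P {}Q S nc {}h {}sPQ {}lt cS h1 h2 IH1 IH2.
have [sPS|ns] := boolP (same_side P S); last first.
  by exists (gm (sg (sg c))), P, S; split=> //; apply: elift_gm.
have [lt1|lt1] := boolP (strip_lt P S); first exact: IH1.
apply: IH2 => //; move: sPQ sPS cS lt lt1; rewrite /ccw.
by case: (P) (Q) (S) => i [] j [] k' //=; lia.
Qed.
End Lifts.

(** * Paths of the dimer algebra across the sides *)

Section Fans.
Variables (n m : nat) (n_gt0 : (0 < n)%N) (m_gt0 : (0 < m)%N).
Variable T : annulus_triangulation n m.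
Local Notation node := ((triangle T * 'I_3) + mark n m)%type.
Local Notation mark := (mark n m).
Local Notation pm := (piv_mark n_gt0 m_gt0).
Local Notation mark_of := (mark_of n_gt0 m_gt0).
Local Notation fan_pos := (@fan_pos n m n_gt0 m_gt0 T).
Implicit Types (x y b c : node) (p q : mark).

Lemma order_fan x : fingraph.order (@nxt n m T) x = fan_size T (pm x).
Proof.
rewrite /fan_size /fingraph.order; apply: eq_card => y.
apply/esym/same_connect; last exact: fan_connect.
exact/fconnect_sym/nxt_inj.
Qed.

(* E x is the idempotent at the target of the arrow x, and a x the class of x. *)
Variables (A : pzRingType) (E a : node -> A).

Fixpoint run x k : A := if k is k'.+1 then a (iter k (@nxt n m T) x) * run x k' else E x.

Hypothesis EM : forall x y, E x * E y = if (y == x) || (y == gm x) then E x else 0.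
Hypothesis E_gm : forall x, E (gm x) = E x.
Hypothesis E_a : forall x, E x * a x = a x.
Hypothesis a_E : forall x, a (sg x) * E x = a (sg x).
Hypothesis dimer : forall x, ~~ is_mark x ->
  a (sg (sg x)) * a (sg x) = run x (fingraph.order (@nxt n m T) x).-1.

Lemma E_idem x : E x * E x = E x. Proof. by rewrite EM eqxx. Qed.
Lemma a_nxtE x : a (nxt x) * E x = a (nxt x).
Proof. by rewrite nxtE -(E_gm x) a_E. Qed.

Lemma run_src x k : run x k * E x = run x k.
Proof. by elim: k => [|k IH] /=; rewrite ?E_idem // -mulrA IH. Qed.
Lemma run_tgt x k : E (iter k (@nxt n m T) x) * run x k = run x k.
Proof. by case: k => [|k] /=; rewrite ?E_idem // mulrA E_a. Qed.
Lemma run_add x k l : run x (k + l) = run (iter k (@nxt n m T) x) l * run x k.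
Proof.
elim: l => [|l IH]; first by rewrite addn0 run_tgt.
by rewrite addnS /= IH mulrA -iterS -iterS -iterD addSn addnC.
Qed.
Lemma runS x k : run x k.+1 = run (nxt x) k * a (nxt x).
Proof. by rewrite -[k.+1]add1n run_add /= a_nxtE. Qed.

(* The parts of the fan of pm x before and after the target of x. *)
Definition hed x := run (inr (pm x)) (fan_pos x).
Definition tl x := run x ((fan_size T (pm x)).-1 - fan_pos x).
Definition ax p := a (inr p).
Definition ee p := E (inr p).

Lemma hed_mark p : hed (inr p) = ee p.
Proof. by rewrite /hed piv_mark_inr fan_pos_mark. Qed.

Lemma hed_nxt x : ~~ is_mark (nxt x) -> hed (nxt x) = a (nxt x) * hed x.
Proof.
move=> h; rewrite /hed piv_mark_nxt (fan_pos_nxt n_gt0 m_gt0 h) /=.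
by rewrite (fan_posP n_gt0 m_gt0 x).
Qed.

Lemma tl_nxt x : ~~ is_mark (nxt x) -> tl x = tl (nxt x) * a (nxt x).
Proof.
move=> h; rewrite /tl piv_mark_nxt (fan_pos_nxt n_gt0 m_gt0 h) -runS; congr (run _ _).
by have := fan_pos_lt n_gt0 m_gt0 x; move: h; rewrite (nxt_mark_fan n_gt0 m_gt0); lia.
Qed.

Lemma tl_mark x : is_mark (nxt x) -> tl x = E x.
Proof. by rewrite (nxt_mark_fan n_gt0 m_gt0) /tl => /eqP ->; rewrite subnn. Qed.

Lemma tl_src x : tl x * E x = tl x. Proof. exact: run_src. Qed.
Lemma hed_tgt x : E x * hed x = hed x.
Proof. by rewrite /hed -{1}(fan_posP n_gt0 m_gt0 x) run_tgt. Qed.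
Lemma hed_src x : hed x * ee (pm x) = hed x. Proof. exact: run_src. Qed.

(** The longer side of the dimer relation runs around a fan, leaving out one arrow, and passes the
    boundary arrow exactly once. Cut there, it is the rest of the fan after [nxt x], then the
    boundary arrow, then the fan up to [x]. *)
Lemma dimer_fan x : ~~ is_mark (nxt x) ->
  a (sg (sg (nxt x))) * a (sg (nxt x)) = hed x * ax (pm x) * tl (nxt x).
Proof.
move=> h; rewrite dimer // order_fan /hed /tl piv_mark_nxt (fan_pos_nxt n_gt0 m_gt0 h).
have := fan_pos_lt n_gt0 m_gt0 x; have := h; rewrite (nxt_mark_fan n_gt0 m_gt0).
have := fan_posP n_gt0 m_gt0 x; set j := fan_pos x; set o := fan_size _ _.
move=> ej ne lt.
have -> : o.-1 = (o.-1 - j.+1 + (1 + j))%N by lia.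
rewrite run_add run_add /= a_nxtE; congr (_ * _); last by congr run; lia.
have -> : nxt (iter (o.-1 - j.+1) (@nxt n m T) (nxt x)) = inr (pm x).
  rewrite -iterSr -iterS -{1}ej -iterD.
  by rewrite (_ : (o.-1 - j.+1).+2 + j = o)%N ?fan_size_iter //; lia.
by [].
Qed.

(* zz b crosses the side at b: it follows the fan of one end of this side up to
   the side, and from there on the fan of its other end.  It is locked because
   associativity would otherwise split it. *)
Definition zz := locked (fun b => tl (gm b) * hed b).
Lemma zzE b : zz b = tl (gm b) * hed b. Proof. by rewrite /zz -lock. Qed.
(** A full turn around the fan of the pivot, based at the target of [x]. At the boundary vertices
    this is multiplication by xy ([rot_XY]). *)
Definition rot x := hed x * ax (pm x) * tl x.
(** The fan of [p] without its boundary arrow: the image of an arrow y, as [ax p] is that of an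
    arrow x. *)
Definition yy p := tl (inr p).

Lemma nxt_gm x : nxt (gm x) = sg x. Proof. by rewrite nxtE gmK. Qed.

Lemma zz_mark p : zz (inr p) = ee p.
Proof. by rewrite !zzE hed_mark tl_mark ?nxt_gm // E_gm E_idem. Qed.

(** The first half of [zz b] ends with the arrow [b] and the second one begins with [sg b], the next
    arrow of the same triangle. The dimer relation at the third arrow replaces the two by the way
    around the third corner, and what precedes and follows completes to paths across the other two
    sides. *)
Lemma zz_rec b : ~~ is_mark b ->
  zz b = zz (gm (sg b)) * ax (pm (sg (sg b))) * zz (gm (sg (sg b))).
Proof.
move=> h.
have h1 : ~~ is_mark (sg b) by rewrite is_mark_sg.
have h2 : ~~ is_mark (sg (sg b)) by rewrite is_mark_sg.
have nb : nxt (gm (sg (sg b))) = b by rewrite nxt_gm sg3.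
rewrite !zzE !gmK tl_nxt ?nxt_gm //.
have hb : hed b = a b * hed (gm (sg (sg b))).
  by have := @hed_nxt (gm (sg (sg b))); rewrite nb; apply.
rewrite hb mulrA -(mulrA (tl (sg b))).
have := @dimer_fan (gm (sg b)); rewrite nxt_gm => /(_ h2).
rewrite (sg3 h1) (sg3 h) => ->; rewrite !mulrA.
by rewrite piv_mark_gm -[X in mark_of X](edge_piv_sg h1).
Qed.

(** Both turns equal the cycle of the three arrows of a triangle, by the dimer relations at two of
    them. At most one of [x] and [gm x] is a boundary arrow, so [x] may be assumed to lie in a
    triangle. *)
Lemma rot_gm x : rot (gm x) = rot x.
Proof.
wlog h : x / ~~ is_mark x => [H|].
  have [mx|] := boolP (is_mark x); last exact: H.
  by case: x mx => [//|p] _; rewrite -[in RHS](gmK (inr p)) -(H (gm (inr p))) ?gm_mark ?gmK.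
have nb : nxt (gm (sg (sg x))) = x by rewrite nxt_gm sg3.
have h1 : ~~ is_mark (sg x) by rewrite is_mark_sg.
have d1 := @dimer_fan (gm (sg (sg x))); rewrite nb in d1.
have d2 := @dimer_fan (gm x); rewrite nxt_gm in d2.
have -> : rot x = a x * (a (sg (sg x)) * a (sg x)).
  rewrite d1 // /rot; have := @hed_nxt (gm (sg (sg x))); rewrite nb => -> //.
  rewrite !mulrA; by rewrite -(piv_mark_nxt n_gt0 m_gt0 (gm (sg (sg x)))) nb.
rewrite /rot tl_nxt nxt_gm // mulrA -d2 // sg3 //.
by rewrite mulrA.
Qed.

Lemma rot_nxt x : a (nxt x) * rot x = rot (nxt x) * a (nxt x).
Proof.
have [h|h] := boolP (is_mark (nxt x)); last first.
  by rewrite /rot (hed_nxt h) piv_mark_nxt (tl_nxt h) !mulrA.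
rewrite {1}/rot (tl_mark h) (nxt_markE n_gt0 m_gt0 h).
have -> : rot (inr (pm x)) = ax (pm x) * yy (pm x).
  by rewrite /rot hed_mark piv_mark_inr /ax /ee E_a.
rewrite -[a (inr _)]/(ax _); have -> : hed x = yy (pm x); last first.
  rewrite -!mulrA; congr (_ * (_ * _)).
  by rewrite /ax -(nxt_markE n_gt0 m_gt0 h) a_nxtE.
rewrite /hed /yy /tl piv_mark_inr fan_pos_mark subn0; congr run.
by move: h; rewrite (nxt_mark_fan n_gt0 m_gt0) => /eqP.
Qed.

Lemma run_rot x k : run x k * rot x = rot (iter k (@nxt n m T) x) * run x k.
Proof.
elim: k => [|k IH] /=; last by rewrite -mulrA IH mulrA rot_nxt mulrA.
rewrite {1}/rot -2!mulrA tl_src !mulrA -[E x * hed x]/(E x * hed x) hed_tgt.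
by rewrite -[LHS]/(rot x).
Qed.

Definition lst p : node := iter (fan_size T p).-1 (@nxt n m T) (inr p).

Lemma fan_size_gt0 p : (0 < fan_size T p)%N. Proof. exact: order_gt0. Qed.

Lemma nxt_lst p : nxt (lst p) = inr p.
Proof. by rewrite /lst -iterS prednK ?fan_size_gt0 // fan_size_iter. Qed.

Lemma gm_lst p : gm (lst p) = inr (mark_next p).
Proof. by apply: sg_inj; rewrite -nxtE nxt_lst /sg /= mark_nextK. Qed.

Lemma pm_lst p : pm (lst p) = p.
Proof. by rewrite -(piv_mark_nxt n_gt0 m_gt0) nxt_lst piv_mark_inr. Qed.

Lemma E_lst p : E (lst p) = ee (mark_next p).
Proof. by rewrite -E_gm gm_lst. Qed.

Lemma tl_end x : iter ((fan_size T (pm x)).-1 - fan_pos x) (@nxt n m T) x = lst (pm x).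
Proof.
have := fan_pos_lt n_gt0 m_gt0 x; have := fan_posP n_gt0 m_gt0 x.
set j := fan_pos x; move=> ej lt.
by rewrite -[X in iter _ _ X]ej -iterD subnK //; lia.
Qed.

Lemma tl_tgt x : ee (mark_next (pm x)) * tl x = tl x.
Proof. by rewrite -E_lst -tl_end run_tgt. Qed.

Lemma zz_src b : zz b * ee (pm b) = zz b.
Proof. by rewrite !zzE -mulrA hed_src. Qed.
Lemma zz_tgt b : ee (mark_next (pm (gm b))) * zz b = zz b.
Proof. by rewrite !zzE mulrA tl_tgt. Qed.

(** A turn can be pushed along a fan ([run_rot]) and does not depend on the end of the side around
    which it is made ([rot_gm]); so it passes through both halves of [zz b]. *)
Lemma zz_rot b :
  zz b * rot (inr (pm b)) = rot (inr (mark_next (pm (gm b)))) * zz b.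
Proof.
rewrite !zzE -mulrA {1}/hed run_rot (fan_posP n_gt0 m_gt0 b) -rot_gm mulrA.
by rewrite {1}/tl run_rot tl_end -rot_gm gm_lst mulrA.
Qed.

Lemma hed_lst p : hed (lst p) = yy p.
Proof.
rewrite /hed pm_lst /yy /tl piv_mark_inr fan_pos_mark subn0 fan_pos_iter //.
by rewrite prednK // fan_size_gt0.
Qed.

Lemma ax_lst p : ax p * E (lst p) = ax p.
Proof. by have := a_nxtE (lst p); rewrite nxt_lst. Qed.

Lemma rot_mark p : rot (inr p) = ax p * yy p.
Proof. by rewrite /rot hed_mark piv_mark_inr /ee /ax E_a. Qed.

Lemma rot_mark_next p : rot (inr (mark_next p)) = yy p * ax p.
Proof.
rewrite -gm_lst rot_gm /rot hed_lst pm_lst tl_mark ?nxt_lst //.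
by rewrite -mulrA ax_lst.
Qed.

Lemma zz_lst p : zz (lst p) = yy (mark_next p) * yy p.
Proof. by rewrite !zzE gm_lst hed_lst. Qed.

Lemma ee_M p q : ee p * ee q = if p == q then ee p else 0.
Proof.
rewrite /ee EM (inj_eq (@inr_inj _ _)) [q == p]eq_sym; case: eqP => //= _.
by have := gm_mark T p; case: (gm _) => // c _.
Qed.

Lemma ax_ee p : ax p * ee (mark_next p) = ax p.
Proof. by rewrite -E_lst ax_lst. Qed.
Lemma ee_ax p : ee p * ax p = ax p.
Proof. by rewrite /ee /ax E_a. Qed.
Lemma yy_ee p : yy p * ee p = yy p.
Proof. by rewrite /yy tl_src. Qed.
Lemma ee_yy p : ee (mark_next p) * yy p = yy p.
Proof. by have := tl_tgt (inr p); rewrite piv_mark_inr. Qed.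

Definition XX : A := \sum_p ax p.
Definition YY : A := \sum_p yy p.

Lemma XX_ee p : XX * ee p = ax (mark_prev p).
Proof.
have e := ax_ee (mark_prev p); rewrite mark_prevK in e.
rewrite /XX mulr_suml (bigD1 (mark_prev p)) //= e big1 ?addr0 // => q nq.
rewrite -ax_ee -mulrA ee_M; case: (mark_next q =P p) => [e'|_]; last by rewrite mulr0.
by rewrite -e' mark_nextK eqxx in nq.
Qed.
Lemma ee_XX p : ee p * XX = ax p.
Proof.
rewrite /XX mulr_sumr (bigD1 p) //= ee_ax big1 ?addr0 // => q nq.
by rewrite -ee_ax mulrA ee_M eq_sym (negPf nq) mul0r.
Qed.
Lemma YY_ee p : YY * ee p = yy p.
Proof.
rewrite /YY mulr_suml (bigD1 p) //= yy_ee big1 ?addr0 // => q nq.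
by rewrite -yy_ee -mulrA ee_M (negPf nq) mulr0.
Qed.
Lemma ee_YY p : ee (mark_next p) * YY = yy p.
Proof.
rewrite /YY mulr_sumr (bigD1 p) //= ee_yy big1 ?addr0 // => q nq.
rewrite -ee_yy mulrA ee_M (inj_eq (can_inj (@mark_nextK n m))) eq_sym (negPf nq).
by rewrite mul0r.
Qed.

Lemma XX_shift p : XX * ee p = ee (mark_prev p) * XX.
Proof. by rewrite XX_ee ee_XX. Qed.
Lemma YY_shift p : YY * ee p = ee (mark_next p) * YY.
Proof. by rewrite YY_ee ee_YY. Qed.

Lemma XX_exp_shift k p : XX ^+ k * ee p = ee (iter k (@mark_prev n m) p) * XX ^+ k.
Proof.
elim: k => [|k IH]; first by rewrite expr0 mul1r mulr1.
by rewrite exprS -mulrA IH mulrA XX_shift iterS mulrA.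
Qed.

Lemma rot_XY p : XX * YY * ee p = rot (inr p).
Proof.
rewrite rot_mark -mulrA YY_shift mulrA XX_ee mark_nextK.
by rewrite -ee_YY mulrA ax_ee.
Qed.

Lemma rot_YX p : YY * XX * ee p = rot (inr p).
Proof.
rewrite -[p in RHS]mark_prevK rot_mark_next -mulrA XX_shift mulrA YY_ee.
by rewrite -{1}yy_ee -mulrA ee_XX.
Qed.

Lemma XYC p : XX * YY * ee p = YY * XX * ee p.
Proof. by rewrite rot_XY rot_YX. Qed.

Lemma ee_XY p : ee p * (XX * YY) = rot (inr p).
Proof. by rewrite mulrA ee_XX rot_mark -ee_YY mulrA ax_ee. Qed.

Lemma zz_XY b : zz b * (XX * YY) = XX * YY * zz b.
Proof. by rewrite -{1}zz_src -mulrA ee_XY zz_rot -rot_XY -mulrA zz_tgt. Qed.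

Lemma zz_rec' b : ~~ is_mark b ->
  zz b = zz (gm (sg b)) * XX * zz (gm (sg (sg b))).
Proof.
move=> nb; rewrite zz_rec // -[zz (gm (sg (sg b)))]zz_tgt gmK.
by rewrite -!mulrA (mulrA XX) XX_ee mark_nextK (mulrA (ax _)) ax_ee.
Qed.

Lemma mark_of_dist (P Q : strip_point) (k : nat) : same_side Q P ->
  strip_dist Q P = k%:Z -> mark_of Q = iter k (@mark_prev n m) (mark_of P).
Proof.
elim: k P Q => [|k IH] P Q sPQ d.
  by congr mark_of; move: sPQ d; case: P Q => i [] j //= _ h; congr (_ _); lia.
rewrite iterS -(IH P (strip_next Q)).
- by rewrite mark_of_next mark_nextK.
- by move: sPQ; case: (P) (Q) => i [].
- by move: sPQ d; case: (P) (Q) => i [] j //= _; lia.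
Qed.

(** With [Q] before [P] the triangle of [b] lies inside the polygon, which has [k.+1] boundary
    intervals. The third corner splits them into [k1.+1] and [k2.+1], and the factor x of the
    recursion gives [k1 + 1 + k2 = k]. *)
Lemma zz_polygon k b P Q : elift b P Q -> same_side Q P ->
  strip_dist Q P = k.+1%:Z -> zz b = XX ^+ k * ee (mark_of P).
Proof.
elim/ltn_ind: k b P Q => k IH b P Q h sQP d.
have [mb|nb] := boolP (is_mark b).
  have eP := elift_mark mb h; have k0 : k = 0%N.
    by move: sQP d; rewrite eP; case: (Q) => i /= _; lia.
  rewrite k0 expr0 mul1r -(elift_piv_mark n_gt0 m_gt0 h).
  by case: b mb {h} => // p _; rewrite zz_mark piv_mark_inr.
have [S [c h1 h2]] := elift_sg nb h.
have sS : [/\ same_side S P, same_side Q S, 0 < strip_dist S P & 0 < strip_dist Q S].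
  by move: c sQP d; rewrite /ccw; case: (P) (Q) (S) => i [] j [] l //= ; split=> //; lia.
case: sS => s1 s2 d1 d2; have dd := strip_distD s2 s1.
case e1: (strip_dist S P) d1 dd => [[|k1]|//] // _ dd.
case e2: (strip_dist Q S) d2 dd => [[|k2]|//] // _ dd.
rewrite zz_rec' // (IH k1 _ (gm (sg (sg b))) P S (elift_gm h2)) //; last by lia.
rewrite (IH k2 _ (gm (sg b)) S Q (elift_gm h1)) //; last by lia.
have -> : mark_of S = iter k1.+1 (@mark_prev n m) (mark_of P) by apply: mark_of_dist.
rewrite -!mulrA (mulrA XX) -exprS (mulrA (ee _)) -XX_exp_shift -mulrA ee_M eqxx mulrA -exprD.
by congr (_ ^+ _ * _); lia.
Qed.

Lemma zz_polygonr k d P Q R : elift d Q R -> same_side Q P ->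
  strip_dist Q P = k%:Z -> zz d * (XX ^+ k * ee (mark_of P)) = zz d * XX ^+ k.
Proof.
move=> h s e; rewrite XX_exp_shift mulrA -(mark_of_dist s e).
by rewrite -(elift_piv_mark n_gt0 m_gt0 h) zz_src.
Qed.

Lemma zz_polygonl k d : XX ^+ k * ee (pm (gm d)) * XX * zz d = XX ^+ k.+1 * zz d.
Proof.
by rewrite -{1}(mark_nextK (pm (gm d))) -(mulrA _ (ee _)) -XX_shift -!mulrA zz_tgt mulrA -exprSr.
Qed.

(** Walk from [b] to the right, one triangle at a time. Since sides do not cross, the third corner
    [S] does not go beyond the end of [c] on its component, so the distance to [c] drops. Each
    triangle has one side that cuts off a polygon at one boundary component. *)
Lemma zz_chain b c (P Q P' Q' : int) :
  elift b (inl P) (inr Q) -> elift c (inl P') (inr Q') -> P <= P' -> Q <= Q' ->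
  zz c = XX ^+ `|Q' - Q| * zz b * XX ^+ `|P' - P| /\
  zz (gm b) = XX ^+ `|P' - P| * zz (gm c) * XX ^+ `|Q' - Q|.
Proof.
have [N] := ubnP (`|P' - P| + `|Q' - Q|)%N.
elim: N b P Q => // N IH b P Q ltN hb hc leP leQ.
have [/andP[/eqP eP /eqP eQ]|ne] := boolP ((P == P') && (Q == Q')).
  rewrite -eP -eQ in hc *; rewrite (elift_unique n_gt0 m_gt0 hb hc).
  by rewrite !subrr !expr0 !mul1r !mulr1.
have hg := elift_gm hb; set g := gm b in hg *.
have gb : gm g = b by exact: gmK.
have ng : ~~ is_mark g by apply/negP => /elift_mark /(_ hg).
have [[S|S] [cS h1 h2]] := elift_sg ng hg.
- have n1 := elift_noncross h1 hc; have n2 := elift_noncross h2 hc.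
  have {n1 n2} [PS SP'] : P < S /\ S <= P'.
    by move: cS n1 n2 ne leP leQ; rewrite /strip_cross /ccw /=; lia.
  have nb' : ~~ is_mark (sg (sg g)) by rewrite !is_mark_sg.
  have [|e1 e2] := IH _ _ _ _ h2 hc SP' leQ; first by lia.
  (* The polygon between [P] and [S] contributes the exponent [S - P - 1]; the factor x of the
     recursion supplies the missing 1. *)
  have hp := elift_gm h1; have [k ek] : exists k, S - P = k.+1%:Z by exists `|S - P|.-1; lia.
  have ep := zz_polygon hp isT ek.
  have z1 : zz (sg (sg g)) = zz b * XX ^+ k.+1.
    rewrite zz_rec' // sg3 // gb ep -mulrA (mulrA XX) -exprS.
    by apply: zz_polygonr hb _ _ => //=; lia.
  have z2 : zz g = XX ^+ k.+1 * zz (gm (sg (sg g))).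
    rewrite zz_rec' // ep -(elift_piv_mark n_gt0 m_gt0 h2) -[X in pm X]gmK.
    exact: zz_polygonl.
  rewrite e1 z2 e2 z1; split.
    by rewrite -!mulrA -exprD; congr (_ * (_ * _ ^+ _)); lia.
  by rewrite !mulrA -exprD; congr (_ ^+ _ * _ * _); lia.
- have n1 := elift_noncross h1 hc; have n2 := elift_noncross h2 hc.
  have {n1 n2} [QS SQ'] : Q < S /\ S <= Q'.
    by move: cS n1 n2 ne leP leQ; rewrite /strip_cross /ccw /=; lia.
  have nb' : ~~ is_mark (sg g) by rewrite !is_mark_sg.
  have [|e1 e2] := IH _ _ _ _ h1 hc leP SQ'; first by lia.
  have hp := elift_gm h2; have [k ek] : exists k, S - Q = k.+1%:Z by exists `|S - Q|.-1; lia.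
  have ep := zz_polygon hp isT ek.
  have z1 : zz (sg g) = XX ^+ k.+1 * zz b.
    rewrite zz_rec' // sg3 // gb ep -(elift_piv_mark n_gt0 m_gt0 hg).
    exact: zz_polygonl.
  have z2 : zz g = zz (gm (sg g)) * XX ^+ k.+1.
    rewrite zz_rec' // ep -mulrA (mulrA XX) -exprS.
    by apply: zz_polygonr (elift_gm h1) _ _ => //=; lia.
  rewrite e1 z2 e2 z1; split.
    by rewrite !mulrA -exprD; congr (_ ^+ _ * _ * _); lia.
  by rewrite -!mulrA -exprD; congr (_ * (_ * _ ^+ _)); lia.
Qed.

Variables (b0 : node) (i0 j0 : int).
Hypothesis b0P : elift b0 (inl i0) (inr j0).

(* The images of r (for true) and s (for false); the side at b0 joins the two
   boundary components. *)
Definition bridge (o : bool) : A := if o then zz b0 else zz (gm b0).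
Definition bsize (o : bool) : nat := if o then n else m.

(** The walk from the side at [b0] to its translate by one turn passes [n] outer and [m] inner
    intervals. *)
Lemma bridge_shift o :
  bridge o = XX ^+ bsize (~~ o) * bridge o * XX ^+ bsize o.
Proof.
have [|||e1 e2] := @zz_chain b0 b0 i0 j0 (i0 + n%:Z) (j0 + m%:Z) b0P; try by lia.
  by have := elift_deck 1 b0P; rewrite /= !mul1r.
have en (x y : int) : x + y - x = y by rewrite addrC addKr.
by rewrite !en in e1 e2; case: o.
Qed.

(** A walk to the right expresses [zz] of its last side through that of its first one, but for the
    reversed sides it is the other way round. So for the first claim [c] is translated to the right
    of [b0], and for the second one [b0] to the right of [c]. As [n] and [m] are positive, [k] turns
    suffice for both. *)
Lemma zz_bridge c i j : elift c (inl i) (inr j) ->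
  (exists k l, zz c = XX ^+ k * bridge true * XX ^+ l) /\
  (exists k l, zz (gm c) = XX ^+ k * bridge false * XX ^+ l).
Proof.
move=> h; pose k : int := `|i - i0| + `|j - j0|.
have hk : (`|i - i0| <= k * n%:Z) && (`|j - j0| <= k * m%:Z).
  by rewrite /k; apply/andP; split; nia.
split.
  have [||-> _] := zz_chain b0P (elift_deck k h : elift c (inl _) (inr _)); try by lia.
  by do 2!eexists.
have [||_ ->] := zz_chain h (elift_deck k b0P : elift b0 (inl _) (inr _)); try by lia.
by do 2!eexists.
Qed.

Definition outer_mark p := if p is inl _ then true else false.

(** Here the triangle of [c] lies away from the boundary part between [P] and [Q]. While its third
    corner is on the same component, a polygon is split off, which changes only the first or the
    last exponent. Once it is on the other component, the two other sides join the components and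
    contribute one crossing in each direction. *)
Lemma zz_outward c P Q : elift c P Q -> same_side P Q -> strip_lt P Q ->
  exists k1 k2 k3, let o := outer_mark (pm c) in
  zz c = XX ^+ k1 * bridge (~~ o) * XX ^+ k2 * bridge o * XX ^+ k3.
Proof.
move: c P Q; apply: (elift_ind_outward n_gt0 m_gt0) => c P Q S nc h sPQ lt cS h1 h2 IH1 IH2.
have h3 := elift_gm h1; have h4 := elift_gm h2.
have pc := elift_piv_mark n_gt0 m_gt0 h.
have [sPS|ns] := boolP (same_side P S).
  have sSQ : same_side S Q by move: sPQ sPS; case: (P) (Q) (S) => i [] j [] k'.
  have [lt1|lt1] := boolP (strip_lt P S).
    have [k1 [k2 [k3 e]]] := IH1 sPS lt1.
    have [k ek] : exists k, strip_dist Q S = k.+1%:Z.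
      exists `|strip_dist Q S|.-1; move: sPQ sPS cS lt lt1.
      by rewrite /ccw; case: (P) (Q) (S) => i [] j [] l //=; lia.
    have sQS : same_side Q S by move: sSQ; case: (Q) (S) => i [].
    rewrite zz_rec' // (zz_polygon h3 sQS ek).
    have := zz_polygonl k (gm (sg (sg c))).
    rewrite gmK (elift_piv_mark n_gt0 m_gt0 h2) => ->.
    rewrite e (elift_piv_mark n_gt0 m_gt0 h4) -pc.
    by exists (k.+1 + k1)%N, k2, k3; rewrite /= exprD !mulrA.
  have ltSQ : strip_lt S Q.
    by move: sPQ sPS cS lt lt1; rewrite /ccw; case: (P) (Q) (S) => i [] j [] k' //=; lia.
  have [k1 [k2 [k3 e]]] := IH2 sPS ltSQ.
  have [k ek] : exists k, strip_dist S P = k.+1%:Z.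
    exists `|strip_dist S P|.-1; move: sPQ sPS cS lt lt1.
    by rewrite /ccw; case: (P) (Q) (S) => i [] j [] l //=; lia.
  have sSP : same_side S P by move: sPS; case: (P) (S) => i [].
  have os : outer_mark (pm (gm (sg c))) = outer_mark (pm c).
    rewrite pc (elift_piv_mark n_gt0 m_gt0 h3).
    by move: sPS; case: (P) (S) => i [].
  rewrite zz_rec' // (zz_polygon h4 sSP ek) -mulrA (mulrA XX) -exprS.
  rewrite (zz_polygonr h3 sSP ek) e os.
  by exists k1, k2, (k3 + k.+1)%N; rewrite /= exprD !mulrA.
rewrite zz_rec' // pc.
case: P S Q sPQ ns h1 h2 h3 h4 {h lt cS IH1 IH2 pc} => i [] j [] l //= _ _ h1 h2 h3 h4.
  have [[k1 [l1 e1]] _] := zz_bridge h4; have [_ [k2 [l2 e2]]] := zz_bridge h1.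
  exists k2, (l2 + 1 + k1)%N, l1.
  by rewrite /= e1 e2 !exprD !mulrA.
have [[k1 [l1 e1]] _] := zz_bridge h3; have [_ [k2 [l2 e2]]] := zz_bridge h2.
exists k1, (l1 + 1 + k2)%N, l2.
by rewrite /= e1 e2 !exprD !mulrA.
Qed.

(** * Paths between boundary vertices are generated by x, y and the two bridges *)

Section Generation.
Variable gen : A -> Prop.
Hypothesis genM : forall u v, gen u -> gen v -> gen (u * v).
Hypothesis gen1 : forall p, gen (ee p).
Hypothesis genX : gen XX.
Hypothesis genY : forall p, gen (yy p).
Hypothesis genB : forall o, gen (bridge o).

Lemma genX_exp k u : gen u -> gen (XX ^+ k * u).
Proof. by elim: k => [|k IH] gu; rewrite ?mul1r // exprS -mulrA; apply/genM/IH. Qed.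

Lemma genX_exp_r k u : gen u -> gen (u * XX ^+ k).
Proof. by elim: k => [|k IH] gu; rewrite ?mulr1 // exprSr mulrA; apply: genM => //; apply: IH. Qed.

Lemma gen_zz c : gen (zz c).
Proof.
have h := elift_refl c.
have bridgeP d i j : elift d (inl i) (inr j) -> gen (zz d) /\ gen (zz (gm d)).
  by case/zz_bridge => -[k [l ->]] [k' [l' ->]]; split; apply/genX_exp_r/genX_exp/genB.
move: (edge_piv c) (edge_end c) h => P Q h.
have [sPQ|ns] := boolP (same_side P Q); last first.
  case: P Q ns h => i [] j // _ h; first by have [] := bridgeP _ _ _ h.
  by have [_] := bridgeP _ _ _ (elift_gm h); rewrite gmK.
have [lt|nlt] := boolP (strip_lt P Q).
  have [k1 [k2 [k3 ->]]] := zz_outward h sPQ lt.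
  by apply/genX_exp_r/genM; [apply/genX_exp_r/genX_exp|]; apply: genB.
have nPQ : P <> Q.
  move=> e; have [mc|nc] := boolP (is_mark c).
    have := elift_mark mc h; have := strip_nextP Q; rewrite e => /[swap] <-.
    by rewrite strip_lt_irr.
  have [S [cS _ _]] := elift_sg nc h; move: cS; rewrite e.
  by case: (Q) (S) => i [] j; rewrite /ccw /=; lia.
have [k ek] : exists k, strip_dist Q P = k.+1%:Z.
  exists `|strip_dist Q P|.-1; move: nlt; rewrite (strip_lt_neg nPQ) negbK.
  by move: sPQ; case: (P) (Q) => i [] j //= _; lia.
have sQP : same_side Q P by move: sPQ; case: (P) (Q) => i [].
by rewrite (zz_polygon h sQP ek); apply: genX_exp.
Qed.

Fixpoint follows c (s : seq node) : bool :=
  if s is d :: s' then ((d == sg c) || (d == nxt c)) && follows d s' else true.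

Definition steps (t : A) (s : seq node) : A := foldl (fun f d => a d * f) t s.

Lemma steps_mul t s : steps t s = steps 1 s * t.
Proof.
elim/last_ind: s => [|s d IH]; first by rewrite mul1r.
by rewrite /steps !foldl_rcons -/(steps t s) -/(steps 1 s) IH mulrA.
Qed.

(** From a side, two standard paths lead to the boundary, along the fans of its two ends. Induction
    from the first arrow shows that every path to a boundary vertex is one of them followed by an
    element of [gen]. *)
Lemma gen_steps c s q : follows c s -> (last c s == inr q) || (last c s == gm (inr q)) ->
  exists2 g, gen g & steps (E c) s = g * tl c \/ steps (E c) s = g * tl (gm c).
Proof.
elim: s c => [|d s IH] c /=.
  move=> _ /orP[/eqP ->|/eqP ->]; exists (ee q) => //=.
  - by right; rewrite tl_mark ?nxt_gm // E_gm E_idem.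
  - by left; rewrite tl_mark ?nxt_gm // E_gm E_idem.
(* [sg c] is [nxt (gm c)] and the claim is symmetric in [c] and [gm c]. *)
wlog dn : c / d = nxt c => [H /andP[/orP[/eqP ds|/eqP dn] fs] el|].
- have [|||g gg] := H (gm c); rewrite ?nxt_gm ?ds ?eqxx ?orbT //.
    by rewrite -ds fs.
    by rewrite -ds.
  rewrite E_gm gmK -ds => e; exists g => //.
  by case: e; [right|left].
- by apply: (H c dn) => //; rewrite dn eqxx orbT -dn fs.
move=> /andP[_ fs] el; have [g gg e] := IH d fs el.
have -> : steps (a d * E c) s = steps (E d) s * a d.
  rewrite (steps_mul (a d * _)) (steps_mul (E d)) -mulrA E_a dn a_nxtE.
  by [].
have [md|nd] := boolP (is_mark d).
  rewrite dn in md; have ed := nxt_markE n_gt0 m_gt0 md.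
  have axE : ax (pm c) * E c = ax (pm c) by rewrite /ax -ed a_nxtE.
  have et := tl_mark md; case: e => ->; rewrite dn ed.
    exists (g * yy (pm c) * ax (pm c)); last by left; rewrite et -[RHS]mulrA axE.
    apply: genM; first exact: genM.
    by rewrite -ee_XX; apply: genM.
  exists (g * ax (pm c)); last first.
    by left; rewrite et tl_mark ?nxt_gm // E_gm -!mulrA axE E_a.
  by apply: genM => //; rewrite -ee_XX; apply: genM.
case: e => ->.
  by exists g => //; left; rewrite -mulrA (@tl_nxt c) -dn.
have ne : ~~ is_mark (gm c) by rewrite -(is_mark_sg (gm c)) -nxtE -dn.
have dsg : d = sg (gm c) by rewrite dn nxtE.
have nnd : ~~ is_mark (nxt (gm d)) by rewrite nxt_gm is_mark_sg.
(* After [d] the path changes fans and continues with [sg d] in the same triangle. The dimer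
   relation trades these two arrows for [tl (gm c)], a boundary arrow and [hed w]; the latter and
   the remaining [tl (sg d)] form [zz w]. *)
pose w : node := gm (sg (sg (gm c))).
have nxw : nxt w = gm c by rewrite nxt_gm sg3.
have gw : gm w = sg d by rewrite gmK dsg.
exists (g * zz w * ax (pm w)).
  apply: genM; first by apply: genM => //; apply: gen_zz.
  by rewrite -ee_XX; apply: genM.
right; rewrite (tl_nxt nnd) nxt_gm -!mulrA; congr (_ * _).
have := @dimer_fan w; rewrite nxw => /(_ ne).
by rewrite -dsg => ->; rewrite !zzE gw !mulrA.
Qed.
End Generation.
End Fans.

(** * The grading of the dimer algebra *)

Section Weights.
Variables (n m : nat) (n_gt0 : (0 < n)%N) (m_gt0 : (0 < m)%N).
Variable T : annulus_triangulation n m.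
Local Notation node := ((triangle T * 'I_3) + mark n m)%type.
Local Notation pm := (piv_mark n_gt0 m_gt0).
Implicit Types (x y : node) (p q : mark n m).

(** Scaled so that one turn adds [n * m] on both components, which makes height differences
    invariant under deck transformations. *)
Definition height (p : strip_point) : int :=
  match p with inl i => i * m%:Z | inr j => j * n%:Z end.

(* The first component tells whether the left end of the strip lies to the left
   of the side from p to q; the second one measures how far the side winds
   around the annulus. *)
Definition side_wt (p q : strip_point) : int * int :=
  ((strip_lt p q)%:R, height q - height p).
Definition phi x := side_wt (edge_piv x) (edge_end x).

Lemma side_wt_deck k (p q : strip_point) : side_wt (deck n m k p) (deck n m k q) = side_wt p q.
Proof.
rewrite /side_wt strip_lt_deck; congr pair.
by case: p q => i [] j /=; ring.
Qed.

Lemma side_wt_opp (p q : strip_point) : p <> q -> side_wt q p = (1, 0) - side_wt p q.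
Proof.
move=> ne; rewrite /side_wt (strip_lt_neg ne); congr pair => /=; last by rewrite sub0r opprB.
by case: strip_lt.
Qed.

Lemma ccw_neq (p q r : strip_point) : ccw p q r -> p <> q.
Proof. by move=> c e; move: c; rewrite e; case: q r {e} => i [] j; rewrite /ccw /=; lia. Qed.

Lemma edge_neq x : edge_piv x <> edge_end x.
Proof.
have [mx|nx] := boolP (is_mark x); last exact: ccw_neq (edge_ccw nx).
case: x mx => // p _; rewrite edge_mark_next => e.
by have := strip_nextP (edge_end (inr p : node)); rewrite e strip_lt_irr.
Qed.

Lemma phi_gm x : phi (gm x) = (1, 0) - phi x.
Proof.
have [k [h1 h2]] := edge_gm x; rewrite /phi h1 h2 side_wt_deck.
exact/side_wt_opp/edge_neq.
Qed.

Definition sgi x : node := pos0_node x.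
Lemma sgiK x : sg (sgi x) = x.
Proof. by case: x => [[t i]|p] /=; rewrite /sg /= ?ord_predK ?mark_nextK. Qed.
Lemma sgK x : sgi (sg x) = x.
Proof. by apply: sg_inj; rewrite sgiK. Qed.

(** The increment of [phi] as the side turns around the pivot of [x]: [gm (sgi x)] precedes [x] in
    the fan. The term (1, 0) at the boundary arrow makes a full turn have degree (1, 0). *)
Definition wt x : int * int := phi x - phi (gm (sgi x)) + ((is_mark x)%:R, 0).

Lemma wt_sg x : wt (sg x) = phi (sg x) + phi x - (1, 0) + ((is_mark x)%:R, 0).
Proof. by rewrite /wt sgK is_mark_sg phi_gm opprB addrA. Qed.

Lemma wt_nxt x : wt (nxt x) = phi (nxt x) - phi x + ((is_mark (nxt x))%:R, 0).
Proof. by rewrite nxtE /wt sgK gmK. Qed.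

(** Of the three sides of an anticlockwise triangle exactly two are increasing for [strip_lt], and
    the height differences cancel. *)
Lemma phi_triangle x : ~~ is_mark x -> phi x + phi (sg x) + phi (sg (sg x)) = (2%:R, 0).
Proof.
move=> nx; have := edge_ccw nx; rewrite /phi edge_piv_sg // edge_end_sg //.
rewrite edge_piv_sg ?is_mark_sg //.
move: (edge_piv x) (edge_end x) (edge_end (sg x)) => p q r c.
rewrite /side_wt; congr pair => /=; last by ring.
by move: c; rewrite /ccw; case: p q r => i [] j [] k /=; lia.
Qed.

Definition shift_wt p : int := if p is inl _ then m%:Z else - n%:Z.

Lemma phi_mark p : phi (inr p : node) = (0, - shift_wt p).
Proof.
rewrite /phi edge_mark_next /side_wt.
have [k [_ ->]] := edge_mark n_gt0 m_gt0 T p; rewrite -[0](@GRing.mulr0n int 1).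
congr pair => /=; first by case: p => i /=; case: ltP => //; lia.
by case: p => i /=; rewrite /shift_wt; ring.
Qed.

Lemma shift_wt_next p : shift_wt (mark_next p) = shift_wt p.
Proof. by case: p. Qed.

Lemma wt_mark p : wt (inr p) = (0, - (shift_wt p *+ 2)).
Proof.
rewrite /wt /sgi /= phi_gm !phi_mark shift_wt_next; by congr pair => /=; rewrite ?mulr2n; lia.
Qed.

Lemma phi_lst p : phi (lst T p) = (1, shift_wt p).
Proof.
rewrite -[lst T p]gmK phi_gm gm_lst // phi_mark shift_wt_next.
by congr pair => /=; rewrite ?subr0 // sub0r opprK.
Qed.

Lemma wt_run x k : \sum_(i < k) wt (iter i.+1 (@nxt n m T) x) =
  phi (iter k (@nxt n m T) x) - phi x
    + (\sum_(i < k) (is_mark (iter i.+1 (@nxt n m T) x))%:R, 0).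
Proof.
elim: k => [|k IH].
  by rewrite !big_ord0 /= subrr add0r.
rewrite !big_ord_recr IH /= wt_nxt.
move: (phi (iter k _ x)) (phi x) (phi (nxt _)) => [u1 u2] [v1 v2] [w1 w2].
by move: (\sum_(i < k) _) => s; congr pair => /=; ring.
Qed.

(** Completed by the arrow [x], both sides are cycles of degree (1, 0). Around the triangle twice
    the sum (2, 0) of the [phi] is diminished by (1, 0) for each of the three arrows; around the fan
    the increments cancel and the boundary arrow counts once. *)
Lemma wt_dimer x : ~~ is_mark x ->
  wt (sg x) + wt (sg (sg x)) =
  \sum_(i < (fan_size T (pm x)).-1) wt (iter i.+1 (@nxt n m T) x).
Proof.
move=> nx; rewrite wt_run.
have pos0 : (0 < fan_pos n_gt0 m_gt0 x)%N.
  rewrite lt0n; apply: contra nx => /eqP e.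
  by have := fan_posP n_gt0 m_gt0 x; rewrite e /= => <-.
have lt := fan_pos_lt n_gt0 m_gt0 x; have eP := fan_posP n_gt0 m_gt0 x.
move: lt pos0 eP; set o := fan_size _ _; set j := fan_pos _ _ _ => lt pos0 eP.
have -> : \sum_(i < o.-1) (is_mark (iter i.+1 (@nxt n m T) x))%:R = 1 :> int.
  have lt0 : (o.-1 - j < o.-1)%N by lia.
  rewrite (bigD1 (Ordinal lt0)) //= big1 => [|i ne].
    rewrite -iterS -[X in iter _ _ X]eP -iterD.
    by rewrite (_ : (o.-1 - j).+1 + j = o)%N ?fan_size_iter ?addr0 //; lia.
  have {}ne : (i.+1 + j != o)%N.
    by apply: contra ne => /eqP e; apply/eqP/val_inj => /=; lia.
  apply/eqP; rewrite pnatr_eq0 eqb0 -iterS -[X in iter _ _ X]eP -iterD.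
  have li := ltn_ord i; have [le|gt] := ltnP (i.+1 + j) o.
    by apply: (fan_iter_mark n_gt0 m_gt0); rewrite -/o; lia.
  rewrite (_ : (i.+1 + j = (i.+1 + j - o) + o)%N); last by lia.
  rewrite iterD fan_size_iter; apply: (fan_iter_mark n_gt0 m_gt0).
  by rewrite -/o; lia.
have -> : iter o.-1 (@nxt n m T) x = gm (sg (sg x)).
  apply: nxt_inj; rewrite -iterS prednK; last by lia.
  by rewrite nxtE gmK sg3 // -{1}eP -iterD addnC iterD fan_size_iter eP.
have := phi_triangle nx; rewrite !wt_sg phi_gm !is_mark_sg (negPf nx).
move: (phi x) (phi (sg x)) (phi (sg (sg x))) => [u1 u2] [v1 v2] [w1 w2] /= [].
by move=> e1 e2; congr pair => /=; lia.
Qed.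
End Weights.

(** * Orbits of darts along which the position is constant *)

Section Orbits.
Variables (S : finType) (f : S * 'I_4 -> S * 'I_4) (g : S -> S) (i : 'I_4).
Hypothesis fg : forall x, f (x, i) = (g x, i).

Lemma iter_fst x k : iter k f (x, i) = (iter k g x, i).
Proof. by elim: k => //= k ->. Qed.

Lemma orbit_fst x : map fst (fingraph.orbit f (x, i)) = fingraph.orbit g x.
Proof.
have e : fingraph.order f (x, i) = fingraph.order g x.
  rewrite /fingraph.order -(card_imset (fconnect g x) (f := fun y => (y, i)));
    last by move=> y z [].
  apply: eq_card => d; apply/idP/imsetP => [/iter_findex <-|[y /iter_findex <- ->]].
    by rewrite iter_fst; eexists; last by []; exact: fconnect_iter.
  by rewrite -iter_fst; exact: fconnect_iter.
rewrite /fingraph.orbit e; move: (fingraph.order g x) {e} => k.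
elim: k x => //= k IH x.
by rewrite fg IH.
Qed.
End Orbits.

Lemma behead_traject (S : Type) (f : S -> S) x k :
  behead (traject f x k) = traject f (f x) k.-1.
Proof. by case: k. Qed.

Lemma is_qpath_cons (Q : quiver) (v : vertex Q) a w :
  is_qpath v (a :: w) = (qsrc a == v) && is_qpath (qtgt a) w.
Proof. by []. Qed.
Lemma qend_cons (Q : quiver) (v : vertex Q) a w : qend v (a :: w) = qend (qtgt a) w.
Proof. by []. Qed.

(** * The quiver and the dimer relations of the diagram of a triangulation *)

Section Dimer.
Variables (n m : nat) (n_gt0 : (0 < n)%N) (m_gt0 : (0 < m)%N).
Variable T : annulus_triangulation n m.
Local Notation node := ((triangle T * 'I_3) + mark n m)%type.
Local Notation D := (triangulation_diagram T).
Local Notation QD := (diagram_quiver D).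
Local Notation pm := (piv_mark n_gt0 m_gt0).
Local Notation fce := (@face D).
Local Notation fcb := (@face_back D).
Implicit Types (x y : node) (p q : mark n m).

Lemma face0 x : fce (x, pos0) = (sgi x, pos2).
Proof. by congr pair; apply: val_inj. Qed.
Lemma face2 x : fce (x, pos2) = (nxt x, pos0).
Proof. by congr pair; apply: val_inj. Qed.
Lemma face3 x : fce (x, pos3) = (sg x, pos3).
Proof. by congr pair; apply: val_inj. Qed.
Lemma face_back1 x : fcb (x, pos1) = (nxt x, pos1).
Proof. by []. Qed.

Lemma face_inj : injective fce.
Proof. exact: can_inj (@faceK D). Qed.

Lemma region_of_face d : region_of (D := D) (fce d) = region_of (D := D) d.
Proof.
apply/setP => d'; rewrite !inE; apply/esym/same_connect; last exact: fconnect1.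
exact/fconnect_sym/face_inj.
Qed.

Lemma arrow_src_sg x : @qsrc QD (sg x) = @qtgt QD x.
Proof.
apply: val_inj; change (region_of (D := D) (sg x, pos0) = region_of (D := D) (x, pos2)).
by rewrite -region_of_face face0 sgK.
Qed.

Lemma arrow_tgt_gm x : @qtgt QD (gm x) = @qtgt QD x.
Proof.
apply: val_inj; change (region_of (D := D) (gm x, pos2) = region_of (D := D) (x, pos2)).
by rewrite -[RHS]region_of_face face2 -[RHS]region_of_face face0 nxtE sgK.
Qed.

Lemma arrow_src_nxt x : @qsrc QD (nxt x) = @qtgt QD x.
Proof. by rewrite nxtE arrow_src_sg arrow_tgt_gm. Qed.

Lemma arrow_src_sgi x : @qsrc QD x = @qtgt QD (sgi x).
Proof. by rewrite -{1}(sgiK x) arrow_src_sg. Qed.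

(** The only corners of the alternating region are the heads of [x] and [gm x] and the tails of
    [nxt x] and [sg x]; [P] lists them in the order of [face]. *)
Lemma arrow_tgt_eq x y : (@qtgt QD x == @qtgt QD y) = (y == x) || (y == gm x).
Proof.
apply/eqP/orP => [e|[/eqP ->|/eqP ->]] //; last by rewrite arrow_tgt_gm.
have {e} : region_of (D := D) (x, pos2) = region_of (D := D) (y, pos2).
  exact: (congr1 (@alternating_val D) e).
move=> e; have := mem_region_of (D := D) (y, pos2); rewrite -e => h.
pose P (d : dart (triangle T * 'I_3)%type (mark n m)) :=
  [|| d == (x, pos2), d == (nxt x, pos0), d == (gm x, pos2) | d == (sg x, pos0)].
have : P (y, pos2).
  apply: (region_of_closed (D := D) (d := (x, pos2))) h; first by rewrite /P eqxx.
  move=> d /or4P[] /eqP ->; rewrite ?face2 ?face0 /P ?sgK.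
  - by rewrite eqxx orbT.
  - by rewrite nxtE sgK eqxx !orbT.
  - by rewrite nxtE gmK eqxx !orbT.
  - by rewrite eqxx.
by rewrite /P !xpair_eqE !eqxx !andbT !andbF /= orbF => /orP[]; [left|right].
Qed.

Lemma boundary_vertexP (v : vertex QD) :
  reflect (exists p, v = @qtgt QD (inr p)) (boundary_vertex v).
Proof.
apply: (iffP existsP) => [[d /andP[dv bd]]|[p ->]].
  case: v dv => V hV /=; case: d bd => [[c|p] i] // /eqP /= -> dv.
  exists (mark_next p); apply: val_inj => /=.
  have /andP[/andP[/existsP[d0 /eqP eV] _] _] := hV.
  rewrite eV inE in dv.
  transitivity (region_of (D := D) (inr p, pos0)).
    apply/setP => d'; rewrite eV !inE.
    exact: (same_connect (fconnect_sym face_inj) dv).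
  by rewrite -[LHS]region_of_face face0.
exists (inr (mark_prev p), pos0); rewrite andbT.
change ((inr (mark_prev p), pos0) \in region_of (D := D) (inr p, pos2)).
have -> : (inr p : node) = sgi (inr (mark_prev p)) by rewrite /sgi /= mark_prevK.
by rewrite -face0 region_of_face mem_region_of.
Qed.

Lemma order_sg x : ~~ is_mark x -> fingraph.order (@sg n m T) x = 3.
Proof.
move=> nx; have h : fcycle (@sg n m T) [:: x; sg x; sg (sg x)].
  by rewrite /= !eqxx sg3 ?eqxx.
apply: (order_cycle h); last by rewrite inE eqxx.
case: x nx {h} => [[t i]|//] _; rewrite /sg /= !inE.
rewrite !(inj_eq (@inl_inj _ _)) !xpair_eqE !eqxx.
by case: i => [[|[|[|//]]] hi].
Qed.

Lemma arrows_after_face x : ~~ is_mark x ->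
  arrows_after (D := D) fce (x, pos3) = [:: sg x; sg (sg x)].
Proof.
move=> nx; rewrite /arrows_after -behead_map.
have -> : [seq d'.1 | d' <- fingraph.orbit fce (x, pos3)] = fingraph.orbit (@sg n m T) x.
  exact: (orbit_fst face3).
by rewrite /fingraph.orbit order_sg.
Qed.

Lemma arrows_after_face_back x :
  arrows_after (D := D) fcb (x, pos1) =
  traject (@nxt n m T) (nxt x) (fingraph.order (@nxt n m T) x).-1.
Proof.
rewrite /arrows_after -behead_map.
have -> : [seq d'.1 | d' <- fingraph.orbit fcb (x, pos1)] = fingraph.orbit (@nxt n m T) x.
  exact: (orbit_fst face_back1).
by rewrite /fingraph.orbit behead_traject.
Qed.

(** A relator may use any dart at its crossing that lies in an anticlockwise region. Only one
    position qualifies, so that together with [clockwise_pos1] there is a single relator for each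
    crossing. *)
Lemma anticlockwise_pos3 (c : triangle T * 'I_3)
    (dp : dart (triangle T * 'I_3)%type (mark n m)) : dp.1 = inl c ->
  anticlockwise_region (D := D) (region_of (D := D) dp) -> dp = (inl c, pos3).
Proof.
case: dp => [x i] /= -> /andP[_ /forall_inP H].
have H0 := H _ (mem_region_of (D := D) _).
have H1 d : d \in region_of (D := D) (inl c, i) -> on_strand d -> strand_out d.
  by move=> /H /implyP.
have Hf d : d \in region_of (D := D) (inl c, i) -> fce d \in region_of (D := D) (inl c, i).
  by rewrite !inE => h; apply: connect_trans h (fconnect1 _ _).
have h0 := mem_region_of (D := D) (inl c, i).
case: i H {H0} H1 Hf h0 => [[|[|[|[|//]]]] li] H H1 Hf h0.
- by have := H1 _ h0 isT.
- by have := H1 _ h0 isT.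
- have e2 : ((inl c, Ordinal li) : dart (triangle T * 'I_3)%type (mark n m)) = (inl c, pos2).
    by congr pair; apply: val_inj.
  have h1 := Hf _ h0; have := h1; rewrite [in X in fce X]e2 face2 => h1'.
  case en: (nxt (inl c : node)) h1' => [c'|p] h1'; first by have := H1 _ h1' isT.
  (* At a marked point [pos0] belongs to a boundary interval and carries no strand. Two steps
     further along the region there is a crossing again, because a boundary interval is glued to a
     triangle. *)
  have h2 := Hf _ (Hf _ h1'); rewrite face0 face2 in h2.
  have : ~~ is_mark (nxt (sgi (inr p) : node)) by rewrite nxtE is_mark_sg gm_mark.
  by case: (nxt _) h2 => // c' /H1 /(_ isT).
- by congr pair; apply: val_inj.
Qed.

Lemma clockwise_pos1 (c : triangle T * 'I_3)
    (dm : dart (triangle T * 'I_3)%type (mark n m)) : dm.1 = inl c ->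
  clockwise_region (D := D) (region_of (D := D) dm) -> dm = (inl c, pos1).
Proof.
case: dm => [x i] /= -> /andP[_ /forall_inP H].
have H1 d : d \in region_of (D := D) (inl c, i) -> on_strand d -> strand_in d.
  by move=> /H /implyP.
have Hf d : d \in region_of (D := D) (inl c, i) -> fce d \in region_of (D := D) (inl c, i).
  by rewrite !inE => h; apply: connect_trans h (fconnect1 _ _).
have h0 := mem_region_of (D := D) (inl c, i).
case: i H H1 Hf h0 => [[|[|[|[|//]]]] li] H H1 Hf h0.
- have e2 : ((inl c, Ordinal li) : dart (triangle T * 'I_3)%type (mark n m)) = (inl c, pos0).
    by congr pair; apply: val_inj.
  have h1 := Hf _ h0; have := h1; rewrite [in X in fce X]e2 face0.
  by case: c {H h0 h1 e2} H1 Hf => t j H1 Hf /H1 /(_ isT).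
- by congr pair; apply: val_inj.
- by have := H1 _ h0 isT.
- by have := H1 _ h0 isT.
Qed.

Variable K : fieldType.
Local Notation rel := (@dimer_relator D K).
Local Notation A := (dimer_algebra D K).
Local Notation aD := (acl rel : node -> A).
Definition eD x : A := vcl rel (@qtgt QD x).

Lemma dimer_relP f : rel f -> exists x, ~~ is_mark x /\
  f = word K (@qtgt QD x) [:: sg x : arrow QD; sg (sg x)] -
      word K (@qtgt QD x) (traject (@nxt n m T) (nxt x) (fingraph.order (@nxt n m T) x).-1).
Proof.
case=> c dp dm ep hp em hm v; exists (inl c); split=> //.
rewrite (anticlockwise_pos3 ep hp) (clockwise_pos1 em hm).
by rewrite arrows_after_face // arrows_after_face_back.
Qed.

Lemma dimer_rel x : ~~ is_mark x ->
  rel (word K (@qtgt QD x) [:: sg x : arrow QD; sg (sg x)] -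
      word K (@qtgt QD x) (traject (@nxt n m T) (nxt x) (fingraph.order (@nxt n m T) x).-1)).
Proof.
case: x => [c _|p h]; last by rewrite /= in h.
have := @DimerRelator D K c (inl c, pos3) (inl c, pos1) erefl
  (@crossing_anticlockwise D c) erefl (@crossing_clockwise D c).
have nc : ~~ is_mark (inl c : node) by [].
rewrite (arrows_after_face nc).
rewrite (arrows_after_face_back (inl c)).
exact.
Qed.

Lemma eD_M x y : eD x * eD y = if (y == x) || (y == gm x) then eD x else 0.
Proof. by rewrite /eD vclM arrow_tgt_eq. Qed.
Lemma eD_gm x : eD (gm x) = eD x. Proof. by rewrite /eD arrow_tgt_gm. Qed.
Lemma eD_aD x : eD x * aD x = aD x. Proof. exact: acl_tgt. Qed.
Lemma aD_eD x : aD (sg x) * eD x = aD (sg x).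
Proof. by rewrite /eD -arrow_src_sg acl_src. Qed.

Lemma runE x k : run eD aD x k = pcl rel (@qtgt QD x) (traject (@nxt n m T) (nxt x) k).
Proof.
elim: k => [|k IH]; first by rewrite pcl_nil.
by rewrite trajectSr pcl_rcons -IH /= -iterSr.
Qed.

Lemma dimerD x : ~~ is_mark x ->
  aD (sg (sg x)) * aD (sg x) = run eD aD x (fingraph.order (@nxt n m T) x).-1.
Proof.
move=> nx; have := class_rel (dimer_rel nx); rewrite classB -!pclE runE => /eqP.
rewrite subr_eq0 => /eqP <-.
by rewrite (pcl_rcons rel _ [:: sg x : arrow QD]) pcl_cons ?arrow_src_sg // pcl_nil acl_tgt.
Qed.

Definition wts (s : seq node) : int * int := \sum_(x <- s) wt x.

Lemma is_qpath_traject x k :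
  is_qpath (@qtgt QD x) (traject (@nxt n m T) (nxt x) k) /\
  qend (@qtgt QD x) (traject (@nxt n m T) (nxt x) k) = @qtgt QD (iter k (@nxt n m T) x).
Proof.
elim: k x => [|k IH] x; first by [].
rewrite trajectS (is_qpath_cons (Q := QD)) (qend_cons (Q := QD)) arrow_src_nxt eqxx.
by have [h1 h2] := IH (nxt x); split; rewrite // h2 iterSr.
Qed.

Lemma wts_traject x k :
  wts (traject (@nxt n m T) (nxt x) k) = \sum_(i < k) wt (iter i.+1 (@nxt n m T) x).
Proof.
elim: k => [|k IH]; first by rewrite /wts big_nil big_ord0.
by rewrite trajectSr /wts big_rcons -/(wts _) IH big_ord_recr /= -iterSr.
Qed.

Lemma qend_dimer x : ~~ is_mark x ->
  qend (@qtgt QD x) [:: sg x : arrow QD; sg (sg x)] = qend (@qtgt QD x)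
    (traject (@nxt n m T) (nxt x) (fingraph.order (@nxt n m T) x).-1).
Proof.
move=> nx; have [_ ->] := is_qpath_traject x (fingraph.order (@nxt n m T) x).-1.
suff -> : iter (fingraph.order (@nxt n m T) x).-1 (@nxt n m T) x = gm (sg (sg x)).
  by rewrite arrow_tgt_gm.
apply: (@nxt_inj n m T); rewrite -iterS prednK ?order_gt0 //.
by rewrite iter_order ?nxt_gm ?sg3 //; exact: nxt_inj.
Qed.

Section GradedLift.
Variables (V : lmodType K) (F : vertex QD -> vertex QD -> int * int -> V).
Let Phi v (s : seq (arrow QD)) := F v (qend v s) (wts s).

Lemma graded_lift_relP f : rel f -> exists v w1 w2,
  [/\ f = word K v w1 - word K v w2, is_qpath v w1, is_qpath v w2,
      qend v w1 = qend v w2 &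
      forall u (a b : seq (arrow QD)), is_qpath u a -> qend u a = v ->
        is_qpath (qend v w1) b -> Phi u (a ++ w1 ++ b) = Phi u (a ++ w2 ++ b)].
Proof.
move=> /dimer_relP[x [nx ->]]; do 3!eexists; split; first by reflexivity.
- by rewrite !(is_qpath_cons (Q := QD)) !arrow_src_sg !eqxx.
- by have [] := is_qpath_traject x (fingraph.order (@nxt n m T) x).-1.
- exact: qend_dimer.
move=> u a b _ ua _; rewrite /Phi !qend_cat ua (qend_dimer nx).
congr F; rewrite /wts !big_cat -!/(wts _) wts_traject order_fan // -wt_dimer //.
by rewrite /wts !big_cons big_nil addr0.
Qed.

(** Well defined for an arbitrary function [F] of ends and degree, since the two sides of a dimer
    relation agree in both, also inside a longer path. *)
Definition graded_lift : A -> V := class_lift Phi.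
Lemma graded_liftD (t u : A) : graded_lift (t + u) = graded_lift t + graded_lift u.
Proof. exact/class_liftD/graded_lift_relP. Qed.
Lemma graded_liftZ c (t : A) : graded_lift (c *: t) = c *: graded_lift t.
Proof. exact/class_liftZ/graded_lift_relP. Qed.
Lemma graded_lift_pcl v w : is_qpath v w ->
  graded_lift (pcl rel v w) = F v (qend v w) (wts w).
Proof. exact: (class_lift_pcl graded_lift_relP). Qed.
End GradedLift.

Definition pathlike (t : A) (i j : vertex QD) (w : int * int) :=
  exists s, [/\ is_qpath i s, qend i s = j, wts s = w & t = pcl rel i s].

(** The indicator function of one triple of ends and degree extends linearly to the dimer algebra
    and takes the value 1 on [t]. *)
Lemma pathlike_unique t i j w i' j' w' :
  pathlike t i j w -> pathlike t i' j' w' -> [/\ i = i', j = j' & w = w'].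
Proof.
move=> [s [h1 <- <- e1]] [s' [h1' <- <- e1']].
pose F (a b : vertex QD) (u : int * int) : K^o :=
  ((a, b, u) == (i, qend i s, wts s))%:R.
have : F i' (qend i' s') (wts s') = F i (qend i s) (wts s).
  by rewrite -!graded_lift_pcl // -e1 -e1'.
rewrite /F eqxx; case: eqP => [[-> -> ->] //|_ /eqP].
by rewrite eq_sym (oner_eq0 K).
Qed.

Lemma pathlikeM t t' i j k w w' :
  pathlike t j k w -> pathlike t' i j w' -> pathlike (t * t') i k (w + w').
Proof.
move=> [s [h1 e1 <- ->]] [s' [h1' e1' <- ->]]; exists (s' ++ s); split.
- by rewrite is_qpath_cat h1' e1' h1.
- by rewrite qend_cat e1'.
- by rewrite /wts big_cat addrC.
- by rewrite pcl_cat e1'.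
Qed.

Lemma pathlike_eD x : pathlike (eD x) (@qtgt QD x) (@qtgt QD x) 0.
Proof. by exists [::]; rewrite pcl_nil /wts big_nil. Qed.

Lemma pathlike_neq0 t i j w : pathlike t i j w -> t <> 0.
Proof.
move=> [s [h1 _ _ ->]] e; pose F (a b : vertex QD) (u : int * int) : K^o := 1.
have := graded_lift_pcl F h1; rewrite e.
have -> : graded_lift F 0 = 0 by rewrite -(scale0r (0 : A)) graded_liftZ scale0r.
by move/esym/eqP; rewrite (oner_eq0 K).
Qed.

Lemma pathlike_tgt t i j w : pathlike t i j w -> vcl rel j * t = t.
Proof. by move=> [s [_ <- _ ->]]; rewrite vcl_pcl. Qed.

Lemma pathlike_run x k : pathlike (run eD aD x k) (@qtgt QD x)
  (@qtgt QD (iter k (@nxt n m T) x)) (\sum_(i < k) wt (iter i.+1 (@nxt n m T) x)).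
Proof.
have [h1 h2] := is_qpath_traject x k.
by exists (traject (@nxt n m T) (nxt x) k); rewrite runE wts_traject.
Qed.

Local Notation hed := (hed n_gt0 m_gt0 eD aD).
Local Notation tl := (tl n_gt0 m_gt0 eD aD).
Local Notation zz := (zz n_gt0 m_gt0 eD aD).
Local Notation yy := (yy n_gt0 m_gt0 eD aD).
Definition bv p : vertex QD := @qtgt QD (inr p).

Lemma bv_inj : injective bv.
Proof.
move=> p q /eqP; rewrite /bv arrow_tgt_eq => /orP[/eqP[] //|/eqP e].
by have := gm_mark T p; rewrite -e.
Qed.

Lemma run_marks x k : (forall i, (i < k)%N -> ~~ is_mark (iter i.+1 (@nxt n m T) x)) ->
  \sum_(i < k) wt (iter i.+1 (@nxt n m T) x) = phi (iter k (@nxt n m T) x) - phi x.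
Proof.
move=> H; rewrite wt_run big1 ?addr0 // => i _.
by rewrite (negPf (H i (ltn_ord i))).
Qed.

Lemma pathlike_hed x : pathlike (hed x) (bv (pm x)) (@qtgt QD x)
  (phi x + (0, shift_wt (pm x))).
Proof.
have := pathlike_run (inr (pm x)) (fan_pos n_gt0 m_gt0 x).
rewrite run_marks => [|i hi]; last first.
  by apply: fan_iter_mark; have := fan_pos_lt n_gt0 m_gt0 x; lia.
rewrite (fan_posP n_gt0 m_gt0 x) (phi_mark n_gt0 m_gt0).
suff -> : - (0, - shift_wt (pm x)) = (0, shift_wt (pm x)) :> (int * int)%type by [].
by congr pair => /=; rewrite ?oppr0 ?opprK.
Qed.

Lemma pathlike_tl x : pathlike (tl x) (@qtgt QD x) (bv (mark_next (pm x)))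
  ((1, shift_wt (pm x)) - phi x).
Proof.
have := pathlike_run x ((fan_size T (pm x)).-1 - fan_pos n_gt0 m_gt0 x).
rewrite run_marks => [|i hi].
  by rewrite (tl_end n_gt0 m_gt0) phi_lst // -[@qtgt QD (lst T _)]arrow_tgt_gm gm_lst.
rewrite -[X in iter _ _ X](fan_posP n_gt0 m_gt0 x) -iterD.
by apply: (fan_iter_mark n_gt0 m_gt0); lia.
Qed.

Lemma pathlike_zz x : pathlike (zz x) (bv (pm x)) (bv (mark_next (pm (gm x))))
  (phi x + phi x + (0, shift_wt (pm x) + shift_wt (pm (gm x)))).
Proof.
rewrite zzE; have h1 := pathlike_tl (gm x); have h2 := pathlike_hed x.
rewrite arrow_tgt_gm in h1.
have -> : phi x + phi x + (0, shift_wt (pm x) + shift_wt (pm (gm x))) =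
    ((1, shift_wt (pm (gm x))) - phi (gm x)) + (phi x + (0, shift_wt (pm x))).
  by rewrite (phi_gm n_gt0 m_gt0); case: (phi x) => u1 u2; congr pair => /=; lia.
exact: pathlikeM h1 h2.
Qed.

Lemma pathlike_yy p : pathlike (yy p) (bv p) (bv (mark_next p)) (1, shift_wt p *+ 2).
Proof.
have := pathlike_tl (inr p); rewrite piv_mark_inr (phi_mark n_gt0 m_gt0).
suff -> : (1, shift_wt p) - (0, - shift_wt p) = (1, shift_wt p *+ 2) :> (int * int)%type by [].
by congr pair => /=; rewrite ?subr0 // opprK mulr2n.
Qed.

Lemma pathlike_ax p : pathlike (ax aD p) (bv (mark_next p)) (bv p) (0, - (shift_wt p *+ 2)).
Proof.
exists [:: inr p]; split.
- by rewrite (is_qpath_cons (Q := QD)) arrow_src_sgi eqxx.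
- by [].
- by rewrite /wts big_seq1 (wt_mark n_gt0 m_gt0).
by rewrite /ax -(pcl_seq1 rel) arrow_src_sgi.
Qed.
End Dimer.

(** * Normal forms *)

Section Thin.
(** The setting is abstract because it serves for Lambda and, in part, for the dimer algebra.
    [t true] and [t false] stand for r and s or their images, [sh] for the effect of x on vertices
    and [shi] for that of y; [N o] is the number of marked points of the component [o]. *)
Variables (L : pzRingType) (V : eqType).
Variables (e : V -> L) (X Y : L) (t : bool -> L).
Variables (side : V -> bool) (sh shi : V -> V) (N : bool -> nat) (vs vt : bool -> V).

Hypothesis N_gt0 : forall o, (0 < N o)%N.
Hypothesis eM : forall u v, e u * e v = if u == v then e u else 0.
Hypothesis X_e : forall v, X * e v = e (sh v) * X.
Hypothesis t_src : forall o, t o * e (vs o) = t o.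
Hypothesis shiK : cancel shi sh.
Hypothesis side_sh : forall v, side (sh v) = side v.
Hypothesis side_vs : forall o, side (vs o) = o.
Hypothesis side_vt : forall o, side (vt o) = ~~ o.
Hypothesis sh_vt : forall o, sh (vt o) = vs (~~ o).
Hypothesis sh_mod : forall v k l, iter k sh v = iter l sh v -> k = l %[mod N (side v)].
Hypothesis XYC : X * Y = Y * X.
Hypothesis t_XY : forall o, t o * (X * Y) = X * Y * t o.
Hypothesis t_shift : forall o, t o = X ^+ N (~~ o) * t o * X ^+ N o.
Hypothesis YY : forall v i, (i < N (side v))%N -> iter i sh v = vs (side v) ->
  Y * Y * e v = X ^+ (N (side v) - 1 - i) * t (~~ side v) * X ^+ (N (~~ side v)).+1
                * t (side v) * X ^+ i * e v.
Hypothesis YY_index : forall v, exists2 i, (i < N (side v))%N & iter i sh v = vs (side v).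

Local Notation U := (X * Y).

Lemma e_idem v : e v * e v = e v. Proof. by rewrite eM eqxx. Qed.

Lemma side_iter k v : side (iter k sh v) = side v.
Proof. by elim: k => //= k IH; rewrite side_sh. Qed.

Lemma X_exp_e k v : X ^+ k * e v = e (iter k sh v) * X ^+ k.
Proof.
elim: k => [|k IH]; first by rewrite mul1r mulr1.
by rewrite exprS -mulrA IH mulrA X_e mulrA.
Qed.

Lemma U_X : GRing.comm U X.
Proof. by rewrite /GRing.comm -mulrA -XYC mulrA. Qed.
Lemma U_Y : GRing.comm U Y.
Proof. by rewrite /GRing.comm {1}XYC -mulrA. Qed.
Lemma U_t o : GRing.comm U (t o).
Proof. by rewrite /GRing.comm t_XY. Qed.
Lemma Uk_X k : GRing.comm (U ^+ k) X.
Proof. exact/commr_sym/commrX/commr_sym/U_X. Qed.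
Lemma Uk_Xl k l : GRing.comm (U ^+ k) (X ^+ l).
Proof. exact/commrX/Uk_X. Qed.
Lemma Uk_Y k : GRing.comm (U ^+ k) Y.
Proof. exact/commr_sym/commrX/commr_sym/U_Y. Qed.
Lemma Uk_t k o : GRing.comm (U ^+ k) (t o).
Proof. exact/commr_sym/commrX/commr_sym/U_t. Qed.

Lemma t_Y o : t o * Y = U * (X ^+ N (~~ o) * t o * X ^+ (N o).-1).
Proof.
rewrite {1}t_shift; case: (N o) (N_gt0 o) => [//|p] _ /=.
rewrite exprSr mulrA -(mulrA _ X Y); apply/esym/commrM/commrX/U_X.
by apply: commrM (U_t o); apply/commrX/U_X.
Qed.

Lemma t_shiftn p o : t o = X ^+ (p * N (~~ o)) * t o * X ^+ (p * N o).
Proof.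
elim: p => [|p IH]; first by rewrite !mul0n mul1r mulr1.
by rewrite {1}t_shift {1}IH !mulSn (addnC (N o)) !exprD !mulrA.
Qed.

Lemma raise1 o a c p :
  X ^+ a * t o * X ^+ c = X ^+ (a + p * N (~~ o)) * t o * X ^+ (c + p * N o).
Proof. by rewrite {1}(t_shiftn p o) exprD (addnC c) exprD !mulrA. Qed.

Lemma raise2 o a b c p q :
  X ^+ a * t (~~ o) * X ^+ b * t o * X ^+ c =
  X ^+ (a + p * N o) * t (~~ o) * X ^+ (b + (p + q) * N (~~ o)) * t o * X ^+ (c + q * N o).
Proof.
rewrite (raise1 (~~ o) a b p) negbK -!mulrA; congr (_ * (_ * _)).
rewrite mulrA (raise1 o _ c q) -mulrA; congr (X ^+ _ * _).
by rewrite mulnDl addnA.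
Qed.

Lemma int_nat_diff (z : int) : exists p q : nat, z = p%:Z - q%:Z.
Proof. by case: z => k; [exists k, 0%N|exists 0%N, k.+1]; lia. Qed.

Lemma modn_diff (a b d : nat) : a = b %[mod d] -> exists z : int, b%:Z - a%:Z = z * d%:Z.
Proof.
move=> h; exists ((b %/ d)%:Z - (a %/ d)%:Z).
by rewrite {1}(divn_eq b d) {1}(divn_eq a d) h; lia.
Qed.

(** The second hypothesis expresses equality of degrees. By the congruence, shift relations raise
    both words to a common right exponent, and then the degree forces equal left exponents. *)
Lemma eq_bridge1 o a c a' c' : c = c' %[mod N o] ->
  (N o * a + N (~~ o) * c' = N o * a' + N (~~ o) * c)%N ->
  X ^+ a * t o * X ^+ c = X ^+ a' * t o * X ^+ c'.
Proof.
move=> /modn_diff[z ez] ea; have [p [q ezpq]] := int_nat_diff z.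
have N0 := N_gt0 o.
rewrite (raise1 o a c p) (raise1 o a' c' q).
have ec : (c + p * N o = c' + q * N o)%N by nia.
rewrite ec; congr (X ^+ _ * _ * _); apply/eqP; rewrite -(eqn_pmul2l N0); apply/eqP.
nia.
Qed.

Lemma eq_bridge2 o a b c a' b' c' : c = c' %[mod N o] -> b = b' %[mod N (~~ o)] ->
  (N o * b + N (~~ o) * (a' + c') = N o * b' + N (~~ o) * (a + c))%N ->
  X ^+ a * t (~~ o) * X ^+ b * t o * X ^+ c = X ^+ a' * t (~~ o) * X ^+ b' * t o * X ^+ c'.
Proof.
move=> /modn_diff[z ez] /modn_diff[w ew] ea.
have [q [q' ezq]] := int_nat_diff z; have [p [p' ezp]] := int_nat_diff (w - z).
have N0 := N_gt0 o; have N1 := N_gt0 (~~ o).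
rewrite (raise2 o a b c p q) (raise2 o a' b' c' p' q').
have ec : (c + q * N o = c' + q' * N o)%N by nia.
have eb : (b + (p + q) * N (~~ o) = b' + (p' + q') * N (~~ o))%N by nia.
rewrite ec eb; congr (X ^+ _ * _ * _ * _ * _).
apply/eqP; rewrite -(eqn_pmul2l N1); apply/eqP.
nia.
Qed.

(* Every path is a power of the central element U = X Y times one of the words
   X^a, Y, X^a t X^c and X^a t X^b t X^c. *)
Inductive nform := NX of nat & nat | NY of nat | N1 of nat & nat & nat
  | N2 of nat & nat & nat & nat.

Definition neval (o : bool) (f : nform) : L :=
  match f with
  | NX k a => U ^+ k * X ^+ a
  | NY k => U ^+ k * Y
  | N1 k a c => U ^+ k * (X ^+ a * t o * X ^+ c)
  | N2 k a b c => U ^+ k * (X ^+ a * t (~~ o) * X ^+ b * t o * X ^+ c)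
  end.

(* To be read as: a is the class of a path from v to j, of degree w. *)
Variable pl : L -> V -> V -> int * int -> Prop.
Variable om : bool -> int.
Hypothesis pl_unique : forall a v j w v' j' w',
  pl a v j w -> pl a v' j' w' -> [/\ v = v', j = j' & w = w'].
Hypothesis plM : forall a b i j k w w',
  pl a j k w -> pl b i j w' -> pl (a * b) i k (w + w').
Hypothesis pl0 : forall a v j w, pl a v j w -> a <> 0.
Hypothesis pl_tgt : forall a v j w, pl a v j w -> e j * a = a.
Hypothesis pl_e : forall v, pl (e v) v v 0.
Definition delta o : int := if o then (N false)%:Z else - (N true)%:Z.
Hypothesis pl_X : forall v, pl (X * e v) v (sh v) (0, - (delta (side v) + delta (side v))).
Hypothesis pl_Y : forall v, pl (Y * e v) v (shi v) (1, delta (side v) + delta (side v)).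
Hypothesis pl_t : forall o, pl (t o) (vs o) (vt o) ((if o then 2%:Z else 0), om o).

Inductive lpath (v : V) : V -> L -> Prop :=
| lpath_e : lpath v v (e v)
| lpath_X j a : lpath v j a -> lpath v (sh j) (X * a)
| lpath_Y j a : lpath v j a -> lpath v (shi j) (Y * a)
| lpath_t o a : lpath v (vs o) a -> lpath v (vt o) (t o * a).

Lemma plX a v j w : pl a v j w ->
  pl (X * a) v (sh j) ((0, - (delta (side j) + delta (side j))) + w).
Proof. by move=> h; rewrite -(pl_tgt h) mulrA; apply: plM (pl_X j) h. Qed.
Lemma plY a v j w : pl a v j w ->
  pl (Y * a) v (shi j) ((1, delta (side j) + delta (side j)) + w).
Proof. by move=> h; rewrite -(pl_tgt h) mulrA; apply: plM (pl_Y j) h. Qed.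

Lemma lpath_pl v j a : lpath v j a -> exists w, pl a v j w.
Proof.
elim=> [|{}j {}a _ [w h]|{}j {}a _ [w h]|o {}a _ [w h]].
- by eexists; apply: pl_e.
- by eexists; apply: plX h.
- by eexists; apply: plY h.
- by eexists; apply: plM (pl_t o) h.
Qed.

Lemma plXk k a v j w : pl a v j w ->
  pl (X ^+ k * a) v (iter k sh j) (w.1, w.2 - 2%:Z * delta (side j) * k%:Z).
Proof.
move=> h; elim: k => [|k IH].
  by rewrite mul1r mulr0 subr0; case: w h.
rewrite exprS -mulrA; have := plX IH; rewrite side_iter.
set u := _ + _; set u' := (_, _); suff -> : u = u' by [].
by rewrite /u /u'; apply: injective_projections => /=; rewrite ?add0r //; lia.
Qed.

Lemma plUk k a v j w : pl a v j w -> pl (U ^+ k * a) v j (w.1 + k%:Z, w.2).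
Proof.
move=> h; elim: k => [|k IH].
  by rewrite mul1r addr0; case: w h.
rewrite exprS -!mulrA; have := plX (plY IH); rewrite shiK.
have -> : side (shi j) = side j by rewrite -[in RHS](shiK j) side_sh.
set u := _ + _; set u' := (_, _); suff -> : u = u' by [].
by rewrite /u /u'; apply: injective_projections => /=; lia.
Qed.

Lemma plt o a v j w : pl a v j w -> t o * a <> 0 ->
  j = vs o /\ pl (t o * a) v (vt o) ((if o then 2%:Z else 0) + w.1, om o + w.2).
Proof.
move=> h ne; have ej : j = vs o.
  apply/eqP; apply: contra_notT ne => ne.
  by rewrite -(t_src o) -(pl_tgt h) mulrA -(mulrA (t o)) eM eq_sym (negPf ne) mulr0 mul0r.
by split=> //; rewrite ej in h; apply: plM (pl_t o) h.
Qed.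

Lemma mul_neq0r (a b : L) : a * b <> 0 -> b <> 0.
Proof. by move=> h e0; apply: h; rewrite e0 mulr0. Qed.

Lemma pl_NX k a v j w : pl (neval (side v) (NX k a) * e v) v j w ->
  w = (k%:Z, - (2%:Z * delta (side v) * a%:Z)).
Proof.
rewrite /= -mulrA => h; have [_ _ ->] := pl_unique h (plUk k (plXk a (pl_e v))).
by apply: injective_projections => /=; rewrite ?add0r ?sub0r.
Qed.

Lemma pl_NY k v j w : pl (neval (side v) (NY k) * e v) v j w ->
  w = (k%:Z + 1, 2%:Z * delta (side v)).
Proof.
rewrite /= -mulrA => h; have [_ _ ->] := pl_unique h (plUk k (pl_Y v)).
by apply: injective_projections => /=; lia.
Qed.

Lemma pl_N1 k a c v j w : pl (neval (side v) (N1 k a c) * e v) v j w ->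
  [/\ iter c sh v = vs (side v), side j = ~~ side v &
  w = (k%:Z + (if side v then 2%:Z else 0),
     om (side v) - 2%:Z * delta (side v) * c%:Z - 2%:Z * delta (~~ side v) * a%:Z)].
Proof.
rewrite /= -!mulrA => h; have h1 := plXk c (pl_e v).
have n1 := mul_neq0r (mul_neq0r (pl0 h)).
have [e1 h2] := plt h1 n1; have [_ -> ->] := pl_unique h (plUk k (plXk a h2)).
split=> //; first by rewrite side_iter side_vt.
by rewrite side_vt; apply: injective_projections => /=; lia.
Qed.

Lemma pl_N2 k a b c v j w : pl (neval (side v) (N2 k a b c) * e v) v j w ->
  [/\ iter c sh v = vs (side v), iter b sh (vt (side v)) = vs (~~ side v), side j = side v &
  w = (k%:Z + 2%:Z, om true + om false
     - 2%:Z * delta (side v) * (a + c)%:Z - 2%:Z * delta (~~ side v) * b%:Z)].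
Proof.
rewrite /= -!mulrA => h; have h1 := plXk c (pl_e v).
have n2 := mul_neq0r (mul_neq0r (pl0 h)).
have n1 := mul_neq0r (mul_neq0r n2).
have [e1 h2] := plt h1 n1; have [e2 h3] := plt (plXk b h2) n2.
have [_ -> ->] := pl_unique h (plUk k (plXk a h3)).
rewrite side_iter !side_vt negbK; split=> //.
by case: (side v); apply: injective_projections => /=; lia.
Qed.

Lemma side_vs_mod b o : iter b sh (vt o) = vs (~~ o) -> b = 1 %[mod N (~~ o)].
Proof. by move=> h; have := @sh_mod (vt o) b 1; rewrite side_vt /= sh_vt h; apply. Qed.

Lemma YY_N2 v : exists a b c, Y * Y * e v =
  X ^+ a * t (~~ side v) * X ^+ b * t (side v) * X ^+ c * e v.
Proof. by have [i lt ei] := YY_index v; rewrite (YY lt ei); do 3!eexists. Qed.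

(* A path crossing the annulus three times winds around enough to contain y^2. *)
Lemma cross3 o a b : b = 1 %[mod N (~~ o)] ->
  exists a' c', t o * X ^+ a * t (~~ o) * X ^+ b * t o =
    U ^+ 2 * (X ^+ a' * t o * X ^+ c') * e (vs o).
Proof.
move=> hb; have N0 := N_gt0 o; have N1' := N_gt0 (~~ o).
have [z ez] := modn_diff hb.
have [p ep] : exists p : nat, (b + p * N (~~ o) = (N (~~ o)).+1 + b * N (~~ o))%N.
  exists `|(1 + b%:Z + z)%R|%N; have : 0 <= 1 + b%:Z + z by nia.
  by nia.
have e1 := YY (v := vs o); rewrite side_vs in e1.
have {}e1 := e1 0%N N0 erefl; rewrite mulr1 subn0 in e1.
(* Of the [b + 2] shifts applied to the first [t o], [b] pay for changing the middle exponent from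
   [b] to [(N (~~ o)).+1], the one in [YY]. The other two leave room for the factor [X ^+ (N o - 1)]
   of [YY] and for the two X that turn [Y * Y] into [U ^+ 2]. *)
pose A' := (2 * N o + a + p * N o)%N.
pose C := (A' - N o - 1)%N.
have eA : A' = (C + 2 + (N o - 1))%N by rewrite /C /A'; lia.
exists ((b + 2) * N (~~ o))%N, C.
have [U2 eU] : exists U2, U ^+ 2 = U2 by exists (U ^+ 2).
rewrite eU; have U2X := Uk_Xl 2; have U2t := Uk_t 2; rewrite eU in U2X U2t.
rewrite {1}(t_shiftn (b + 2) o).
have : X ^+ ((b + 2) * N o + a) * t (~~ o) * X ^+ b * t o * X ^+ 0 =
    X ^+ A' * t (~~ o) * X ^+ (N (~~ o)).+1 * t o * X ^+ 0.
  rewrite (raise2 o ((b + 2) * N o + a) b 0 p 0) (raise2 o A' (N (~~ o)).+1 0 b 0).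
  rewrite !addn0 ep; congr (X ^+ _ * _ * _ * _ * _).
  by rewrite /A'; lia.
rewrite !mulr1 => E.
transitivity (X ^+ ((b + 2) * N (~~ o)) * t o *
    (X ^+ ((b + 2) * N o + a) * t (~~ o) * X ^+ b * t o)).
  by rewrite exprD !mulrA.
rewrite E eA !exprD -!mulrA.
have -> : X ^+ (N o - 1) * (t (~~ o) * (X ^+ (N (~~ o)).+1 * t o)) = Y * Y * e (vs o).
  by rewrite e1 -!mulrA t_src.
have -> : X * (X * (Y * Y * e (vs o))) = U2 * e (vs o).
  by rewrite -eU !expr2 !mulrA -(mulrA X X) XYC !mulrA -XYC.
rewrite !(mulrA (X ^+ C)) -U2X -!mulrA.
by rewrite (mulrA (t o)) -U2t -!mulrA mulrA -U2X -!mulrA.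
Qed.

Lemma pl_side f v j w : pl (neval (side v) f * e v) v j w ->
  side j = if f is N1 _ _ _ then ~~ side v else side v.
Proof.
case: f => [k a|k|k a c|k a b c] h.
- rewrite /= -mulrA in h; have [_ -> _] := pl_unique h (plUk k (plXk a (pl_e v))).
  exact: side_iter.
- rewrite /= -mulrA in h; have [_ -> _] := pl_unique h (plUk k (pl_Y v)).
  by rewrite -[in RHS](shiK v) side_sh.
- by have [] := pl_N1 h.
- by have [] := pl_N2 h.
Qed.

(** Each new letter is absorbed: a shift relation provides an X for a Y that meets a crossing,
    [Y * Y] is rewritten by [YY], and a third crossing is removed by [cross3]. The congruence
    required there holds because the word is nonzero, so that its factors have matching ends. *)
Lemma lpath_nf v j a : lpath v j a -> exists f, a = neval (side v) f * e v.
Proof.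
elim=> [|{}j {}a _ [f ->]|{}j {}a _ [f ->]|o {}a pa [f ef]].
- by exists (NX 0 0); rewrite /= !mul1r.
- case: f => [k a'|k|k a' c|k a' b c] /=.
  + by exists (NX k a'.+1); rewrite /= exprS !mulrA Uk_X.
  + by exists (NX k.+1 0); rewrite /= mulr1 exprSr !mulrA Uk_X.
  + by exists (N1 k a'.+1 c); rewrite /= exprS !mulrA Uk_X.
  + by exists (N2 k a'.+1 b c); rewrite /= exprS !mulrA Uk_X.
- case: f => [k [|a']|k|k a' c|k a' b c] /=.
  + by exists (NY k); rewrite /= mulr1 !mulrA Uk_Y.
  + exists (NX k.+1 a'); rewrite /= (exprSr U) (exprS X) !mulrA -Uk_Y -!mulrA.
    by rewrite (mulrA Y) -XYC -!mulrA.
  + have [a' [b [c e1]]] := YY_N2 v; exists (N2 k a' b c).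
    by rewrite /= -!mulrA (mulrA Y) -Uk_Y -!mulrA (mulrA Y) e1 !mulrA.
  + have N0 := N_gt0 (~~ side v).
    exists (N1 k.+1 (a' + (N (~~ side v)).-1) (c + N (side v))) => /=.
    rewrite (raise1 (side v) a' c 1) !mul1n -[X in (a' + X)%N](prednK N0) addnS (exprS X).
    rewrite (exprSr U) !mulrA -Uk_Y -!mulrA.
    by rewrite (mulrA Y) -XYC -!mulrA.
  + have N0 := N_gt0 (side v).
    exists (N2 k.+1 (a' + (N (side v)).-1) (b + N (~~ side v)) c) => /=.
    rewrite (raise2 (side v) a' b c 1 0) !addn0 !mul1n.
    rewrite -[X in (a' + X)%N](prednK N0) addnS (exprS X).
    rewrite (exprSr U) !mulrA -Uk_Y -!mulrA.
    by rewrite (mulrA Y) -XYC -!mulrA.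
have [w ha] := lpath_pl pa; rewrite ef in ha; have := pl_side ha; rewrite side_vs.
move: ha; rewrite ef {ef}; case: f => [k a'|k|k a' c|k a' b c] /= ha eo.
- by exists (N1 k 0 a'); rewrite /= mul1r !mulrA Uk_t eo.
- exists (N1 k.+1 (N (~~ side v)) (N (side v)).-1); rewrite /= eo.
  by rewrite mulrA (mulrA (t _)) -Uk_t -(mulrA _ (t _)) t_Y exprSr !mulrA.
- exists (N2 k 0 a' c); rewrite /= mul1r eo !mulrA -Uk_t.
  by [].
have [e1 e2 _ _] := pl_N2 ha.
have [a1 [c1 E]] := @cross3 (side v) a' b (side_vs_mod e2).
exists (N1 k.+2 a1 (c1 + c)); rewrite eo /=.
have -> : t (side v) * (U ^+ k * (X ^+ a' * t (~~ side v) * X ^+ b * t (side v) * X ^+ c) * e v) =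
    U ^+ k * (t (side v) * X ^+ a' * t (~~ side v) * X ^+ b * t (side v)) * X ^+ c * e v.
  by rewrite !mulrA Uk_t.
have ee : e (vs (side v)) * (X ^+ c * e v) = X ^+ c * e v.
  by rewrite X_exp_e e1 mulrA e_idem.
have -> : U ^+ k.+2 = U ^+ k * U ^+ 2 by rewrite -exprD addn2.
by rewrite E (exprD X c1 c) -!mulrA ee.
Qed.

Lemma UU : U ^+ 2 = Y * Y * (X * X).
Proof. by rewrite expr2 XYC -(mulrA Y X) (mulrA X Y) XYC !mulrA. Qed.

(** [U ^+ 2] contains [Y * Y], hence two crossings. The normal forms thus overlap, and this
    rewriting brings the overlap to the form [N2]. *)
Lemma UUX_N2 k v c : exists a' b' c', U ^+ k.+2 * X ^+ c * e v =
  neval (side v) (N2 k a' b' c') * e v.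
Proof.
have [a' [b' [c' E]]] := YY_N2 (iter c.+2 sh v); rewrite side_iter in E.
exists a', b', (c' + c.+2)%N => /=.
have -> : U ^+ k.+2 * X ^+ c * e v = U ^+ k * (Y * Y * X ^+ c.+2 * e v).
  rewrite -addn2 exprD -!(mulrA (U ^+ k)); congr (_ * _).
  by rewrite UU !exprS !mulrA.
rewrite -(mulrA (Y * Y)) X_exp_e (mulrA (Y * Y)) E.
by rewrite -!mulrA -(X_exp_e c.+2) exprD -!mulrA.
Qed.

Lemma UY_N2 k v : exists a' b' c', U ^+ k.+1 * Y * e v =
  neval (side v) (N2 k a' b' c') * e v.
Proof.
have [a' [b' [c' E]]] := YY_N2 (sh v); rewrite side_sh in E.
exists a', b', c'.+1 => /=.
have -> : U ^+ k.+1 * Y * e v = U ^+ k * (Y * Y * (X * e v)).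
  by rewrite exprSr -!mulrA (mulrA X Y) XYC -!mulrA (mulrA X Y) XYC -!mulrA.
rewrite X_e (mulrA (Y * Y)) E.
by rewrite -!mulrA -X_e exprSr -!mulrA.
Qed.

Lemma delta_neq0 o : delta o != 0.
Proof. by have := N_gt0 true; have := N_gt0 false; rewrite /delta; case: o; lia. Qed.

(** [N1] alone changes the component. The second degree of [NX] is a nonpositive multiple of
    [delta], that of [NY] a positive one, so these two never meet. If one of them meets [N2], the
    first degree provides the factors U needed to rewrite it as [N2]. Equal forms with crossings are
    compared by [eq_bridge1] and [eq_bridge2]. *)
Lemma nf_thin f g v j w : pl (neval (side v) f * e v) v j w ->
  pl (neval (side v) g * e v) v j w -> neval (side v) f * e v = neval (side v) g * e v.
Proof.
have D0 := delta_neq0 (side v).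
have c22 k a b c k' a' b' c' : pl (neval (side v) (N2 k a b c) * e v) v j w ->
    pl (neval (side v) (N2 k' a' b' c') * e v) v j w ->
    neval (side v) (N2 k a b c) * e v = neval (side v) (N2 k' a' b' c') * e v.
  move=> h h'; have [e1 e2 _ ew] := pl_N2 h; have [e1' e2' _ ew'] := pl_N2 h'.
  move: ew'; rewrite ew => -[ek ea].
  have -> : k' = k by lia.
  congr (_ * _ * _); apply: eq_bridge2.
  - by apply: sh_mod; rewrite e1 e1'.
  - by have := @sh_mod (vt (side v)) b b'; rewrite side_vt; apply; rewrite e2 e2'.
  by move: ea; rewrite /delta; case: (side v) => /=; lia.
have c2 f' k' a' b' c' : (forall k a c, f' <> N1 k a c) ->
    pl (neval (side v) f' * e v) v j w ->
    pl (neval (side v) (N2 k' a' b' c') * e v) v j w ->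
    neval (side v) f' * e v = neval (side v) (N2 k' a' b' c') * e v.
  case: f' => [k a|k|k a c|k a b c] nN1 h h'.
  - have [_ _ _ ew'] := pl_N2 h'; move: (pl_NX h); rewrite ew' => -[ek _].
    have [a2 [b2 [c2 E]]] := UUX_N2 k' v a.
    have ek' : k = k'.+2 by lia.
    by move: h; rewrite ek' /= E => h; apply: c22.
  - have [_ _ _ ew'] := pl_N2 h'; move: (pl_NY h); rewrite ew' => -[ek _].
    have [a2 [b2 [c2 E]]] := UY_N2 k' v.
    have ek' : k = k'.+1 by lia.
    by move: h; rewrite ek' /= E => h; apply: c22.
  - by case: (nN1 k a c).
  exact: c22.
have n1s f1 k a c : pl (neval (side v) f1 * e v) v j w ->
    pl (neval (side v) (N1 k a c) * e v) v j w -> exists k' a' c', f1 = N1 k' a' c'.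
  move=> /pl_side h /pl_side h'; move: h; rewrite h'.
  by case: f1 => [? ?|?|? ? ?|? ? ? ?]; try (by case: (side v)); do 3!eexists.
case: g => [k' a'|k'|k' a' c'|k' a' b' c'] hf hg; last first.
- case: f hf => [k a|k|k a c|k a b c] hf; try by apply: c2.
  by have [? [? [? ]]] := n1s _ _ _ _ hg hf.
- have [k [a [c ef]]] := n1s _ _ _ _ hf hg; move: hf; rewrite ef => hf.
  have [e1 _ ew] := pl_N1 hf; have [e1' _ ew'] := pl_N1 hg.
  move: ew'; rewrite ew => -[ek ea].
  have -> : k' = k by case: (side v) ek; lia.
  congr (_ * _ * _); apply: eq_bridge1.
    by apply: sh_mod; rewrite e1 e1'.
  by move: ea; rewrite /delta; case: (side v) => /=; lia.
- case: f hf => [k a|k|k a c|k a b c] hf.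
  + by move: (pl_NX hf) D0; rewrite (pl_NY hg) => -[_]; nia.
  + by move: (pl_NY hf); rewrite (pl_NY hg) => -[ek]; have -> : k' = k by lia.
  + by have [? [? [? ]]] := n1s _ _ _ _ hg hf.
  by apply/esym/c2.
case: f hf => [k a|k|k a c|k a b c] hf.
+ move: (pl_NX hf) D0; rewrite (pl_NX hg) => -[ek ea] D0.
  have -> : k' = k by lia.
  by have -> : a' = a by nia.
+ by move: (pl_NX hg) D0; rewrite (pl_NY hf) => -[_]; nia.
+ by have [? [? [? ]]] := n1s _ _ _ _ hg hf.
by apply/esym/c2.
Qed.

Lemma lpath_thin v j a b w : lpath v j a -> lpath v j b ->
  pl a v j w -> pl b v j w -> a = b.
Proof.
by move=> /lpath_nf[f ->] /lpath_nf[g ->]; apply: nf_thin.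
Qed.
End Thin.

Lemma iter_can (S : Type) (f g : S -> S) : cancel f g ->
  forall k, cancel (iter k f) (iter k g).
Proof. by move=> fg; elim=> // k IH x; rewrite iterSr iterS fg IH. Qed.

(** * Iterated shifts of residues and of marked points *)

Section OrdIter.
Variable d : nat.
Implicit Types i j : 'I_d.

Lemma iter_ordS k i : (iter k (@ordS d) i = (i + k) %% d :> nat)%N.
Proof.
elim: k => [|k IH] /=; first by rewrite addn0 modn_small.
by rewrite IH -addn1 modnDml addn1 addnS.
Qed.

Lemma iter_ord_pred k i j : iter k (@ord_pred d) i = j <-> iter k (@ordS d) j = i.
Proof.
by split=> <-; rewrite iter_can //; [exact: ord_predK|exact: ordSK].
Qed.

Lemma ordS_mod k l i : iter k (@ordS d) i = iter l (@ordS d) i -> k = l %[mod d].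
Proof.
move=> /(congr1 (@nat_of_ord d)); rewrite !iter_ordS => /eqP.
by rewrite eqn_modDl => /eqP.
Qed.

Lemma ord_pred_mod k l i :
  iter k (@ord_pred d) i = iter l (@ord_pred d) i -> k = l %[mod d].
Proof.
move=> e; pose j := iter k (@ord_pred d) i.
have h1 : iter k (@ordS d) j = i by apply/iter_ord_pred.
have h2 : iter l (@ordS d) j = i by apply/iter_ord_pred; rewrite /j e.
by apply: (@ordS_mod k l j); rewrite h1 h2.
Qed.

Lemma iter_ordS_mod k i : iter (k %% d) (@ordS d) i = iter k (@ordS d) i.
Proof. by apply: val_inj; rewrite /= !iter_ordS modnDmr. Qed.

Lemma iter_ord_pred_mod k i : iter (k %% d) (@ord_pred d) i = iter k (@ord_pred d) i.
Proof.
apply/iter_ord_pred; rewrite iter_ordS_mod; exact/iter_ord_pred.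
Qed.

Lemma iter_ordS_reach i j : exists2 k, (k < d)%N & iter k (@ordS d) i = j.
Proof.
have lti := ltn_ord i; have ltj := ltn_ord j.
exists ((j + (d - i)) %% d)%N; first by rewrite ltn_mod; lia.
apply: val_inj; rewrite /= iter_ordS modnDmr (_ : i + (j + (d - i)) = j + d)%N; last by lia.
by rewrite modnDr modn_small.
Qed.

Lemma iter_ord_pred_reach i j : exists2 k, (k < d)%N & iter k (@ord_pred d) i = j.
Proof.
have [k lt e] := iter_ordS_reach j i; exists k => //; exact/iter_ord_pred.
Qed.
End OrdIter.

Section Marks.
Variables n m : nat.
Local Notation mark := (mark n m).
Implicit Types p q : mark.
Local Notation om := (@outer_mark n m).
Local Notation bs := (bsize n m).

Lemma outer_mark_prev p : om (mark_prev p) = om p. Proof. by case: p. Qed.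
Lemma outer_mark_next p : om (mark_next p) = om p. Proof. by case: p. Qed.
Lemma outer_mark_iter k p : om (iter k (@mark_prev n m) p) = om p.
Proof. by elim: k => //= k IH; rewrite outer_mark_prev. Qed.

Lemma iter_prev_inl k i : iter k (@mark_prev n m) (inl i) = inl (iter k (@ord_pred n) i).
Proof. by elim: k => //= k ->. Qed.
Lemma iter_prev_inr k i : iter k (@mark_prev n m) (inr i) = inr (iter k (@ordS m) i).
Proof. by elim: k => //= k ->. Qed.

Lemma mark_prev_mod p k l :
  iter k (@mark_prev n m) p = iter l (@mark_prev n m) p -> k = l %[mod bs (om p)].
Proof.
case: p => i; rewrite ?iter_prev_inl ?iter_prev_inr => -[].
  exact: ord_pred_mod.
exact: ordS_mod.
Qed.

Lemma mark_prev_iter_mod p k :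
  iter (k %% bs (om p)) (@mark_prev n m) p = iter k (@mark_prev n m) p.
Proof.
by case: p => i /=; rewrite ?iter_prev_inl ?iter_prev_inr
  ?iter_ord_pred_mod ?iter_ordS_mod.
Qed.

Lemma mark_prev_reach p q : om p = om q ->
  exists2 k, (k < bs (om p))%N & iter k (@mark_prev n m) p = q.
Proof.
case: p q => i [] j //= _.
  by have [k lt e] := iter_ord_pred_reach i j; exists k; rewrite // iter_prev_inl e.
by have [k lt e] := iter_ordS_reach i j; exists k; rewrite // iter_prev_inr e.
Qed.
End Marks.

(* X is the sum of its parts xs true and xs false on the two boundary
   components; powers of X act on one component like those of one part. *)
Section SidePowers.
Variables (L : pzRingType) (V : Type) (e : V -> L) (xs : bool -> L) (X : L).
Variables (side : V -> bool) (sh shi : V -> V).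
Hypothesis XE : X = xs true + xs false.
Hypothesis xs0 : forall v, xs (~~ side v) * e v = 0.
Hypothesis e_xs0 : forall v, e v * xs (~~ side v) = 0.
Hypothesis X_e : forall v, X * e v = e (sh v) * X.
Hypothesis side_sh : forall v, side (sh v) = side v.
Hypothesis shiK : cancel shi sh.

Lemma xs_e v : xs (side v) * e v = X * e v.
Proof.
have := xs0 v; rewrite XE mulrDl; case: (side v) => /= ->; rewrite ?addr0 ?add0r //.
Qed.

Lemma e_xs v : e v * xs (side v) = e v * X.
Proof.
have := e_xs0 v; rewrite XE mulrDr; case: (side v) => /= ->; rewrite ?addr0 ?add0r //.
Qed.

Lemma xs_exp k v : xs (side v) ^+ k * e v = X ^+ k * e v.
Proof.
elim: k v => [|k IH] v //; rewrite !exprSr -!mulrA xs_e X_e !mulrA.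
by rewrite -(side_sh v) IH.
Qed.

Lemma e_xs_exp k v : e v * xs (side v) ^+ k = e v * X ^+ k.
Proof.
elim: k v => [|k IH] v //.
have eX : e v * X = X * e (shi v) by rewrite X_e shiK.
have := IH (shi v); rewrite -side_sh shiK => IH'.
by rewrite !exprS !mulrA e_xs eX -!mulrA IH'.
Qed.

Lemma xs_exp_mul k v a : e v * a = a -> xs (side v) ^+ k * a = X ^+ k * a.
Proof. by move=> <-; rewrite !mulrA xs_exp. Qed.

Lemma e_xs_exp_mul k v a : a * e v = a -> a * xs (side v) ^+ k = a * X ^+ k.
Proof. by move=> <-; rewrite -!mulrA e_xs_exp. Qed.

Variables (t : bool -> L) (vs vt : bool -> V).
Hypothesis eK : forall v, e v * e v = e v.
Hypothesis t_src : forall o, t o * e (vs o) = t o.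
Hypothesis t_tgt : forall o, e (vt o) * t o = t o.
Hypothesis side_vs : forall o, side (vs o) = o.
Hypothesis side_vt : forall o, side (vt o) = ~~ o.

Lemma xs_t_xs k l o : xs (~~ o) ^+ k * t o * xs o ^+ l = X ^+ k * t o * X ^+ l.
Proof.
have h := e_xs_exp_mul l (t_src o); have h' := xs_exp_mul k (t_tgt o).
rewrite side_vs in h; rewrite side_vt in h'.
by rewrite h' -!mulrA h.
Qed.

Lemma side_word v k1 k3 i :
  xs (side v) ^+ k1 * t (~~ side v) * xs (~~ side v) ^+ k3 * t (side v)
    * xs (side v) ^+ i * e v =
  X ^+ k1 * t (~~ side v) * X ^+ k3 * t (side v) * X ^+ i * e v.
Proof.
have e1 o k a : xs (~~ o) ^+ k * (t o * a) = X ^+ k * (t o * a).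
  by rewrite -side_vt; apply: xs_exp_mul; rewrite mulrA t_tgt.
have e2 := e1 (~~ side v); rewrite negbK in e2.
by rewrite -!mulrA (xs_exp_mul _ (eK v)) e1 e2.
Qed.
End SidePowers.

(** * Products of one x and one y on a single boundary component *)

Section SideWords.
Variables (L : pzRingType) (V : Type) (e : V -> L) (xs ys : bool -> L) (X Y : L).
Variables (side : V -> bool) (sh shi : V -> V).
Hypothesis XE : X = xs true + xs false.
Hypothesis YE : Y = ys true + ys false.
Hypothesis xs0 : forall v, xs (~~ side v) * e v = 0.
Hypothesis e_xs0 : forall v, e v * xs (~~ side v) = 0.
Hypothesis ys0 : forall v, ys (~~ side v) * e v = 0.
Hypothesis e_ys0 : forall v, e v * ys (~~ side v) = 0.
Hypothesis X_e : forall v, X * e v = e (sh v) * X.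
Hypothesis Y_e : forall v, Y * e v = e (shi v) * Y.
Hypothesis side_shi : forall v, side (shi v) = side v.
Hypothesis shiK : cancel shi sh.

Lemma xs_ys v : xs (side v) * ys (side v) * e v = X * Y * e v.
Proof.
rewrite -!mulrA (xs_e YE ys0) Y_e !mulrA -{1}(side_shi v).
by rewrite (xs_e XE xs0).
Qed.

Lemma e_xs_ys v : e v * (xs (side v) * ys (side v)) = e v * (X * Y).
Proof.
have eX : e v * X = X * e (shi v) by rewrite X_e shiK.
by rewrite !mulrA (e_xs XE e_xs0) eX -(side_shi v) -!mulrA (e_xs YE e_ys0).
Qed.

Lemma xs_ys_mul v a : e v * a = a -> xs (side v) * ys (side v) * a = X * Y * a.
Proof. by move=> <-; rewrite mulrA xs_ys -mulrA. Qed.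

Lemma mul_xs_ys v a : a * e v = a -> a * xs (side v) * ys (side v) = a * X * Y.
Proof. by move=> <-; rewrite -!mulrA e_xs_ys. Qed.
End SideWords.

(** * The algebra Lambda *)

Section LambdaFacts.
Variables (K : fieldType) (n m : nat) (n_gt0 : (0 < n)%N) (m_gt0 : (0 < m)%N).
Local Notation QL := (lambda_quiver n_gt0 m_gt0).
Local Notation lrel := (@lambda_relator K n m n_gt0 m_gt0).
Local Notation LA := (Lambda K n_gt0 m_gt0).
Local Notation V := (lambda_vertex n m).
Implicit Types (u v : V).

Definition lside v : bool := if v is inl _ then true else false.
Definition lsh v : V := match v with inl i => inl (ordS i) | inr j => inr (ord_pred j) end.
Definition lshi v : V := match v with inl i => inl (ord_pred i) | inr j => inr (ordS j) end.
Definition lvs (o : bool) : V := if o then outer m n_gt0 1 else inner n m_gt0 m.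
Definition lvt (o : bool) : V := if o then inner n m_gt0 1 else outer m n_gt0 n.

Lemma lshK : cancel lsh lshi.
Proof. by case=> i /=; rewrite ?ordSK ?ord_predK. Qed.
Lemma lshiK : cancel lshi lsh.
Proof. by case=> i /=; rewrite ?ordSK ?ord_predK. Qed.
Lemma lside_sh v : lside (lsh v) = lside v. Proof. by case: v. Qed.
Lemma lside_shi v : lside (lshi v) = lside v. Proof. by case: v. Qed.
Lemma lside_vs o : lside (lvs o) = o. Proof. by case: o. Qed.
Lemma lside_vt o : lside (lvt o) = ~~ o. Proof. by case: o. Qed.

Lemma lsh_vt o : lsh (lvt o) = lvs (~~ o).
Proof.
case: o; rewrite /lvt /lvs /= /inner /outer; congr (_ _); apply: val_inj => /=.
  by case: m m_gt0 => [//|[//|k]] _; rewrite (@modn_small 1) // add1n.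
by rewrite modnn.
Qed.

Lemma iter_lsh_inl k i : iter k lsh (inl i) = inl (iter k (@ordS n) i).
Proof. by elim: k => //= k ->. Qed.
Lemma iter_lsh_inr k i : iter k lsh (inr i) = inr (iter k (@ord_pred m) i).
Proof. by elim: k => //= k ->. Qed.

Lemma lsh_mod v k l : iter k lsh v = iter l lsh v -> k = l %[mod bsize n m (lside v)].
Proof.
case: v => i; rewrite ?iter_lsh_inl ?iter_lsh_inr => -[].
  exact: ordS_mod.
exact: ord_pred_mod.
Qed.

Lemma lsh_reach v : exists2 i, (i < bsize n m (lside v))%N & iter i lsh v = lvs (lside v).
Proof.
case: v => j /=.
  have [k lt e] := iter_ordS_reach j (Ordinal (ltn_pmod 1 n_gt0)).
  by exists k; rewrite // iter_lsh_inl e.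
have [k lt e] := iter_ord_pred_reach j (Ordinal (ltn_pmod m m_gt0)).
by exists k; rewrite // iter_lsh_inr e.
Qed.

Local Notation el := (vcl lrel).
Local Notation al := (acl lrel).

Definition lx (o : bool) : LA := if o then \sum_(i < n) al (arrow_x m i)
  else \sum_(i < m) al (arrow_xbar n i).
Definition ly (o : bool) : LA := if o then \sum_(i < n) al (arrow_y m i)
  else \sum_(i < m) al (arrow_ybar n i).
Definition lt_ (o : bool) : LA := al (inr o).
Definition XL : LA := lx true + lx false.
Definition YL : LA := ly true + ly false.

Definition xarrow v : arrow QL :=
  match v with inl i => arrow_x m (ordS i) | inr j => arrow_xbar n j end.
Definition yarrow v : arrow QL :=
  match v with inl i => arrow_y m i | inr j => arrow_ybar n (ordS j) end.

Lemma al_el (a : arrow QL) v : al a * el v = if v == qsrc a then al a else 0.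
Proof. exact: acl_vcl. Qed.
Lemma el_al (a : arrow QL) v : el v * al a = if v == qtgt a then al a else 0.
Proof. exact: vcl_acl. Qed.

Lemma sum_al_el (d : nat) (F : 'I_d -> arrow QL) (k : 'I_d) v :
  (forall i, (v == qsrc (F i)) = (i == k)) -> (\sum_(i < d) al (F i)) * el v = al (F k).
Proof.
move=> H; rewrite mulr_suml (bigD1 k) //= al_el H eqxx big1 ?addr0 // => i ne.
by rewrite al_el H (negPf ne).
Qed.
Lemma sum_el_al (d : nat) (F : 'I_d -> arrow QL) (k : 'I_d) v :
  (forall i, (v == qtgt (F i)) = (i == k)) -> el v * (\sum_(i < d) al (F i)) = al (F k).
Proof.
move=> H; rewrite mulr_sumr (bigD1 k) //= el_al H eqxx big1 ?addr0 // => i ne.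
by rewrite el_al H (negPf ne).
Qed.
Lemma sum_al_el0 (d : nat) (F : 'I_d -> arrow QL) v :
  (forall i, (v == qsrc (F i)) = false) -> (\sum_(i < d) al (F i)) * el v = 0.
Proof. by move=> H; rewrite mulr_suml big1 // => i _; rewrite al_el H. Qed.
Lemma sum_el_al0 (d : nat) (F : 'I_d -> arrow QL) v :
  (forall i, (v == qtgt (F i)) = false) -> el v * (\sum_(i < d) al (F i)) = 0.
Proof. by move=> H; rewrite mulr_sumr big1 // => i _; rewrite el_al H. Qed.

Lemma inl_eqE (i j : 'I_n) : ((inl i : V) == inl j) = (i == j).
Proof. exact: inj_eq (@inl_inj _ _) i j. Qed.
Lemma inr_eqE (i j : 'I_m) : ((inr i : V) == inr j) = (i == j).
Proof. exact: inj_eq (@inr_inj _ _) i j. Qed.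

Lemma lx_side v : lx (~~ lside v) * el v = 0.
Proof. by case: v => i; apply: sum_al_el0. Qed.
Lemma ly_side v : ly (~~ lside v) * el v = 0.
Proof. by case: v => i; apply: sum_al_el0. Qed.

Lemma XL_el v : XL * el v = al (xarrow v).
Proof.
rewrite /XL mulrDl; case: v => i.
  rewrite (lx_side (inl i)) addr0; apply: (@sum_al_el _ (arrow_x m)) => j.
  by rewrite inl_eqE eq_sym (can2_eq (@ord_predK n) (@ordSK n)).
rewrite (lx_side (inr i)) add0r; apply: (@sum_al_el _ (@arrow_xbar n m) i (inr i)) => j.
by rewrite inr_eqE eq_sym.
Qed.

Lemma YL_el v : YL * el v = al (yarrow v).
Proof.
rewrite /YL mulrDl; case: v => i.
  rewrite (ly_side (inl i)) addr0; apply: (@sum_al_el _ (arrow_y m)) => j.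
  by rewrite inl_eqE eq_sym.
rewrite (ly_side (inr i)) add0r; apply: (@sum_al_el _ (@arrow_ybar n m) (ordS i) (inr i)) => j.
by rewrite inr_eqE eq_sym (can2_eq (@ord_predK m) (@ordSK m)).
Qed.

Lemma el_XL v : el (lsh v) * XL = al (xarrow v).
Proof.
rewrite /XL mulrDr; case: v => i.
  rewrite (@sum_el_al0 m (@arrow_xbar n m) (inl _)) // addr0.
  by apply: (@sum_el_al _ (arrow_x m)) => j; rewrite inl_eqE eq_sym.
rewrite (@sum_el_al0 n (arrow_x m) (inr _)) // add0r.
apply: (@sum_el_al _ (@arrow_xbar n m) i (inr (ord_pred i))) => j.
by rewrite inr_eqE (inj_eq (can_inj (@ord_predK m))) eq_sym.
Qed.

Lemma el_YL v : el (lshi v) * YL = al (yarrow v).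
Proof.
rewrite /YL mulrDr; case: v => i.
  rewrite (@sum_el_al0 m (@arrow_ybar n m) (inl _)) // addr0.
  apply: (@sum_el_al _ (arrow_y m)) => j.
  by rewrite inl_eqE (inj_eq (can_inj (@ord_predK n))) eq_sym.
rewrite (@sum_el_al0 n (arrow_y m) (inr _)) // add0r.
by apply: (@sum_el_al _ (@arrow_ybar n m) (ordS i) (inr (ordS i))) => j; rewrite inr_eqE eq_sym.
Qed.

Lemma XL_shift v : XL * el v = el (lsh v) * XL. Proof. by rewrite XL_el el_XL. Qed.
Lemma YL_shift v : YL * el v = el (lshi v) * YL. Proof. by rewrite YL_el el_YL. Qed.

Lemma lt_src o : lt_ o * el (lvs o) = lt_ o.
Proof. by case: o; rewrite /lt_ /lvs; exact: (acl_src lrel). Qed.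
Lemma lt_tgt o : el (lvt o) * lt_ o = lt_ o.
Proof.
case: o; first exact: (acl_tgt lrel (inr true : arrow QL)).
exact: (acl_tgt lrel (inr false : arrow QL)).
Qed.

Lemma sum_el : \sum_v el v = 1.
Proof.
transitivity (qclass lrel (path_one K QL)); last by [].
by rewrite /path_one class_sum; apply: eq_bigr => v _; rewrite vclE.
Qed.

Lemma el_ext (a b : LA) : (forall v, a * el v = b * el v) -> a = b.
Proof.
move=> H; rewrite -[a]mulr1 -[b]mulr1 -sum_el !mulr_sumr.
by apply: eq_bigr => v _; apply: H.
Qed.

Lemma elK v : el v * el v = el v. Proof. exact: vclK. Qed.

Lemma el_lx_side v : el v * lx (~~ lside v) = 0.
Proof. by case: v => i; apply: sum_el_al0. Qed.
Lemma el_ly_side v : el v * ly (~~ lside v) = 0.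
Proof. by case: v => i; apply: sum_el_al0. Qed.

Lemma class_x1 : qclass lrel (\sum_(i < n) arr K (arrow_x m i : arrow QL)) = lx true.
Proof. by rewrite class_sum; apply: eq_bigr => i _; rewrite aclE. Qed.
Lemma class_x0 : qclass lrel (\sum_(i < m) arr K (arrow_xbar n i : arrow QL)) = lx false.
Proof. by rewrite class_sum; apply: eq_bigr => i _; rewrite aclE. Qed.
Lemma class_y1 : qclass lrel (\sum_(i < n) arr K (arrow_y m i : arrow QL)) = ly true.
Proof. by rewrite class_sum; apply: eq_bigr => i _; rewrite aclE. Qed.
Lemma class_y0 : qclass lrel (\sum_(i < m) arr K (arrow_ybar n i : arrow QL)) = ly false.
Proof. by rewrite class_sum; apply: eq_bigr => i _; rewrite aclE. Qed.

Lemma lrel_eq f g : lrel (f - g) -> qclass lrel f = qclass lrel g.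
Proof. by move=> /class_rel; rewrite classB => /eqP; rewrite subr_eq0 => /eqP. Qed.

(* The classes are passed as equations: matching the sums of arrows in the
   relators up to conversion would unfold them. *)
Lemma lrel3 f1 f2 f3 g1 g2 g3 c1 c2 c3 d1 d2 d3 :
  qclass lrel f1 = c1 -> qclass lrel f2 = c2 -> qclass lrel f3 = c3 ->
  qclass lrel g1 = d1 -> qclass lrel g2 = d2 -> qclass lrel g3 = d3 ->
  lrel (f1 * f2 * f3 - g1 * g2 * g3) -> c1 * c2 * c3 = d1 * d2 * d3.
Proof. by do 6!move=> <-; move=> /lrel_eq; rewrite !classM. Qed.

Lemma lrel_shift f g1 k g2 l g3 c d1 d2 d3 :
  qclass lrel f = c ->
  qclass lrel g1 = d1 -> qclass lrel g2 = d2 -> qclass lrel g3 = d3 ->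
  lrel (f - g1 ^+ k * g2 * g3 ^+ l) -> c = d1 ^+ k * d2 * d3 ^+ l.
Proof. by do 4!move=> <-; move=> /lrel_eq; rewrite !classM !class_exp. Qed.

Lemma lrel_square f f' g1 k1 g2 g3 k3 g4 g5 k5 g6 c c' d1 d2 d3 d4 d5 d6 :
  qclass lrel f = c -> qclass lrel f' = c' ->
  qclass lrel g1 = d1 -> qclass lrel g2 = d2 -> qclass lrel g3 = d3 ->
  qclass lrel g4 = d4 -> qclass lrel g5 = d5 -> qclass lrel g6 = d6 ->
  lrel (f ^+ 2 * f' - g1 ^+ k1 * g2 * g3 ^+ k3 * g4 * g5 ^+ k5 * g6) ->
  c ^+ 2 * c' = d1 ^+ k1 * d2 * d3 ^+ k3 * d4 * d5 ^+ k5 * d6.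
Proof. by do 8!move=> <-; move=> /lrel_eq; rewrite !classM !class_exp. Qed.

Lemma class_vtx v : qclass lrel (vtx K (v : vertex QL)) = el v. Proof. by rewrite vclE. Qed.
Lemma class_arr (a : arrow QL) : qclass lrel (arr K a) = al a. Proof. by rewrite aclE. Qed.

Lemma lx_ly v a : el v * a = a -> lx (lside v) * ly (lside v) * a = XL * YL * a.
Proof. exact: (xs_ys_mul (erefl XL) (erefl YL) lx_side ly_side YL_shift lside_shi). Qed.
Lemma ly_lx v a : el v * a = a -> ly (lside v) * lx (lside v) * a = YL * XL * a.
Proof. exact: (xs_ys_mul (erefl YL) (erefl XL) ly_side lx_side XL_shift lside_sh). Qed.
Lemma mul_lx_ly v a : a * el v = a -> a * lx (lside v) * ly (lside v) = a * XL * YL.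
Proof.
exact: (mul_xs_ys (erefl XL) (erefl YL) el_lx_side el_ly_side XL_shift lside_shi lshiK).
Qed.
Lemma mul_ly_lx v a : a * el v = a -> a * ly (lside v) * lx (lside v) = a * YL * XL.
Proof.
exact: (mul_xs_ys (erefl YL) (erefl XL) el_ly_side el_lx_side YL_shift lside_sh lshK).
Qed.

Lemma XYL : XL * YL = YL * XL.
Proof.
apply: el_ext => v; rewrite -(lx_ly (elK v)) -(ly_lx (elK v)); case: v => v.
  exact: (lrel3 class_x1 class_y1 (class_vtx _) class_y1 class_x1 (class_vtx _)
            (lambda_xy K n_gt0 m_gt0 v)).
exact: (lrel3 class_x0 class_y0 (class_vtx _) class_y0 class_x0 (class_vtx _)
          (lambda_xybar K n_gt0 m_gt0 v)).
Qed.

Lemma lt_shift o : lt_ o = XL ^+ bsize n m (~~ o) * lt_ o * XL ^+ bsize n m o.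
Proof.
rewrite -(xs_t_xs (erefl XL) lx_side el_lx_side XL_shift lside_sh lshiK lt_src lt_tgt
  lside_vs lside_vt); case: o.
  exact: (lrel_shift (class_arr _) class_x0 (class_arr _) class_x1 (lambda_r K n_gt0 m_gt0)).
exact: (lrel_shift (class_arr _) class_x1 (class_arr _) class_x0 (lambda_s K n_gt0 m_gt0)).
Qed.

Lemma lt_XY o : lt_ o * (XL * YL) = XL * YL * lt_ o.
Proof.
have h1 := ly_lx (lt_tgt o); have h2 := lx_ly (lt_tgt o).
have h3 := mul_lx_ly (lt_src o); have h4 := mul_ly_lx (lt_src o).
rewrite lside_vt in h1 h2; rewrite lside_vs in h3 h4.
case: o h1 h2 h3 h4 => h1 h2 h3 h4.
  rewrite -h2 XYL mulrA -h4; apply/esym.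
  exact: (lrel3 class_x0 class_y0 (class_arr _) (class_arr _) class_y1 class_x1
            (lambda_xyr K n_gt0 m_gt0)).
rewrite mulrA -h3 XYL -h1; apply/esym.
exact: (lrel3 class_y1 class_x1 (class_arr _) (class_arr _) class_x0 class_y0
          (lambda_yxs K n_gt0 m_gt0)).
Qed.

(** The length of the orbit of [v] is divisible by [d], so an index below [d] does not wrap around.
    This matches the exponent of the relators with the [i] of the abstract setting. *)
Lemma findex_eq (S : finType) (f : S -> S) (d i : nat) (v w : S) : injective f ->
  (forall k l, iter k f v = iter l f v -> k = l %[mod d]) ->
  (i < d)%N -> iter i f v = w -> findex f v w = i.
Proof.
move=> finj H lt <-; apply: findex_iter; apply: (leq_trans lt).
have h : fingraph.order f v = 0 %[mod d] by apply: H; rewrite iter_order.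
by apply: dvdn_leq; rewrite ?order_gt0 //; apply/eqP; rewrite h mod0n.
Qed.

Lemma lYY v i : (i < bsize n m (lside v))%N -> iter i lsh v = lvs (lside v) ->
  YL * YL * el v = XL ^+ (bsize n m (lside v) - 1 - i) * lt_ (~~ lside v)
    * XL ^+ (bsize n m (~~ lside v)).+1 * lt_ (lside v) * XL ^+ i * el v.
Proof.
move=> lt ei.
have cY : ly (lside v) ^+ 2 * el v = YL * YL * el v.
  by rewrite (xs_exp (erefl YL) ly_side YL_shift lside_shi) expr2.
have cR := side_word (erefl XL) lx_side XL_shift lside_sh elK lt_tgt lside_vt v.
rewrite -cY -cR.
case: v lt ei {cY cR} => v lt ei.
  have -> : i = findex (@ordS n) v (Ordinal (ltn_pmod 1 n_gt0)).
    apply/esym/(findex_eq (d := n)) => //; first exact: can_inj (@ordSK n).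
      by move=> k l; apply: ordS_mod.
    by move: ei; rewrite iter_lsh_inl => -[].
  exact: (lrel_square class_y1 (class_vtx _) class_x1 (class_arr _) class_x0 (class_arr _)
    class_x1 (class_vtx _) (lambda_yy K n_gt0 m_gt0 v)).
have -> : i = findex (@ord_pred m) v (Ordinal (ltn_pmod m m_gt0)).
  apply/esym/(findex_eq (d := m)) => //; first exact: can_inj (@ord_predK m).
    by move=> k l; apply: ord_pred_mod.
  by move: ei; rewrite iter_lsh_inr => -[].
exact: (lrel_square class_y0 (class_vtx _) class_x0 (class_arr _) class_x1 (class_arr _)
  class_x0 (class_vtx _) (lambda_yybar K n_gt0 m_gt0 v)).
Qed.

Lemma lpath_pcl u (w : seq (arrow QL)) : is_qpath (u : vertex QL) w ->
  lpath el XL YL lt_ lsh lshi lvs lvt u (qend (u : vertex QL) w) (pcl lrel u w).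
Proof.
elim/last_ind: w => [|w a IH]; first by rewrite pcl_nil; constructor.
rewrite is_qpath_rcons qend_rcons pcl_rcons => /andP[/IH {}IH /eqP ea].
have tg := vcl_pcl lrel (u : vertex QL) w; rewrite -ea in IH tg.
case: a ea IH tg => [[[[i|i]|i]|i]|o] _ IH tg.
- have -> : al (arrow_x m i : arrow QL) * pcl lrel u w = XL * pcl lrel u w.
    rewrite -{2}tg mulrA XL_el; congr (acl _ _ * _).
    by rewrite /= ord_predK.
  by have := lpath_X IH; rewrite /= ord_predK.
- have -> : al (arrow_y m i : arrow QL) * pcl lrel u w = YL * pcl lrel u w.
    by rewrite -{2}tg mulrA YL_el.
  exact: lpath_Y IH.
- have -> : al (arrow_xbar n i : arrow QL) * pcl lrel u w = XL * pcl lrel u w.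
    by rewrite -{2}tg mulrA XL_el.
  exact: lpath_X IH.
- have -> : al (arrow_ybar n i : arrow QL) * pcl lrel u w = YL * pcl lrel u w.
    rewrite -{2}tg mulrA YL_el; congr (acl _ _ * _).
    by rewrite /= ord_predK.
  by have := lpath_Y IH; rewrite /= ord_predK.
case: o IH tg => IH tg; first exact: (@lpath_t _ _ _ _ _ _ _ _ _ _ _ true).
exact: (@lpath_t _ _ _ _ _ _ _ _ _ _ _ false).
Qed.
End LambdaFacts.

(** * The isomorphism *)

Section Comparison.
Variables (K : fieldType) (n m : nat) (n_gt0 : (0 < n)%N) (m_gt0 : (0 < m)%N).
Variable T : annulus_triangulation n m.
Local Notation node := ((triangle T * 'I_3) + mark n m)%type.
Local Notation mark := (mark n m).
Local Notation D := (triangulation_diagram T).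
Local Notation QD := (diagram_quiver D).
Local Notation rel := (@dimer_relator D K).
Local Notation A := (dimer_algebra D K).
Local Notation aD := (acl rel : node -> A).
Local Notation eA := (@eD n m T K).
Local Notation pm := (piv_mark n_gt0 m_gt0).
Local Notation bv := (@bv n m T).
Local Notation om := (@outer_mark n m).
Local Notation bs := (bsize n m).
Local Notation plike := (@pathlike n m T K).
Local Notation mprev := (@mark_prev n m).
Local Notation mnext := (@mark_next n m).

Variables (b0 : node) (i0 j0 : int).
Hypothesis b0P : elift b0 (inl i0) (inr j0).

Definition P0 : mark := mark_of n_gt0 m_gt0 (inl i0).
Definition Q0 : mark := mark_of n_gt0 m_gt0 (inr j0).

Let EM := @eD_M n m T K.
Let E_gm := @eD_gm n m T K.
Let E_a := @eD_aD n m T K.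
Let a_E := @aD_eD n m T K.
Let dim := @dimerD n m T K.

Local Notation XA := (XX aD).
Local Notation YA := (YY n_gt0 m_gt0 eA aD).
Local Notation yA := (yy n_gt0 m_gt0 eA aD).
Local Notation zA := (zz n_gt0 m_gt0 eA aD).
Local Notation ep := (ee eA).
Local Notation br := (bridge n_gt0 m_gt0 eA aD b0).

Definition mvs (o : bool) : mark := if o then P0 else Q0.
Definition mvt (o : bool) : mark := if o then mnext Q0 else mnext P0.

Lemma pm_b0 : pm b0 = P0. Proof. exact: elift_piv_mark b0P. Qed.
Lemma pm_gm_b0 : pm (gm b0) = Q0.
Proof. exact: elift_piv_mark (elift_gm b0P). Qed.

Lemma br_src o : br o * ep (mvs o) = br o.
Proof. by case: o; rewrite /bridge /mvs -?pm_b0 -?pm_gm_b0 zz_src. Qed.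
Lemma br_tgt o : ep (mvt o) * br o = br o.
Proof.
case: o; rewrite /bridge /mvt -?pm_b0 -?pm_gm_b0.
  by rewrite zz_tgt.
by rewrite -{1}(gmK b0) zz_tgt.
Qed.

Lemma om_mvs o : om (mvs o) = o. Proof. by case: o. Qed.
Lemma om_mvt o : om (mvt o) = ~~ o. Proof. by case: o. Qed.
Lemma prev_mvt o : mprev (mvt o) = mvs (~~ o).
Proof. by case: o; rewrite /mvt mark_nextK. Qed.

Lemma delta_shift (p : mark) : delta bs (om p) = shift_wt p.
Proof. by case: p. Qed.

Definition pla (t : A) (p q : mark) w := plike t (bv p) (bv q) w.

Lemma pla_unique t p q w p' q' w' :
  pla t p q w -> pla t p' q' w' -> [/\ p = p', q = q' & w = w'].
Proof.
move=> h h'; have [e1 e2 ->] := pathlike_unique n_gt0 m_gt0 h h'.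
by rewrite (bv_inj e1) (bv_inj e2).
Qed.

Lemma plaM t u i j k w w' : pla t j k w -> pla u i j w' -> pla (t * u) i k (w + w').
Proof. exact: pathlikeM. Qed.

Lemma pla_neq0 t p q w : pla t p q w -> t <> 0.
Proof. exact: (pathlike_neq0 n_gt0 m_gt0). Qed.

Lemma pla_tgt t p q w : pla t p q w -> ep q * t = t.
Proof. exact: pathlike_tgt. Qed.

Lemma pla_e p : pla (ep p) p p 0.
Proof. exact: pathlike_eD. Qed.

Lemma pla_X p : pla (XA * ep p) p (mprev p) (0, - (delta bs (om p) + delta bs (om p))).
Proof.
rewrite XX_ee // delta_shift; have := pathlike_ax n_gt0 m_gt0 T K (mprev p).
by rewrite mark_prevK mulr2n (_ : shift_wt (mprev p) = shift_wt p) //; case: (p).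
Qed.

Lemma pla_Y p : pla (YA * ep p) p (mnext p) (1, delta bs (om p) + delta bs (om p)).
Proof. by rewrite YY_ee // delta_shift -mulr2n; exact: pathlike_yy. Qed.

(** [j0 * n - i0 * m] is the height difference along the side at [b0], which counts twice in
    [pathlike_zz]; [m - n] is the sum of [shift_wt] at its two ends. *)
Definition omega (o : bool) : int :=
  (if o then 2%:Z else - 2%:Z) * (j0 * n%:Z - i0 * m%:Z) + m%:Z - n%:Z.

Lemma pla_br o : pla (br o) (mvs o) (mvt o) ((if o then 2%:Z else 0), omega o).
Proof.
have [k [h1 h2]] := b0P.
have ephi : phi b0 = (1, j0 * n%:Z - i0 * m%:Z).
  by rewrite /phi h1 h2 side_wt_deck.
have := pathlike_zz n_gt0 m_gt0 K b0; have := pathlike_zz n_gt0 m_gt0 K (gm b0).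
rewrite gmK pm_b0 pm_gm_b0 (phi_gm n_gt0 m_gt0) ephi => hs hr.
case: o; rewrite /bridge /pla /mvs /mvt.
  suff -> : (2%:Z, omega true) = (1, j0 * n%:Z - i0 * m%:Z)
    + (1, j0 * n%:Z - i0 * m%:Z) + (0, shift_wt P0 + shift_wt Q0) by exact: hr.
  by apply: injective_projections => /=; rewrite /omega /shift_wt /P0 /Q0 /=; lia.
suff -> : (0%Z, omega false) = (1%Z, 0%Z) - (1%Z, j0 * n%:Z - i0 * m%:Z)
    + ((1%Z, 0%Z) - (1%Z, j0 * n%:Z - i0 * m%:Z)) + (0%Z, shift_wt Q0 + shift_wt P0)
  by exact: hs.
by apply: injective_projections => /=; rewrite /omega /shift_wt /P0 /Q0 /=; lia.
Qed.

Lemma br_shift o : br o = XA ^+ bs (~~ o) * br o * XA ^+ bs o.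
Proof. by have := bridge_shift n_gt0 m_gt0 EM E_gm E_a a_E dim b0P o; exact. Qed.

Lemma bs_gt0 o : (0 < bs o)%N. Proof. by case: o. Qed.

(** The square is the path [zz (lst p)] across a boundary interval seen from the exterior, so
    [zz_outward] gives it two crossings with unknown exponents. Its degree, twice that of y, and its
    ends suffice for [eq_bridge2] to replace these by the exponents of Lambda. *)
Lemma YYA p i : (i < bs (om p))%N -> iter i mprev p = mvs (om p) ->
  YA * YA * ep p = XA ^+ (bs (om p) - 1 - i) * br (~~ om p) * XA ^+ (bs (~~ om p)).+1
                   * br (om p) * XA ^+ i * ep p.
Proof.
move=> lt ei.
have eY : YA * YA * ep p = zA (lst T p).
  by rewrite zz_lst -mulrA YY_ee // -{1}ee_yy // mulrA YY_ee.
have pl : elift (lst T p) (edge_end (inr (mnext p) : node)) (edge_piv (inr (mnext p) : node)).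
  by have := elift_gm (elift_refl (inr (mnext p) : node)); rewrite -(gm_lst T p) gmK.
rewrite edge_mark_next in pl.
have sP : same_side (edge_end (inr (mnext p) : node))
    (strip_next (edge_end (inr (mnext p) : node))).
  by case: (edge_end _).
have [k1 [k2 [k3 /= ez]]] := zz_outward n_gt0 m_gt0 EM E_gm E_a a_E dim b0P pl sP (strip_nextP _).
rewrite pm_lst in ez.
have zs : zA (lst T p) * ep p = zA (lst T p).
  by have := @zz_src n m n_gt0 m_gt0 T A eA aD EM (lst T p); rewrite pm_lst.
have h : pla (neval XA YA br (om p) (N2 0 k1 k2 k3) * ep p) p (mnext (mnext p))
    (1 + 1, delta bs (om p) + delta bs (om p) + (delta bs (om p) + delta bs (om p))).
  rewrite /= mul1r -ez zs -eY.
  have h1 := pla_Y (mnext p); rewrite outer_mark_next in h1.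
  have h2 := plaM h1 (pla_Y p); rewrite -(mulrA YA) (pla_tgt (pla_Y p)) mulrA in h2.
  exact: h2.
have [e1 e2 _ [ew]] := pl_N2 (@ee_M n m T A eA EM) br_src (@mark_nextK n m) (@outer_mark_prev n m)
  om_mvt pla_unique plaM pla_neq0 pla_tgt pla_e pla_X pla_Y pla_br h.
rewrite eY -zs ez; congr (_ * _).
apply: (eq_bridge2 bs_gt0 br_shift).
- by have := @mark_prev_mod n m p k3 i; rewrite e1 ei; apply.
- have := @mark_prev_mod n m (mvt (om p)) k2 1; rewrite e2 /= prev_mvt om_mvt => ->//.
  by rewrite -[(bs _).+1]addn1 modnDl.
have -> : (bs (om p) - 1 - i + i = (bs (om p)).-1)%N by lia.
move: ew; rewrite /delta /omega /bsize; have := n_gt0; have := m_gt0.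
by case: (om p) => /=; nia.
Qed.

Local Notation V := (lambda_vertex n m).
Local Notation QL := (lambda_quiver n_gt0 m_gt0).
Local Notation lrel := (@lambda_relator K n m n_gt0 m_gt0).
Local Notation LA := (Lambda K n_gt0 m_gt0).
Local Notation el := (vcl lrel).
Local Notation al := (acl lrel).
Implicit Types (u v : V).

(* The numbering of the boundary vertices for which r starts at P0 and s at Q0. *)
Definition gv v : mark :=
  match v with inl i => iter i mprev (mnext P0) | inr j => iter j mnext Q0 end.

Lemma om_gv v : om (gv v) = lside v.
Proof.
case: v => i /=; first by rewrite outer_mark_iter.
by elim: (nat_of_ord i) => //= k IH; rewrite outer_mark_next.
Qed.

Lemma gv_outer k : gv (outer m n_gt0 k) = iter k mprev (mnext P0).
Proof. by rewrite /= -[RHS]mark_prev_iter_mod. Qed.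

Lemma gv_inner k : gv (inner n m_gt0 k) = iter k mnext Q0.
Proof.
rewrite /=.
have e := @mark_prev_iter_mod n m Q0.
pose q := iter k mnext Q0; have eq0 : Q0 = iter k mprev q.
  by rewrite /q iter_can //; exact: mark_nextK.
have eqm : Q0 = iter (k %% m) mprev q.
  have oq : om q = false by rewrite /q; elim: (k) => //= k' IH; rewrite outer_mark_next.
  by have := mark_prev_iter_mod q k; rewrite oq -eq0 => <-.
by rewrite [in LHS]eqm iter_can //; exact: mark_prevK.
Qed.

Lemma gv_vs o : gv (lvs n_gt0 m_gt0 o) = mvs o.
Proof.
case: o; last by rewrite /= modnn.
by rewrite -[LHS]/(gv (outer m n_gt0 1)) gv_outer; exact: mark_nextK.
Qed.
Lemma gv_vt o : gv (lvt n_gt0 m_gt0 o) = mvt o.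
Proof.
case: o; last by rewrite /= modnn.
by rewrite -[LHS]/(gv (inner n m_gt0 1)) gv_inner.
Qed.

Lemma gv_sh v : gv (lsh v) = mprev (gv v).
Proof.
case: v => i.
  have -> : lsh (inl i) = outer m n_gt0 i.+1 by congr (inl _); apply: val_inj.
  by rewrite gv_outer.
apply: (can_inj (@mark_nextK n m)); rewrite mark_prevK.
have e : (inr i : V) = inner n m_gt0 (ord_pred i).+1.
  congr (_ _); apply: val_inj => /=; rewrite -[RHS]/(nat_of_ord (ordS (ord_pred i))).
  by rewrite ord_predK.
by rewrite [in RHS]e gv_inner.
Qed.

Lemma gv_shi v : gv (lshi v) = mnext (gv v).
Proof. by rewrite -{2}(lshiK v) gv_sh mark_prevK. Qed.

Lemma gv_iter k v : gv (iter k (@lsh n m) v) = iter k mprev (gv v).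
Proof. by elim: k => //= k IH; rewrite gv_sh IH. Qed.

Lemma gv_inj : injective gv.
Proof.
move=> u v e; have es : lside u = lside v by rewrite -!om_gv e.
have [k _ ek] := lsh_reach n_gt0 m_gt0 u.
have [l ltl el'] := lsh_reach n_gt0 m_gt0 v.
have h : iter k mprev (gv u) = iter l mprev (gv u).
  by rewrite -gv_iter ek e -gv_iter el' es.
have hm := mark_prev_mod h; rewrite om_gv in hm.
have H w i : iter (i %% bs (lside w)) (@lsh n m) w = iter i (@lsh n m) w.
  by case: w => j /=; rewrite ?iter_lsh_inl ?iter_lsh_inr ?iter_ordS_mod ?iter_ord_pred_mod.
have : iter k (@lsh n m) u = iter k (@lsh n m) v.
  have -> : iter k (@lsh n m) v = iter l (@lsh n m) v.
    by rewrite -(H v k) -es hm es H.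
  by rewrite ek el' es.
by move=> /(congr1 (iter k (@lshi n m))); rewrite !iter_can //; exact: lshK.
Qed.

Lemma gv_surj p : exists v, gv v = p.
Proof.
have [v ov] : exists v, om p = om (gv v).
  case: p => i; first by exists (outer m n_gt0 0); rewrite om_gv.
  by exists (inner n m_gt0 0); rewrite om_gv.
have [k _ <-] := mark_prev_reach (esym ov).
by exists (iter k (@lsh n m) v); rewrite gv_iter.
Qed.

Definition iv v : A := ep (gv v).
Definition ia (a : arrow QL) : A :=
  match a with
  | inl (inl (inl (inl i))) => ax aD (gv (inl i))
  | inl (inl (inl (inr i))) => yA (gv (inl i))
  | inl (inl (inr i)) => ax aD (gv (inr (ord_pred i)))
  | inl (inr i) => yA (gv (inr (ord_pred i)))
  | inr o => br o
  end.

Lemma iv_M u v : iv u * iv v = if u == v then iv u else 0.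
Proof. by rewrite /iv ee_M // (inj_eq gv_inj). Qed.

Lemma gv_predl (i : 'I_n) : gv (inl (ord_pred i)) = mnext (gv (inl i)).
Proof. exact: (gv_shi (inl i)). Qed.
Lemma gv_predr (i : 'I_m) : gv (inr i) = mnext (gv (inr (ord_pred i))).
Proof. by rewrite -[inr (ord_pred i)]/(lsh (inr i)) gv_sh mark_prevK. Qed.

Lemma ia_tgt (a : arrow QL) : iv (qtgt a) * ia a = ia a.
Proof.
case: a => [[[[i|i]|i]|i]|o].
- exact: (ee_ax E_a).
- have -> : iv (@qtgt QL (arrow_y m i)) = ep (mnext (gv (inl i))) by rewrite -gv_predl.
  by rewrite /ia ee_yy.
- exact: (ee_ax E_a).
- have -> : iv (@qtgt QL (arrow_ybar n i)) = ep (mnext (gv (inr (ord_pred i)))).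
    by rewrite -gv_predr.
  by rewrite /ia ee_yy.
have -> : iv (@qtgt QL (inr o)) = ep (mvt o) by rewrite -gv_vt /lvt; case: o.
exact: br_tgt.
Qed.

Lemma ia_src (a : arrow QL) : ia a * iv (qsrc a) = ia a.
Proof.
case: a => [[[[i|i]|i]|i]|o].
- have -> : iv (@qsrc QL (arrow_x m i)) = ep (mnext (gv (inl i))) by rewrite -gv_predl.
  by rewrite /ia ax_ee.
- by rewrite /ia /iv yy_ee.
- have -> : iv (@qsrc QL (arrow_xbar n i)) = ep (mnext (gv (inr (ord_pred i)))).
    by rewrite -gv_predr.
  by rewrite /ia ax_ee.
- by rewrite /ia /iv yy_ee.
have -> : iv (@qsrc QL (inr o)) = ep (mvs o) by rewrite -gv_vs /lvs; case: o.
exact: br_src.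
Qed.

Local Notation im := (@imap K QL QD rel iv ia).

(** [ord_pred i] occurs because [ax] and [yA] are indexed by target and source respectively:
    [arrow_xbar i] ends and [arrow_ybar i] starts at that vertex. *)
Definition xs (o : bool) : A := if o then \sum_(i < n) ax aD (gv (inl i))
  else \sum_(i < m) ax aD (gv (inr (ord_pred i))).
Definition ys (o : bool) : A := if o then \sum_(i < n) yA (gv (inl i))
  else \sum_(i < m) yA (gv (inr (ord_pred i))).

Lemma sum_marks (F : mark -> A) :
  \sum_p F p = \sum_(i < n) F (gv (inl i)) + \sum_(i < m) F (gv (inr (ord_pred i))).
Proof.
have [gi hgi] : exists gi, cancel gi gv.
  have [gi h] := choice gv_surj; by exists gi.
have gb : bijective gv by exists gi => // v; apply: gv_inj; rewrite hgi.
rewrite (reindex gv) /=; last exact: onW_bij.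
rewrite big_sumType /=; congr (_ + _).
rewrite (reindex_inj (h := @ord_pred m)) //; exact: can_inj (@ord_predK m).
Qed.

Lemma xsE : XA = xs true + xs false. Proof. exact: sum_marks. Qed.
Lemma ysE : YA = ys true + ys false. Proof. exact: sum_marks. Qed.

Lemma im_x1 : im (\sum_(i < n) arr K (arrow_x m i : arrow QL)) = xs true.
Proof.
rewrite imap_sum; apply: eq_bigr => i _.
exact: (imap_arr ia_src (arrow_x m i : arrow QL)).
Qed.

Lemma im_x0 : im (\sum_(i < m) arr K (arrow_xbar n i : arrow QL)) = xs false.
Proof.
rewrite imap_sum; apply: eq_bigr => i _.
exact: (imap_arr ia_src (arrow_xbar n i : arrow QL)).
Qed.

Lemma im_y1 : im (\sum_(i < n) arr K (arrow_y m i : arrow QL)) = ys true.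
Proof.
rewrite imap_sum; apply: eq_bigr => i _.
exact: (imap_arr ia_src (arrow_y m i : arrow QL)).
Qed.

Lemma im_y0 : im (\sum_(i < m) arr K (arrow_ybar n i : arrow QL)) = ys false.
Proof.
rewrite imap_sum; apply: eq_bigr => i _.
exact: (imap_arr ia_src (arrow_ybar n i : arrow QL)).
Qed.

Lemma im_t o : im (arr K (inr o : arrow QL)) = br o.
Proof. exact: (imap_arr ia_src (inr o : arrow QL)). Qed.
Lemma im_v v : im (vtx K (v : vertex QL)) = ep (gv v).
Proof. exact: imap_vtx. Qed.
Lemma im1 : im 1 = \sum_p ep p.
Proof.
rewrite imap1 (sum_marks ep) big_sumType /=; congr (_ + _).
by rewrite [LHS](reindex_inj (h := @ord_pred m)) //; exact: can_inj (@ord_predK m).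
Qed.

Lemma ep0 p q : om p != om q -> ep p * ep q = 0.
Proof. by rewrite ee_M //; case: (p =P q) => // ->; rewrite eqxx. Qed.

Lemma sum_ep p : (\sum_q ep q) * ep p = ep p.
Proof.
rewrite mulr_suml (bigD1 p) //= ee_M // eqxx big1 ?addr0 // => q /negPf nq.
by rewrite ee_M // nq.
Qed.

Lemma om_r (j : 'I_m) : om (gv (inr j)) = false. Proof. exact: om_gv. Qed.
Lemma om_l (i : 'I_n) : om (gv (inl i)) = true. Proof. exact: om_gv. Qed.

Lemma ax_side p q : om p != om q -> ax aD p * ep q = 0 /\ ep q * ax aD p = 0.
Proof.
move=> h; rewrite -(@ax_ee n m T A eA aD E_gm a_E p) -(mulrA (ax _ _)).
rewrite ep0 ?outer_mark_next // mulr0.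
by rewrite ax_ee // -(@ee_ax n m T A eA aD E_a p) mulrA ep0 ?mul0r // eq_sym.
Qed.

Lemma yy_side p q : om p != om q -> yA p * ep q = 0 /\ ep q * yA p = 0.
Proof.
move=> h; rewrite -(@yy_ee n m n_gt0 m_gt0 T A eA aD EM p) -(mulrA (yA _)) ep0 // mulr0.
by rewrite yy_ee // -(@ee_yy n m n_gt0 m_gt0 T A eA aD EM E_gm E_a p) mulrA
  ep0 ?mul0r // eq_sym outer_mark_next.
Qed.

Lemma xs0 p : xs (~~ om p) * ep p = 0.
Proof.
case e : (om p); rewrite /= mulr_suml big1 // => i _.
  by have [] := @ax_side (gv (inr (ord_pred i))) p; rewrite ?om_r ?e.
by have [] := @ax_side (gv (inl i)) p; rewrite ?om_l ?e.
Qed.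
Lemma ep_xs0 p : ep p * xs (~~ om p) = 0.
Proof.
case e : (om p); rewrite /= mulr_sumr big1 // => i _.
  by have [] := @ax_side (gv (inr (ord_pred i))) p; rewrite ?om_r ?e.
by have [] := @ax_side (gv (inl i)) p; rewrite ?om_l ?e.
Qed.
Lemma ys0 p : ys (~~ om p) * ep p = 0.
Proof.
case e : (om p); rewrite /= mulr_suml big1 // => i _.
  by have [] := @yy_side (gv (inr (ord_pred i))) p; rewrite ?om_r ?e.
by have [] := @yy_side (gv (inl i)) p; rewrite ?om_l ?e.
Qed.
Lemma ep_ys0 p : ep p * ys (~~ om p) = 0.
Proof.
case e : (om p); rewrite /= mulr_sumr big1 // => i _.
  by have [] := @yy_side (gv (inr (ord_pred i))) p; rewrite ?om_r ?e.
by have [] := @yy_side (gv (inl i)) p; rewrite ?om_l ?e.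
Qed.

Lemma epK p : ep p * ep p = ep p. Proof. by rewrite ee_M // eqxx. Qed.
Let XAe := @XX_shift n m T A eA aD EM E_gm E_a a_E.
Let YAe := @YY_shift n m n_gt0 m_gt0 T A eA aD EM E_gm E_a.
Let omn := @outer_mark_next n m.
Let omp := @outer_mark_prev n m.

Lemma im1_ep p : im 1 * ep p = ep p. Proof. by rewrite im1 sum_ep. Qed.
Lemma im1_br o : im 1 * br o = br o.
Proof. by rewrite -(br_tgt o) mulrA im1_ep. Qed.
Lemma br_im1 o : br o * im 1 = br o.
Proof.
rewrite im1 mulr_sumr (bigD1 (mvs o)) //= br_src big1 ?addr0 // => p np.
by rewrite -(br_src o) -mulrA ee_M // eq_sym (negPf np) mulr0.
Qed.

Lemma xs_ys_ep p a : ep p * a = a -> xs (om p) * ys (om p) * a = XA * YA * a.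
Proof. exact: (xs_ys_mul xsE ysE xs0 ys0 YAe omn). Qed.
Lemma ys_xs_ep p a : ep p * a = a -> ys (om p) * xs (om p) * a = YA * XA * a.
Proof. exact: (xs_ys_mul ysE xsE ys0 xs0 XAe omp). Qed.
Lemma mul_xs_ys_ep p a : a * ep p = a -> a * xs (om p) * ys (om p) = a * XA * YA.
Proof. exact: (mul_xs_ys xsE ysE ep_xs0 ep_ys0 XAe omn (@mark_nextK n m)). Qed.
Lemma mul_ys_xs_ep p a : a * ep p = a -> a * ys (om p) * xs (om p) = a * YA * XA.
Proof. exact: (mul_xs_ys ysE xsE ep_ys0 ep_xs0 YAe omp (@mark_prevK n m)). Qed.

Lemma XY_ep p a : ep p * a = a -> XA * YA * a = YA * XA * a.
Proof. by move=> <-; rewrite !(mulrA _ (ep p)) (XYC n_gt0 m_gt0 EM E_gm E_a a_E dim). Qed.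
Lemma ep_XY p a : a * ep p = a -> a * XA * YA = a * YA * XA.
Proof.
move=> <-; rewrite -!(mulrA (a * ep p)) -!(mulrA a).
have := XYC n_gt0 m_gt0 EM E_gm E_a a_E dim p.
have e1 : XA * YA * ep p = ep p * (XA * YA).
  by rewrite -(mulrA XA) YAe (mulrA XA) XAe mark_nextK -(mulrA (ep p)).
have e2 : YA * XA * ep p = ep p * (YA * XA).
  by rewrite -(mulrA YA) XAe (mulrA YA) YAe mark_prevK -(mulrA (ep p)).
by rewrite e1 e2 => ->.
Qed.

Lemma im_rel f : lrel f -> im f = 0.
Proof.
have rel3 := @imap_rel3 K QL QD rel iv ia iv_M ia_tgt.
have rsh := @imap_shift K QL QD rel iv ia iv_M ia_tgt.
have rsq := @imap_square K QL QD rel iv ia iv_M ia_tgt.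
have br_XY o : br o * XA * YA = XA * YA * br o.
  by rewrite -(mulrA (br o)); case: (o); apply: (zz_XY n_gt0 m_gt0 EM E_gm E_a a_E dim).
have hsq p i : (i < bs (om p))%N -> iter i mprev p = mvs (om p) ->
    ys (om p) ^+ 2 * ep p = xs (om p) ^+ (bs (om p) - 1 - i) * br (~~ om p) *
      xs (~~ om p) ^+ (bs (~~ om p)).+1 * br (om p) * xs (om p) ^+ i * ep p.
  move=> lt ei; rewrite (xs_exp ysE ys0 YAe omn) expr2 (YYA lt ei).
  by rewrite (side_word xsE xs0 XAe omp epK br_tgt om_mvt).
have hsh o : br o = xs (~~ o) ^+ bs (~~ o) * br o * xs o ^+ bs o.
  by rewrite (xs_t_xs xsE xs0 ep_xs0 XAe omp (@mark_nextK n m) br_src br_tgt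
    om_mvs om_mvt) -br_shift.
have find v : exists2 i, (i < bs (om (gv v)))%N & iter i mprev (gv v) = mvs (om (gv v)) /\
    iter i (@lsh n m) v = lvs n_gt0 m_gt0 (lside v).
  have [i lt ei] := lsh_reach n_gt0 m_gt0 v; exists i; rewrite om_gv //.
  by rewrite -gv_iter ei gv_vs.
case=> [v|v|v|v||||].
- have h1 := xs_ys_ep (epK (gv (inl v))); have h2 := ys_xs_ep (epK (gv (inl v))).
  have h := XY_ep (epK (gv (inl v))); rewrite -h1 -h2 om_gv in h.
  exact: (rel3 _ _ _ _ _ _ _ _ _ _ _ _ im_x1 im_y1 (im_v (inl v)) im_y1 im_x1 (im_v (inl v)) h).
- have h1 := xs_ys_ep (epK (gv (inr v))); have h2 := ys_xs_ep (epK (gv (inr v))).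
  have h := XY_ep (epK (gv (inr v))); rewrite -h1 -h2 om_gv in h.
  exact: (rel3 _ _ _ _ _ _ _ _ _ _ _ _ im_x0 im_y0 (im_v (inr v)) im_y0 im_x0 (im_v (inr v)) h).
- have [i lt [ei ei']] := find (inl v).
  have -> : findex (@ordS n) v (Ordinal (ltn_pmod 1 n_gt0)) = i.
    apply: (findex_eq (d := n)) => //; first exact: can_inj (@ordSK n).
    + by move=> k l; apply: ordS_mod.
    + by rewrite om_gv in lt.
    by move: ei'; rewrite iter_lsh_inl => -[].
  have h : ys true ^+ 2 * ep (gv (inl v)) = xs true ^+ (n - 1 - i) * br false *
      xs false ^+ m.+1 * br true * xs true ^+ i * ep (gv (inl v)).
    by have := hsq _ _ lt ei; rewrite om_gv.
  exact: (rsq _ _ _ _ _ _ _ _ _ _ _ _ _ _ _ _ _ _ _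
    im_y1 (im_v (inl v)) im_x1 (im_t false) im_x0 (im_t true)
    im_x1 (im_v (inl v)) (im1_br _) (im1_br _) (im1_ep _) h).
- have [i lt [ei ei']] := find (inr v).
  have -> : findex (@ord_pred m) v (Ordinal (ltn_pmod m m_gt0)) = i.
    apply: (findex_eq (d := m)) => //; first exact: can_inj (@ord_predK m).
    + by move=> k l; apply: ord_pred_mod.
    + by rewrite om_gv in lt.
    by move: ei'; rewrite iter_lsh_inr => -[].
  have h : ys false ^+ 2 * ep (gv (inr v)) = xs false ^+ (m - 1 - i) * br true *
      xs true ^+ n.+1 * br false * xs false ^+ i * ep (gv (inr v)).
    by have := hsq _ _ lt ei; rewrite om_gv.
  exact: (rsq _ _ _ _ _ _ _ _ _ _ _ _ _ _ _ _ _ _ _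
    im_y0 (im_v (inr v)) im_x0 (im_t true) im_x1 (im_t false)
    im_x0 (im_v (inr v)) (im1_br _) (im1_br _) (im1_ep _) h).
- exact: (rsh _ _ _ _ _ _ _ _ _ _ (im_t _) im_x0 (im_t _) im_x1 (br_im1 _) (im1_br _) (hsh true)).
- exact: (rsh _ _ _ _ _ _ _ _ _ _ (im_t _) im_x1 (im_t _) im_x0 (br_im1 _) (im1_br _) (hsh false)).
- have h1 := ys_xs_ep (br_tgt false); have h2 := mul_xs_ys_ep (br_src false).
  rewrite om_mvt in h1; rewrite om_mvs in h2.
  have h := XY_ep (br_tgt false); rewrite -h1 -br_XY -h2 in h.
  exact: (rel3 _ _ _ _ _ _ _ _ _ _ _ _ im_y1 im_x1 (im_t _) (im_t _) im_x0 im_y0 (esym h)).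
- have h1 := xs_ys_ep (br_tgt true); have h2 := mul_ys_xs_ep (br_src true).
  rewrite om_mvt in h1; rewrite om_mvs in h2.
  have h := ep_XY (br_src true); rewrite -h2 br_XY -h1 in h.
  exact: (rel3 _ _ _ _ _ _ _ _ _ _ _ _ im_x0 im_y0 (im_t _) (im_t _) im_y1 im_x1 h).
Qed.

Local Notation G := (@cmap K QL QD lrel rel iv ia).
Local Notation e_bd := (vertex_idem rel (@boundary_vertex D)).

Lemma GD a b : G (a + b) = G a + G b.
Proof. exact: (@cmapD K QL QD lrel rel iv ia iv_M ia_tgt im_rel). Qed.
Lemma GZ c a : G (c *: a) = c *: G a.
Proof. exact: (@cmapZ K QL QD lrel rel iv ia iv_M ia_tgt im_rel). Qed.
Lemma GM a b : G (a * b) = G a * G b.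
Proof. exact: (@cmapM K QL QD lrel rel iv ia iv_M ia_tgt im_rel). Qed.
Lemma G0 : G 0 = 0. Proof. by rewrite -(scale0r 0) GZ scale0r. Qed.
Lemma G_el v : G (el v) = ep (gv v).
Proof. exact: (@cmap_vcl K QL QD lrel rel iv ia iv_M ia_tgt im_rel). Qed.
Lemma G_al (a : arrow QL) : G (al a) = ia a.
Proof. exact: (@cmap_acl K QL QD lrel rel iv ia iv_M ia_tgt ia_src im_rel). Qed.
Lemma G_t o : G (lt_ K n_gt0 m_gt0 o) = br o. Proof. exact: G_al. Qed.
Lemma G_sum I (s : seq I) (P : pred I) (F : I -> LA) :
  G (\sum_(i <- s | P i) F i) = \sum_(i <- s | P i) G (F i).
Proof. exact: (big_morph _ GD G0). Qed.
Lemma G_X : G (XL K n_gt0 m_gt0) = XA.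
Proof.
rewrite xsE GD; congr (_ + _); rewrite [LHS]G_sum; apply: eq_bigr => i _; exact: G_al.
Qed.
Lemma G_Y : G (YL K n_gt0 m_gt0) = YA.
Proof.
rewrite ysE GD; congr (_ + _); rewrite [LHS]G_sum; apply: eq_bigr => i _; exact: G_al.
Qed.

(** Degrees in Lambda are read off from the images under [G]. So Lambda needs no grading of its own,
    and its paths are nonzero because their images are. *)
Definition pll (a : LA) u v w := [/\ el v * a = a, a * el u = a & pla (G a) (gv u) (gv v) w].

Lemma pll_unique a u v w u' v' w' :
  pll a u v w -> pll a u' v' w' -> [/\ u = u', v = v' & w = w'].
Proof.
move=> [_ _ h] [_ _ h']; have [e1 e2 ->] := pla_unique h h'.
by rewrite (gv_inj e1) (gv_inj e2).
Qed.
Lemma pllM a b i j k w w' : pll a j k w -> pll b i j w' -> pll (a * b) i k (w + w').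
Proof.
move=> [h1 h2 h3] [h1' h2' h3']; split; first by rewrite mulrA h1.
  by rewrite -mulrA h2'.
by rewrite GM; apply: plaM h3 h3'.
Qed.
Lemma pll_neq0 a u v w : pll a u v w -> a <> 0.
Proof. by move=> [_ _ h] e; apply: (pla_neq0 h); rewrite e G0. Qed.
Lemma pll_tgt a u v w : pll a u v w -> el v * a = a. Proof. by case. Qed.
Lemma pll_e v : pll (el v) v v 0.
Proof. by split; [exact: vclK|exact: vclK|rewrite G_el; exact: pla_e]. Qed.
Lemma pll_X v : pll (XL K n_gt0 m_gt0 * el v) v (lsh v)
  (0, - (delta bs (lside v) + delta bs (lside v))).
Proof.
split; first by rewrite XL_shift mulrA vclK.
  by rewrite -mulrA vclK.
by rewrite GM G_X G_el gv_sh -om_gv; exact: pla_X.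
Qed.
Lemma pll_Y v : pll (YL K n_gt0 m_gt0 * el v) v (lshi v)
  (1, delta bs (lside v) + delta bs (lside v)).
Proof.
split; first by rewrite YL_shift mulrA vclK.
  by rewrite -mulrA vclK.
by rewrite GM G_Y G_el gv_shi -om_gv; exact: pla_Y.
Qed.
Lemma pll_t o : pll (lt_ K n_gt0 m_gt0 o) (lvs n_gt0 m_gt0 o) (lvt n_gt0 m_gt0 o)
  ((if o then 2%:Z else 0), omega o).
Proof.
split; [exact: lt_tgt|exact: lt_src|].
by rewrite G_t gv_vs gv_vt; exact: pla_br.
Qed.

Lemma lambda_path_pll (u : V) (s : seq (arrow QL)) : is_qpath (u : vertex QL) s ->
  exists w, pll (pcl lrel u s) u (qend (u : vertex QL) s) w.
Proof.
move=> /(lpath_pcl K); exact: (lpath_pl pllM pll_tgt pll_e pll_X pll_Y pll_t).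
Qed.

Lemma lambda_thin (u : V) (s s' : seq (arrow QL)) v w :
  is_qpath (u : vertex QL) s -> is_qpath (u : vertex QL) s' ->
  pll (pcl lrel u s) u v w -> pll (pcl lrel u s') u v w -> pcl lrel u s = pcl lrel u s'.
Proof.
move=> hs hs' h h'.
have [w1 h1] := lambda_path_pll hs; have [_ e1 _] := pll_unique h h1.
have [w2 h2] := lambda_path_pll hs'; have [_ e2 _] := pll_unique h' h2.
have l1 := lpath_pcl K hs; have l2 := lpath_pcl K hs'.
rewrite -e1 in l1; rewrite -e2 in l2.
exact: (lpath_thin bs_gt0 (vclM lrel) (XL_shift K n_gt0 m_gt0) (lt_src K n_gt0 m_gt0)
  (@lshiK n m) (@lside_sh n m) (lside_vs n_gt0 m_gt0) (lside_vt n_gt0 m_gt0)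
  (lsh_vt n_gt0 m_gt0) (@lsh_mod n m) (XYL K n_gt0 m_gt0) (lt_XY K n_gt0 m_gt0)
  (lt_shift K n_gt0 m_gt0) (@lYY K n m n_gt0 m_gt0) (lsh_reach n_gt0 m_gt0)
  pll_unique pllM pll_neq0 pll_tgt pll_e pll_X pll_Y pll_t l1 l2 h h').
Qed.

(* Paths of Lambda are determined by the ends and the degree of their images, so
   that the choice below inverts G on classes of paths. *)
Definition lambda_lift_at (i j : vertex QD) (w : int * int) : LA :=
  match pselect (exists us : V * seq (arrow QL), is_qpath (us.1 : vertex QL) us.2 /\
    plike (G (pcl lrel us.1 us.2)) i j w) with
  | left h => let us := projT1 (cid h) in pcl lrel us.1 us.2
  | right _ => 0
  end.

Lemma lambda_lift_atE (u : V) (s : seq (arrow QL)) i j w : is_qpath (u : vertex QL) s ->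
  plike (G (pcl lrel u s)) i j w -> lambda_lift_at i j w = pcl lrel u s.
Proof.
move=> hs h; rewrite /lambda_lift_at; case: pselect => [ex|[]]; last by exists (u, s).
case: (cid ex) => -[u' s'] [hs' h'] /=; rewrite /= in hs' h'.
have [w1 p1] := lambda_path_pll hs; have [w2 p2] := lambda_path_pll hs'.
have [_ _ q1] := p1; have [_ _ q2] := p2.
have [e1 e2 ew] := pathlike_unique n_gt0 m_gt0 h q1.
have [e1' e2' ew'] := pathlike_unique n_gt0 m_gt0 h' q2.
have eu : u' = u := gv_inj (bv_inj (etrans (esym e1') e1)).
have eq : qend (u' : vertex QL) s' = qend (u : vertex QL) s :=
  gv_inj (bv_inj (etrans (esym e2') e2)).
rewrite eq -ew' ew in p2; rewrite eu in hs' p2 *.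
exact: lambda_thin hs' hs p2 p1.
Qed.

Definition back : A -> LA := graded_lift lambda_lift_at.

Lemma backD a b : back (a + b) = back a + back b. Proof. exact: graded_liftD. Qed.
Lemma backZ c a : back (c *: a) = c *: back a. Proof. exact: graded_liftZ. Qed.

Lemma back_pcl (u : V) (s : seq (arrow QL)) : is_qpath (u : vertex QL) s ->
  back (G (pcl lrel u s)) = pcl lrel u s.
Proof.
move=> hs; have [w [_ _ h]] := lambda_path_pll hs.
have := lambda_lift_atE hs h; case: h => s' [hs' e1 e2 e3] e.
by rewrite e3 /back graded_lift_pcl // e1 e2 e.
Qed.

Lemma backK a : back (G a) = a.
Proof.
elim/classW: a => f; elim/path_algebra_ind: f => [|f g IHf IHg|c p].
- by rewrite class0 G0 -(scale0r (0 : A)) backZ scale0r.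
- by rewrite classD GD backD IHf IHg.
rewrite classZ of_path_word -pclE GZ backZ; congr (_ *: _).
exact: back_pcl (valP p).
Qed.

Definition gen (t : A) := exists a, G a = t.

Lemma genM t t' : gen t -> gen t' -> gen (t * t').
Proof. by move=> [a <-] [b <-]; exists (a * b); exact: GM. Qed.
Lemma gen_ep p : gen (ep p).
Proof. by have [v <-] := gv_surj p; exists (el v); exact: G_el. Qed.
Lemma gen_X : gen XA. Proof. by exists (XL K n_gt0 m_gt0); exact: G_X. Qed.
Lemma gen_y p : gen (yA p).
Proof.
have -> : yA p = YA * ep p by rewrite YY_ee.
apply: genM (gen_ep p); by exists (YL K n_gt0 m_gt0); exact: G_Y.
Qed.
Lemma gen_br o : gen (br o). Proof. by exists (lt_ K n_gt0 m_gt0 o); exact: G_t. Qed.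

Lemma follows_path (c : node) (s : seq (arrow QD)) :
  is_qpath (@qtgt QD c) s -> follows (T := T) c s.
Proof.
elim: s c => [|d s IH] c; first by [].
rewrite (is_qpath_cons (Q := QD)) => /andP[h /IH {}IH].
apply/andP; split; last exact: IH.
move: h; rewrite arrow_src_sgi arrow_tgt_eq => /orP[] /eqP ->.
  by rewrite sgiK eqxx.
by rewrite nxtE gmK sgiK eqxx orbT.
Qed.

Lemma steps_path (c : node) (s : seq (arrow QD)) :
  steps (T := T) aD (eA c) s = pcl rel (@qtgt QD c) s.
Proof.
elim/last_ind: s => [|s d IH]; first by rewrite pcl_nil.
by rewrite pcl_rcons -IH /steps foldl_rcons.
Qed.

(** At a boundary vertex the two standard paths of [gen_steps] are an arrow y and the trivial path,
    both in the image of [G]. *)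
Lemma gen_path p q (s : seq (arrow QD)) : is_qpath (bv p) s -> qend (bv p) s = bv q ->
  gen (pcl rel (bv p) s).
Proof.
move=> hs; rewrite /qend /bv last_map => /eqP; rewrite arrow_tgt_eq => h.
have hl : (last (inr p) s == inr q) || (last (inr p) s == gm (inr q)).
  by case/orP: h => /eqP ->; rewrite ?gmK eqxx ?orbT.
have [g gg] := gen_steps EM E_gm E_a a_E dim b0P genM gen_ep gen_X gen_y gen_br
  (follows_path hs) hl.
rewrite steps_path => -[->|->]; first exact: genM gg (gen_y p).
rewrite tl_mark; last by rewrite nxt_gm is_mark_sg.
by rewrite E_gm; apply: genM gg (gen_ep p).
Qed.

Lemma e_bdE : e_bd = \sum_p ep p.
Proof.
rewrite /vertex_idem class_sum.
rewrite (eq_bigl (mem (bv @: [set: mark]))) => [|v]; last first.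
  apply/boundary_vertexP/imsetP => [[p ->]|[p _ ->]]; first by exists p.
  by exists p.
rewrite big_imset /=; last by move=> p q _ _; exact: bv_inj.
by apply: eq_big => [p|p _]; rewrite ?inE // -vclE.
Qed.

Lemma G1 : G 1 = e_bd.
Proof. by rewrite e_bdE -im1 imap1; exact: (@cmap1 K QL QD lrel rel iv ia iv_M ia_tgt im_rel). Qed.

Lemma e_bd_vcl (x : vertex QD) : (e_bd * vcl rel x = 0 /\ vcl rel x * e_bd = 0) \/
  exists2 p, x = bv p & e_bd * vcl rel x = vcl rel x /\ vcl rel x * e_bd = vcl rel x.
Proof.
rewrite e_bdE; have [/boundary_vertexP[p ->]|nx] := boolP (boundary_vertex x).
  right; exists p => //; split; first exact: sum_ep.
  rewrite mulr_sumr (bigD1 p) //= big1 => [|q nq]; first by rewrite addr0 epK.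
  by rewrite -/(bv p) -[vcl rel (bv p)]/(ep p) ee_M // eq_sym (negPf nq).
have ne p : (x == bv p) = false.
  by apply: contraNF nx => /eqP ->; apply/boundary_vertexP; exists p.
left; rewrite mulr_suml mulr_sumr.
split; apply: big1 => p _; rewrite /ee /eD -/(bv p) vclM ?ne //.
by rewrite eq_sym ne.
Qed.

Lemma gen_corner t : gen (e_bd * t * e_bd).
Proof.
elim/classW: t => f; elim/path_algebra_ind: f => [|f g [a ea] [b eb]|c p].
- by exists 0; rewrite class0 mulr0 mul0r G0.
- by exists (a + b); rewrite classD GD ea eb mulrDr mulrDl.
rewrite classZ of_path_word -pclE -quiver_algebra_scalerAr -quiver_algebra_scalerAl.
suff [a ea] : gen (e_bd * pcl rel (val p).1 (val p).2 * e_bd).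
  by exists (c *: a); rewrite GZ ea.
case: p => -[v s] /= hs.
rewrite -(vcl_pcl rel v s) -(pcl_vcl rel v s) !mulrA.
have [[-> _]|[q eq [-> _]]] := e_bd_vcl (qend v s).
  by exists 0; rewrite !mul0r G0.
rewrite -(mulrA _ (vcl rel v)).
have [[_ ->]|[p ep' [_ ->]]] := e_bd_vcl v.
  by exists 0; rewrite mulr0 G0.
rewrite vcl_pcl pcl_vcl; rewrite ep' in hs eq *.
exact: gen_path hs eq.
Qed.

Lemma G_corner a : G a \in @in_corner K QD rel (@boundary_vertex D).
Proof. by apply/eqP; rewrite -G1 -!GM mul1r mulr1. Qed.

Lemma in_corner_G t : t \in @in_corner K QD rel (@boundary_vertex D) -> G (back t) = t.
Proof. by move=> /eqP <-; have [a <-] := gen_corner t; rewrite backK. Qed.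

Definition to_lambda (x : boundary_algebra D K) : LA := back (corner_val x).

Lemma to_lambda_is_linear : linear to_lambda.
Proof. by move=> c x y; rewrite /to_lambda /= backD backZ. Qed.

(** [back] is only linear by construction; on the corner it is multiplicative because it inverts the
    multiplicative map [G] there. *)
Lemma to_lambda_is_monoid_morphism : GRing.monoid_morphism to_lambda.
Proof.
split=> [|x y]; first by rewrite /to_lambda /= -G1 backK.
rewrite /to_lambda /= -[RHS]backK GM.
by rewrite !in_corner_G //; [case: (y)|case: (x)].
Qed.

Lemma to_lambda_bijective : bijective to_lambda.
Proof.
exists (fun a => Corner (G_corner a)) => [x|a]; last exact: backK.
by apply: val_inj => /=; apply: in_corner_G; case: (x).
Qed.

HB.instance Definition _ := GRing.isLinear.Build K (boundary_algebra D K) LA *:%R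
  to_lambda to_lambda_is_linear.
Lemma boundary_algebra_iso : exists f : {linear boundary_algebra D K -> LA},
  GRing.monoid_morphism f /\ bijective f.
Proof.
exists to_lambda; split; [exact: to_lambda_is_monoid_morphism|exact: to_lambda_bijective].
Qed.
End Comparison.

Theorem proposition13p5 (R : realType) (n m : nat)
    (n_gt0 : (0 < n)%N) (m_gt0 : (0 < m)%N) (T : annulus_triangulation n m) :
  exists f : {linear boundary_algebra (triangulation_diagram T) R[i]
                       -> Lambda R[i] n_gt0 m_gt0},
    GRing.monoid_morphism f /\ bijective f.
Proof.
have [b0 [i0 [j0 h]]] := exists_bridge n_gt0 m_gt0 T.
exact: boundary_algebra_iso h.
Qed.
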